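(* Let $(A,\mathfrak{m})$ be a Cohen-Macaulay local ring of dimension $d=2$ with infinite residue field $k$, let $I$ be an $\mathfrak{m}$-primary ideal of $A$, and let $Q$ be a parameter ideal of $A$ which is a reduction of $I$. Let $\mathcal{S}$ be the Sally module of $I$ with respect to $Q$, let $G$ be the associated graded ring of $I$, and write $\mathrm{e}_i=\mathrm{e}_i(I)$. The following conditions are equivalent: (1) $I^3=QI^2$, $\mathfrak{m}I^2\subseteq QI$, $\ell_A(I^2/QI)=4$, and $\ell_A(I^3/Q^2I)<8$. (2) $\mathfrak{m}\mathcal{S}=0$ and the graded minimal $B$-free resolution of $\mathcal{S}$ is of one of the forms (i) $0\to B(-2)\to B(-1)^{\oplus 4}\to\mathcal{S}\to 0$, or (ii) $0\to B(-2)^{\oplus 2}\to B(-1)^{\oplus 4}\to\mathcal{S}\to 0$. When this is the case, $\operatorname{depth}G=0$ and the following hold. In case (i): $\ell_A(I^3/Q^2I)=7$, $\mathrm{e}_1=\mathrm{e}_0-\ell_A(A/I)+3$, $\mathrm{e}_1=\mathrm{e}_0-\ell_A(A/I)+\mathrm{e}_2+1$, and $$\ell_A(A/I^{n+1})=\mathrm{e}_0\binom{n+2}{2}-\mathrm{e}_1\binom{n+1}{1}+2\quad\text{for all } n\ge 1.$$ In case (ii): $\ell_A(I^3/Q^2I)=6$, $\mathrm{e}_1=\mathrm{e}_0-\ell_A(A/I)+2$, $\mathrm{e}_1=\mathrm{e}_0-\ell_A(A/I)+\mathrm{e}_2+2$, and $$\ell_A(A/I^{n+1})=\mathrm{e}_0\binom{n+2}{2}-\mathrm{e}_1\binom{n+1}{1}\quad\text{for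 all } n\ge 1.$$
   Context: $\ell_A(-)$ denotes length of $A$-modules. The Hilbert coefficients $\mathrm{e}_0(I),\mathrm{e}_1(I),\mathrm{e}_2(I)$ are the integers such that for all $n\gg 0$, $\ell_A(A/I^{n+1})=\mathrm{e}_0(I)\binom{n+2}{2}-\mathrm{e}_1(I)\binom{n+1}{1}+\mathrm{e}_2(I)$. $\mathcal{R}=A[It]$ and $\mathcal{T}=A[Qt]$ are the Rees algebras of $I$ and $Q$ ($t$ an indeterminate), graded by degree in $t$. $G=\mathcal{R}/I\mathcal{R}=\bigoplus_{n\ge 0}I^n/I^{n+1}$ is the associated graded ring of $I$. The Sally module of $I$ with respect to $Q$ is the finitely generated graded $\mathcal{T}$-module $\mathcal{S}=I\mathcal{R}/I\mathcal{T}=\bigoplus_{n\ge 1}I^{n+1}/IQ^n$ (with $\mathcal{S}_n=I^{n+1}/IQ^n$). Put $B=\mathcal{T}/\mathfrak{m}\mathcal{T}$, which is isomorphic as a graded ring to the polynomial ring $k[X_1,X_2]$ with $\deg X_i=1$. When $\mathfrak{m}\mathcal{S}=0$, $\mathcal{S}$ is regarded as a graded $B$-module. For a graded module $M$, $M(j)$ denotes the shift with $M(j)_n=M_{j+n}$; maps in graded resolutions are degree-preserving. *)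

(* Defs.v *)
From HB Require Import structures.
From mathcomp Require Import all_boot all_order all_algebra.
From mathcomp Require Import boolp classical_sets cardinality.

Set Implicit Arguments.
Unset Strict Implicit.
Unset Printing Implicit Defensive.

Import GRing.Theory.
Local Open Scope ring_scope.
Local Open Scope classical_set_scope.
Local Open Scope quotient_scope.

(* The value of a supremum of a set of natural numbers, when it is finite;
   dimension, length and depth are all expressed through it, as relations. *)
Definition is_max (P : nat -> Prop) (n : nat) : Prop :=
  P n /\ forall k, P k -> (k <= n)%N.

Identity Coercion set_Funclass : set >-> Funclass.

Section Submodules.
Variables (R : comPzRingType) (M : lmodType R).

Record submod := Submod {
  submod_set :> set M;
  submod0 : submod_set 0;
  submodD : forall x y, submod_set x -> submod_set y -> submod_set (x + y);
  submodZ : forall (a : R) x, submod_set x -> submod_set (a *: x) }.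

Lemma submodB (N : submod) x y :
  submod_set N x -> submod_set N y -> submod_set N (x - y).
Proof. by move=> Nx Ny; rewrite -scaleN1r; apply: submodD => //; apply: submodZ. Qed.

Definition submod_pred (N : submod) : {pred M} := fun x => `[< submod_set N x >].

Lemma submod_pred_closed (N : submod) : GRing.submod_closed (submod_pred N).
Proof.
split; first exact/asboolP/submod0.
move=> a x y /asboolP Nx /asboolP Ny; apply/asboolP.
by apply: submodD => //; apply: submodZ.
Qed.

HB.instance Definition _ (N : submod) :=
  GRing.isSubmodClosed.Build R M (submod_pred N) (submod_pred_closed N).

Lemma span_subproof (X : set M) :
  let S := [set x | forall N : submod, X `<=` N -> submod_set N x] in
  [/\ S 0, forall x y, S x -> S y -> S (x + y)
    & forall (a : R) x, S x -> S (a *: x)].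
Proof.
split=> [N _|x y Sx Sy N XN|a x Sx N XN]; first exact: submod0.
- by apply: submodD; [exact: Sx|exact: Sy].
- by apply: submodZ; exact: Sx.
Qed.

Definition span (X : set M) : submod :=
  let: And3 S0 SD SZ := span_subproof X in Submod S0 SD SZ.

Lemma spanP (X : set M) (x : M) :
  span X x <-> forall N : submod, X `<=` N -> N x.
Proof. by rewrite /span; case: span_subproof. Qed.

Lemma sub_span (X : set M) : X `<=` span X.
Proof. by move=> x Xx; apply/spanP => N; apply. Qed.

Lemma span_min (X : set M) (N : submod) : X `<=` N -> span X `<=` N.
Proof. by move=> XN x /spanP; apply. Qed.

Definition fullsub : submod := @Submod setT I (fun _ _ _ _ => I) (fun _ _ _ => I).

Definition proper_chain (n : nat) : Prop :=
  exists C : nat -> submod, forall i, (i < n)%N -> C i `<` C i.+1.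

Record subm (N : submod) := Subm {
  subm_val : M;
  subm_valP : subm_val \in submod_pred N }.

HB.instance Definition _ (N : submod) := [isSub for @subm_val N].
HB.instance Definition _ (N : submod) := [Choice of subm N by <:].
HB.instance Definition _ (N : submod) := [SubChoice_isSubLmodule of subm N by <:].

Definition quo (N : submod) : Type := Quotient.quot (submod_pred N).

HB.instance Definition _ (N : submod) := GRing.Zmodule.on (quo N).

Definition quo_proj (N : submod) (x : M) : quo N :=
  \pi_(Quotient.quot (submod_pred N)) x.

Definition quo_repr (N : submod) (u : quo N) : M :=
  repr (u : Quotient.quot (submod_pred N)).

Lemma quo_reprK (N : submod) : cancel (@quo_repr N) (@quo_proj N).
Proof. by move=> u; rewrite /quo_proj /quo_repr reprK. Qed.

Lemma quo_projB (N : submod) : {morph @quo_proj N : x y / x - y}.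
Proof. by move=> x y; rewrite /quo_proj raddfB. Qed.

Lemma quo_projD (N : submod) : {morph @quo_proj N : x y / x + y}.
Proof. by move=> x y; rewrite /quo_proj raddfD. Qed.

Lemma quo_projP (N : submod) (x y : M) :
  quo_proj N x = quo_proj N y <-> N (x - y).
Proof.
have E : (quo_proj N x == quo_proj N y) = `[< N (x - y) >].
  by rewrite /quo_proj -Quotient.idealrBE.
by split=> [/eqP|Nxy]; [|apply/eqP]; rewrite E; [move/asboolP|apply/asboolP].
Qed.

Definition quo_scale (N : submod) (a : R) (u : quo N) : quo N :=
  quo_proj N (a *: quo_repr u).

Lemma quo_projZ (N : submod) (a : R) (x : M) :
  quo_proj N (a *: x) = quo_scale a (quo_proj N x).
Proof.
apply/quo_projP; rewrite -scalerBr; apply: submodZ.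
by apply/quo_projP; rewrite quo_reprK.
Qed.

Lemma quo_scaleA (N : submod) (a b : R) (u : quo N) :
  quo_scale a (quo_scale b u) = quo_scale (a * b) u.
Proof. by rewrite -[u]quo_reprK -!quo_projZ scalerA. Qed.

Lemma quo_scale1 (N : submod) : left_id 1 (@quo_scale N).
Proof. by move=> u; rewrite -[u]quo_reprK -!quo_projZ scale1r. Qed.

Lemma quo_scaleDr (N : submod) : right_distributive (@quo_scale N) +%R.
Proof.
move=> a u v; rewrite -[u]quo_reprK -[v]quo_reprK.
by rewrite -quo_projD -!quo_projZ scalerDr quo_projD.
Qed.

Lemma quo_scaleDl (N : submod) (u : quo N) :
  {morph (@quo_scale N)^~ u : a b / a + b}.
Proof.
move=> a b; rewrite -[u]quo_reprK.
by rewrite -!quo_projZ scalerDl quo_projD.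
Qed.

HB.instance Definition _ (N : submod) :=
  GRing.Zmodule_isLmodule.Build R (quo N)
    (@quo_scaleA N) (@quo_scale1 N) (@quo_scaleDr N) (@quo_scaleDl N).

End Submodules.

Arguments fullsub {R} M.

(* [has_length M n]: the R-module M has finite length n. *)
Definition has_length (R : comPzRingType) (M : lmodType R) (n : nat) : Prop :=
  is_max (proper_chain M) n.

Section Subquotients.
Variables (R : comPzRingType) (M : lmodType R) (N L : submod M).

Definition pull_set : set (subm L) := [set x | N (val x)].

Lemma pull0 : pull_set 0. Proof. exact: submod0. Qed.
Lemma pullD x y : pull_set x -> pull_set y -> pull_set (x + y).
Proof. exact: submodD. Qed.
Lemma pullZ (a : R) x : pull_set x -> pull_set (a *: x).
Proof. exact: submodZ. Qed.
Definition pull : submod (subm L) := Submod pull0 pullD pullZ.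

(* L/N; the submodule N is meant to be contained in L. *)
Definition subquo : lmodType R := quo pull.

End Subquotients.

(* Ideals are the submodules of the regular module R^o. *)
Notation ideal R :=
  (@submod R (GRing.GRing_regular__canonical__GRing_Lmodule R)).


Section Ideals.
Variable R : comPzRingType.
Implicit Types (J K P : ideal R) (s : seq R).

Definition smul J (M : lmodType R) (N : submod M) : submod M :=
  span [set z | exists (a : R) (x : M), [/\ J a, N x & z = a *: x]].

Definition idmul J K : ideal R := smul J K.

Fixpoint idpow J (n : nat) : ideal R :=
  if n is n'.+1 then idmul J (idpow J n') else fullsub _.

Definition noetherian : Prop :=
  forall J, exists s, J = span ([set` s] : set R^o) :> set R.

Definition proper_ideal J : Prop := ~ J 1.

Definition prime_ideal P : Prop :=
  proper_ideal P /\ forall x y : R, P (x * y) -> P x \/ P y.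

Definition maximal_ideal J : Prop :=
  proper_ideal J /\
  forall K, J `<=` K -> proper_ideal K -> K = J :> set R.

Definition primary_ideal J : Prop :=
  proper_ideal J /\
  forall x y : R, J (x * y) -> J x \/ exists n : nat, J (y ^+ n).

Definition radical J : set R := [set x | exists n : nat, J (x ^+ n)].

Definition primary_to (m J : ideal R) : Prop :=
  primary_ideal J /\ radical J = m.

Definition local_ring (m : ideal R) : Prop :=
  [/\ noetherian, maximal_ideal m
    & forall J, maximal_ideal J -> J = m :> set R].

Definition krull_dim (d : nat) : Prop :=
  is_max (fun n => exists P : nat -> ideal R,
    (forall i, (i <= n)%N -> prime_ideal (P i)) /\
    (forall i, (i < n)%N -> P i `<` P i.+1)) d.

Definition regular_seq s : Prop :=
  (forall i x, (i < size s)%N ->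
     span ([set` take i s] : set R^o) (s`_i * x) ->
     span ([set` take i s] : set R^o) x) /\
  ~ span ([set` s] : set R^o) 1.

(* [depth m d]: the supremum of the lengths of the R-regular sequences of
   elements of m is d. *)
Definition depth (m : set R) (d : nat) : Prop :=
  is_max (fun n => exists s,
    [/\ size s = n, forall x, x \in s -> m x & regular_seq s]) d.

Definition cohen_macaulay (m : ideal R) : Prop :=
  exists d, krull_dim d /\ depth m d.

Definition parameter_ideal (m Q : ideal R) : Prop :=
  exists d s, [/\ krull_dim d, size s = d,
    Q = span ([set` s] : set R^o) :> set R & primary_to m Q].

Definition is_reduction (Q J : ideal R) : Prop :=
  Q `<=` J /\
  exists n : nat, idpow J n.+1 = idmul Q (idpow J n) :> set R.

(* e0, e1, e2 are the Hilbert coefficients of J in dimension 2. *)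
Definition hilbert_coefficients (J : ideal R) (e0 e1 e2 : int) : Prop :=
  exists N : nat, forall n : nat, (N <= n)%N ->
  exists2 l, has_length (quo (idpow J n.+1)) l
    & l%:Z = e0 * 'C(n + 2, 2)%:Z - e1 * 'C(n + 1, 1)%:Z + e2.

(* The same module as [quo J], with its structure of ring. *)
Definition quo_ring J : Type := quo J.

Section QuotientRing.
Variable J : ideal R.
Local Notation RJ := (quo_ring J).

HB.instance Definition _ := GRing.Zmodule.on RJ.

Definition ring_proj (x : R) : RJ := quo_proj J x.

Definition quo_ring_mul (u v : RJ) : RJ :=
  ring_proj ((quo_repr u : R) * (quo_repr v : R)).

Lemma quo_ring_mulE : {morph ring_proj : x y / x * y >-> quo_ring_mul x y}.
Proof.
move=> x y; apply/quo_projP.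
have E (z : R) : J (z - quo_repr (ring_proj z)).
  by apply/quo_projP; rewrite quo_reprK.
set x' := quo_repr _; set y' := quo_repr _.
have -> : x * y - x' * y' = y * (x - x') + x' * (y - y') :> R.
  by rewrite !mulrBr addrA [y * x]mulrC [y * x']mulrC subrK.
by apply: submodD; apply: (@submodZ _ _ J); exact: E.
Qed.

Lemma ring_reprK : cancel (@quo_repr _ _ J : RJ -> R) ring_proj.
Proof. exact: quo_reprK. Qed.

Lemma quo_ring_mulA : associative quo_ring_mul.
Proof.
move=> u v w; rewrite -[u]ring_reprK -[v]ring_reprK -[w]ring_reprK.
by rewrite -!quo_ring_mulE mulrA.
Qed.

Lemma quo_ring_mulC : commutative quo_ring_mul.
Proof.
by move=> u v; rewrite -[u]ring_reprK -[v]ring_reprK -!quo_ring_mulE mulrC.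
Qed.

Lemma quo_ring_mul1 : left_id (ring_proj 1) quo_ring_mul.
Proof. by move=> u; rewrite -[u]ring_reprK -quo_ring_mulE mul1r. Qed.

Lemma ring_projD : {morph ring_proj : x y / x + y}.
Proof. by move=> x y; exact: (@quo_projD _ _ J x y). Qed.

Lemma quo_ring_mulDl : left_distributive quo_ring_mul +%R.
Proof.
move=> u v w; rewrite -[u]ring_reprK -[v]ring_reprK -[w]ring_reprK.
by rewrite -ring_projD -!quo_ring_mulE mulrDl ring_projD.
Qed.

HB.instance Definition _ := GRing.Zmodule_isComPzRing.Build RJ
  quo_ring_mulA quo_ring_mulC quo_ring_mul1 quo_ring_mulDl.

Lemma ring_projM : {morph ring_proj : x y / x * y}.
Proof. exact: quo_ring_mulE. Qed.

End QuotientRing.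

Definition kills (X : set R) (M : lmodType R) : Prop :=
  forall (a : R) (x : M), X a -> a *: x = 0.

(* An R-module M killed by X, regarded as a module over R/(X). *)
Definition mod_over (X : set R) (M : lmodType R) (h : kills X M) : Type := M.

Section ModOver.
Variables (X : set R) (M : lmodType R) (h : kills X M).
Local Notation J := (span (X : set R^o)).

HB.instance Definition _ := GRing.Zmodule.on (mod_over h).

Lemma ann_subproof :
  let S := [set a : R^o | forall x : M, (a : R) *: x = 0] in
  [/\ S 0, forall a b, S a -> S b -> S (a + b)
    & forall (c : R) a, S a -> S (c *: a)].
Proof.
split=> [x|a b Sa Sb x|c a Sa x]; first by rewrite scale0r.
- by rewrite scalerDl Sa Sb addr0.
- by rewrite -[LHS]scalerA Sa scaler0.
Qed.

Lemma kills_span (a : R) (x : M) : J a -> a *: x = 0.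
Proof.
case: ann_subproof => S0 SD SZ.
have XS : X `<=` (Submod S0 SD SZ : ideal R) by move=> b Xb y; exact: h.
by move=> /spanP Ja; exact: (Ja _ XS).
Qed.

Definition over_scale (b : quo_ring J) (x : mod_over h) : mod_over h :=
  (quo_repr b : R) *: (x : M).

Lemma over_scaleE (a : R) (x : M) : over_scale (ring_proj J a) x = a *: x.
Proof.
apply/eqP; rewrite -subr_eq0 -scalerBl; apply/eqP/kills_span.
by apply/quo_projP; rewrite quo_reprK.
Qed.

Lemma over_scaleA (a b : quo_ring J) (x : mod_over h) :
  over_scale a (over_scale b x) = over_scale (a * b) x.
Proof.
rewrite -[a]ring_reprK -[b]ring_reprK.
by rewrite -(ring_projM J) !over_scaleE scalerA.
Qed.

Lemma over_scale1 : left_id 1 over_scale.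
Proof. by move=> x; rewrite [1]/(ring_proj J 1) over_scaleE scale1r. Qed.

Lemma over_scaleDr : right_distributive over_scale +%R.
Proof. by move=> a x y; exact: scalerDr. Qed.

Lemma over_scaleDl (x : mod_over h) : {morph over_scale^~ x : a b / a + b}.
Proof.
move=> a b; rewrite -[a]ring_reprK -[b]ring_reprK.
by rewrite -(ring_projD J) !over_scaleE scalerDl.
Qed.

HB.instance Definition _ := GRing.Zmodule_isLmodule.Build (quo_ring J)
  (mod_over h) over_scaleA over_scale1 over_scaleDr over_scaleDl.

End ModOver.
End Ideals.

(* A grading of M is given by its homogeneous components M_n, n in Z. *)
Definition shift (T : Type) (g : int -> set T) (j : int) : int -> set T :=
  fun n => g (j + n).

Definition copies (T : Type) (g : int -> set T) (r : nat) : int -> set 'rV[T]_r :=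
  fun n => [set v | forall i, g n (v 0 i)].

Section GradedResolution.
Variables (R : comPzRingType) (gR : int -> set R).
Variables (M : lmodType R) (gM : int -> set M).

Definition irrelevant : ideal R :=
  span ([set x | exists n : int, 0 < n /\ gR n x] : set R^o).

(* 0 -> R(j1)^r1 -> R(j0)^r0 -> M -> 0 is a graded minimal R-free resolution of
   M, for R a graded ring such that R_0 is a field. *)
Definition min_free_resolution (r1 : nat) (j1 : int) (r0 : nat) (j0 : int) :=
  exists (phi : {linear 'rV[R]_r1 -> 'rV[R]_r0})
         (eps : {linear 'rV[R]_r0 -> M}),
  [/\ (forall n v, copies (shift gR j1) n v -> copies (shift gR j0) n (phi v))
      /\ (forall n v, copies (shift gR j0) n v -> gM n (eps v)),
      injective phi,
      forall v, eps v = 0 <-> exists u, phi u = v,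
      forall x, exists v, eps v = x
    & forall u, smul irrelevant (fullsub 'rV[R]_r0) (phi u)].

End GradedResolution.

(* A[t], regarded below as a module over A[Jt]. *)
Definition rees_poly (A : comNzRingType) (J : ideal A) : Type := {poly A}.

Section ReesAlgebra.
Variables (A : comNzRingType) (J : ideal A).

Definition rees_pred : {pred {poly A}} :=
  fun p => `[< forall i, idpow J i p`_i >].

Lemma idpowM i j (x y : A) :
  idpow J i x -> idpow J j y -> idpow J (i + j) (x * y).
Proof.
move=> Jx Jy; move: x Jx; elim: i => [|i IH] x Jx.
  exact: (@submodZ _ _ (idpow J j)).
have S0 : idpow J (i.+1 + j) (0 * y) by rewrite mul0r; apply: submod0.
have SD (u v : A^o) : idpow J (i.+1 + j) ((u : A) * y) ->
    idpow J (i.+1 + j) ((v : A) * y) -> idpow J (i.+1 + j) ((u + v : A) * y).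
  by move=> *; rewrite mulrDl; apply: submodD.
have SZ (a : A) (u : A^o) : idpow J (i.+1 + j) ((u : A) * y) ->
    idpow J (i.+1 + j) ((a *: u : A^o) * y).
  by move=> h; rewrite -[X in submod_set _ X]mulrA; apply: (@submodZ _ _ (idpow J (i.+1 + j))).
pose S : ideal A :=
  @Submod _ A^o [set u : A^o | idpow J (i.+1 + j) ((u : A) * y)] S0 SD SZ.
move/spanP: Jx => Jx; apply: (Jx S) => _ [a [z [Ja Jz ->]]] /=.
apply: sub_span; exists a, (z * y); split=> //; first exact: IH.
by rewrite -[LHS]mulrA.
Qed.

Lemma rees_closed : GRing.subring_closed rees_pred.
Proof.
split.
- apply/asboolP => i; rewrite coef1; case: i => [|i] //=; exact: submod0.
- move=> p q /asboolP Jp /asboolP Jq; apply/asboolP => i; rewrite coefB.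
  exact: (@submodB _ _ (idpow J i)).
- move=> p q /asboolP Jp /asboolP Jq; apply/asboolP => i; rewrite coefM.
  elim/big_ind: _ => [|x y|k _]; [exact: submod0|exact: submodD|].
  by rewrite -[i in idpow J i](subnKC (ltn_ord k : (k <= i)%N)); apply: idpowM.
Qed.

HB.instance Definition _ :=
  GRing.isSubringClosed.Build {poly A} rees_pred rees_closed.

(* The Rees algebra A[Jt] = \bigoplus_n J^n t^n, as a subring of A[t]. *)
Record rees := Rees {
  rees_val : {poly A};
  rees_valP : rees_val \in rees_pred }.

HB.instance Definition _ := [isSub for rees_val].
HB.instance Definition _ := [Choice of rees by <:].
HB.instance Definition _ := [SubChoice_isSubComNzRing of rees by <:].

Lemma reesC_subproof (a : A) : a%:P \in rees_pred.
Proof.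
by apply/asboolP => -[|i] //=; rewrite coefC /=; exact: submod0.
Qed.

Definition reesC (a : A) : rees := Rees (reesC_subproof a).

Local Notation rees_poly := (rees_poly J).

HB.instance Definition _ := GRing.Zmodule.on rees_poly.

Definition rees_scale (t : rees) (p : rees_poly) : rees_poly :=
  val t * (p : {poly A}).

Lemma rees_scaleA (s t : rees) (p : rees_poly) :
  rees_scale s (rees_scale t p) = rees_scale (s * t) p.
Proof. by rewrite /rees_scale mulrA. Qed.
Lemma rees_scale1 : left_id 1 rees_scale.
Proof. by move=> p; rewrite /rees_scale mul1r. Qed.
Lemma rees_scaleDr : right_distributive rees_scale +%R.
Proof. by move=> s p q; exact: mulrDr. Qed.
Lemma rees_scaleDl (p : rees_poly) : {morph rees_scale^~ p : s t / s + t}.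
Proof. by move=> s t; exact: mulrDl. Qed.

HB.instance Definition _ := GRing.Zmodule_isLmodule.Build rees rees_poly
  rees_scaleA rees_scale1 rees_scaleDr rees_scaleDl.

(* The ideal K A[Jt] generated by K, and the ring A[Jt] / K A[Jt]. *)
Definition rees_quo (K : ideal A) : Type :=
  quo_ring (span (reesC @` K : set (rees^o))).

HB.instance Definition _ (K : ideal A) := GRing.ComPzRing.on (rees_quo K).

End ReesAlgebra.

Definition homog (A : comNzRingType) (n : int) : set {poly A} :=
  [set p | forall i : nat, i%:Z != n -> p`_i = 0].

Section AssociatedGraded.
Variables (A : comNzRingType) (I : ideal A).

Definition assoc_graded : comPzRingType := rees_quo I I.

(* The graded maximal ideal of G, for A local with maximal ideal m: it is
   generated by m/I and the components of positive degree. *)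
Definition assoc_graded_max (m : ideal A) : set assoc_graded :=
  [set ring_proj _ p | p in [set p : rees I | m (val p)`_0]].

End AssociatedGraded.

Arguments assoc_graded_max {A} I m.

Section SallyModule.
Variables (A : comNzRingType) (I Q : ideal A).
Local Notation T := (rees Q).

Definition fiberT (m : ideal A) : comPzRingType := rees_quo Q m.

Definition fiberT_gr (m : ideal A) : int -> set (fiberT m) :=
  fun n => [set ring_proj _ p | p in [set p : T | homog n (val p)]].

(* For an A-subalgebra X of A[t] containing A[Qt], the ideal I X of X, as an
   A[Qt]-submodule of A[t]. *)
Definition extend (X : set {poly A}) : submod (rees_poly Q) :=
  span ([set z | exists (a : A) (p : {poly A}), [/\ I a, X p & z = a%:P * p]] : set (rees_poly Q)).

Definition sally : lmodType T :=
  subquo (extend (range (@rees_val A Q))) (extend (range (@rees_val A I))).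

Definition sally_gr : int -> set sally :=
  fun n => [set quo_proj _ x | x in
    [set x : subm (extend (range (@rees_val A I))) | homog n (val x)]].

(* m S = 0, m acting on S through A -> A[Qt]. *)
Definition m_kills_sally (m : ideal A) : Prop :=
  kills (reesC Q @` m) sally.

(* The Sally module, regarded as a graded B-module when m S = 0. *)
Definition sallyB (m : ideal A) (h : m_kills_sally m) : lmodType (fiberT m) :=
  mod_over h.

Definition sallyB_gr (m : ideal A) (h : m_kills_sally m) : int -> set (sallyB h) :=
  sally_gr.

End SallyModule.

Arguments fiberT_gr {A} Q m n.
Arguments sally_gr {A} I Q n.
Arguments sallyB_gr {A I Q m} h n.

(* Main.v *)
Require Import Defs.
From HB Require Import structures.
From mathcomp Require Import all_boot all_order all_algebra.
From mathcomp Require Import boolp classical_sets cardinality.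
From mathcomp Require Import ring zify.

(* Write Q = (a, b). As Q contains a regular sequence of length 2, the Koszul
   complex of (a, b) is exact, so a form of degree N vanishing at (a, b) is a
   multiple of bX - aY. Hence, when S is generated by S_1 and killed by m, the
   relations among lifts of a basis of S_1 = I^2/QI are the forms H, taken
   modulo I, such that (bX - aY)H has coefficients in I^2. The constant ones
   form W/I with W = I^2 : Q, and W <> I exactly when l(I^3/Q^2 I) < 8. Every
   h in W \ I gives two independent elements ah, bh of I^2/QI; since
   l(I^2/QI) = 4 this leaves c = dim W/I <= 2, and a non-constant minimal
   relation would need a fifth independent element. So I^2/QI has a basis
   a h_j, b h_j (j < c), f_l (l < 4 - 2c), the relations are free on
   b (a h_j) - a (b h_j), and S_n has the basis Q^n h_j, Q^(n-1) f_l. This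
   yields the resolution and the length of S_n, hence the Hilbert function.
   Finally the class of h in G_0 = A/I is killed by the classes at, bt and by a
   power of m, so by a power of the graded maximal ideal of G, whence depth G = 0. *)

Set Implicit Arguments.
Unset Strict Implicit.
Unset Printing Implicit Defensive.

Import GRing.Theory.
Local Open Scope ring_scope.
Local Open Scope classical_set_scope.

(** * Lengths *)

(** The number c = dim W/I governs both directions. When I^3 = Q I^2, the map (u, v) -> au + bv
    sends two copies of I^2/QI onto I^3/Q^2 I, and Koszul exactness identifies its kernel with W/I
    through w -> (bw, -aw). So l(I^3/Q^2 I) = 8 - c, which is the origin of the bound 8 and of the
    values 7 and 6. With e = 4 - 2c, the pair (c, e) is (1, 2) or (2, 0), and l(S_n) = c(n+1) + en
    produces e_2 = e and e_1 = e_0 - l(A/I) + c + e. For the converse, the relations of a given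
    resolution are linear, and Koszul exactness turns each of them into an element of W; the two
    ranks are then l(I^2/QI) and dim W/I. The resolution is not analysed further: these numbers
    suffice to rebuild an adapted basis, from which everything else follows. The modules S, B and G
    are quotients built on Rees algebras. Each assertion about them is translated, degree by degree,
    into a congruence in A modulo IQ^n, mQ^n or I^(n+1), so that the argument itself takes place
    among ideals of A. *)

Lemma is_max_uniq (P : nat -> Prop) p q : is_max P p -> is_max P q -> p = q.
Proof.
by move=> [Pp mp] [Pq mq]; apply/eqP; rewrite eqn_leq mq ?mp.
Qed.

Lemma is_max_ext (P Q : nat -> Prop) :
  (forall n, P n <-> Q n) -> forall n, is_max P n <-> is_max Q n.
Proof. by move=> PQ n; have -> : P = Q by apply/funext => k; apply/propext. Qed.

Lemma bounded_is_max (P : nat -> Prop) k b :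
  P k -> (forall n, P n -> (n <= b)%N) -> exists n, is_max P n.
Proof.
move=> Pk Pb; have exP : exists n, `[< P n >] by exists k; apply/asboolP.
have ubP n : `[< P n >] -> (n <= b)%N by move/asboolP/Pb.
case: (ex_maxnP exP ubP) => n /asboolP Pn nmax.
by exists n; split=> // j Pj; apply: nmax; apply/asboolP.
Qed.

Section SubmodLattice.
Variables (R : comPzRingType) (M : lmodType R).
Implicit Types (N L P C : submod M).

Lemma submod_ext N L : N = L :> set M -> N = L.
Proof.
case: N => N N0 ND NZ; case: L => L L0 LD LZ /= NL; case: L / NL L0 LD LZ => *.
by congr Submod; exact: Prop_irrelevance.
Qed.

Lemma submod_eqP N L : N `<=` L -> L `<=` N -> N = L.
Proof. by move=> NL LN; apply: submod_ext; apply/seteqP; split. Qed.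

Lemma submodN N x : N x -> N (- x).
Proof. by move=> Nx; rewrite -scaleN1r; apply: submodZ. Qed.

Lemma submod_sum N (T : Type) (r : seq T) (P : pred T) (F : T -> M) :
  (forall t, P t -> N (F t)) -> N (\sum_(t <- r | P t) F t).
Proof.
move=> NF; elim/big_ind: _ => //; first exact: submod0.
by move=> x y; apply: submodD.
Qed.

Lemma submod_cong N x y : N (x - y) -> N y -> N x.
Proof. by move=> Nxy Ny; rewrite -(subrK y x); apply: submodD. Qed.

Lemma submod_congr N x y : N (x - y) -> N x -> N y.
Proof.
by move=> Nxy; apply: submod_cong; rewrite -opprB; apply: submodN.
Qed.

Lemma zerosub_subproof :
  let S := [set x : M | x = 0] in
  [/\ S 0, forall x y, S x -> S y -> S (x + y)
    & forall (a : R) x, S x -> S (a *: x)].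
Proof.
by split=> //= [x y -> ->|a x ->]; rewrite ?addr0 ?scaler0.
Qed.

Definition zerosub : submod M :=
  let: And3 S0 SD SZ := zerosub_subproof in Submod S0 SD SZ.

Lemma zerosubE x : zerosub x = (x = 0).
Proof. by rewrite /zerosub; case: zerosub_subproof. Qed.

Definition capsub N L : submod M :=
  @Submod _ _ (N `&` L) (conj (submod0 N) (submod0 L))
   (fun x y '(conj Nx Lx) '(conj Ny Ly) => conj (submodD Nx Ny) (submodD Lx Ly))
   (fun a x '(conj Nx Lx) => conj (submodZ a Nx) (submodZ a Lx)).

Lemma addsub_subproof N L :
  let S := [set x | exists y z, [/\ N y, L z & x = y + z]] in
  [/\ S 0, forall x y, S x -> S y -> S (x + y)
    & forall (a : R) x, S x -> S (a *: x)].
Proof.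
split=> [|_ _ [y [z [Ny Lz ->]]] [y' [z' [Ny' Lz' ->]]]|a _ [y [z [Ny Lz ->]]]].
- by exists 0, 0; split; rewrite ?addr0 //; apply: submod0.
- exists (y + y'), (z + z'); split; rewrite 1?addrACA //; exact: submodD.
- exists (a *: y), (a *: z); split; rewrite ?scalerDr //; exact: submodZ.
Qed.

Definition addsub N L : submod M :=
  let: And3 S0 SD SZ := addsub_subproof N L in Submod S0 SD SZ.

Lemma addsubP N L x :
  addsub N L x <-> exists y z, [/\ N y, L z & x = y + z].
Proof. by rewrite /addsub; case: addsub_subproof. Qed.

Lemma addsubl N L : N `<=` addsub N L.
Proof.
by move=> x Nx; apply/addsubP; exists x, 0; rewrite addr0; split=> //; apply: submod0.
Qed.

Lemma addsubr N L : L `<=` addsub N L.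
Proof.
by move=> x Lx; apply/addsubP; exists 0, x; rewrite add0r; split=> //; apply: submod0.
Qed.

Lemma addsub_min N L P : N `<=` P -> L `<=` P -> addsub N L `<=` P.
Proof.
by move=> NP LP _ /addsubP[y [z [/NP Py /LP Pz ->]]]; apply: submodD.
Qed.

(* The submodules of a chain from N to L need not start at N. *)
Fixpoint chain N L n : Prop :=
  if n is n'.+1 then exists C, chain N C n' /\ C `<` L else N `<=` L.

Definition rel_length N L n := is_max (chain N L) n.

Lemma chain_sub N L n : chain N L n -> N `<=` L.
Proof.
elim: n L => //= n IH L [C [/IH NC [CL _]]]; exact: subset_trans NC CL.
Qed.

Lemma chainSr N L L' n : L `<=` L' -> chain N L n -> chain N L' n.
Proof.
case: n => /= [|n] LL'; first by move=> NL; exact: subset_trans LL'.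
move=> [C [NC [CL LC]]]; exists C; split=> //; split; first exact: subset_trans LL'.
by move=> L'C; apply: LC; exact: subset_trans L'C.
Qed.

Lemma chainSl N N' L n : N' `<=` N -> chain N L n -> chain N' L n.
Proof.
move=> NN'; elim: n L => [|n IH] L /=; first exact: subset_trans.
by move=> [C [/IH NC CL]]; exists C.
Qed.

Lemma chain_leq N L n k : (k <= n)%N -> chain N L n -> chain N L k.
Proof.
elim: n L => [|n IH] L; first by case: k.
rewrite leq_eqVlt => /predU1P[-> //|kn] [C [NC [CL _]]].
by apply: chainSr CL _; exact: IH.
Qed.

Lemma chain_cat N L P p q : chain N L p -> chain L P q -> chain N P (p + q).
Proof.
elim: q P => [|q IH] P NL /=; first by rewrite addn0 => LP; exact: chainSr NL.
by rewrite addnS => -[C [LC CP]]; exists C; split=> //; exact: IH.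
Qed.

(* Modular law: a strict step C < P stays strict after intersecting with L or
   after adding L. *)
Lemma chain_split N L P n : chain N P n -> N `<=` L ->
  exists p q, [/\ (n <= p + q)%N, chain N (capsub P L) p
                & chain L (addsub P L) q].
Proof.
move=> + NL; elim: n P => [|n IH] P /=.
  move=> NP; exists 0, 0; split=> //=; last exact: addsubr.
  by move=> x Nx; split; [exact: NP|exact: NL].
move=> [C [/IH[p [q [npq Cp Cq]]] [CP PC]]].
have capS : capsub C L `<=` capsub P L by move=> x [/CP].
have addS : addsub C L `<=` addsub P L.
  by apply: addsub_min; [apply: subset_trans CP _; exact: addsubl|exact: addsubr].
have [capS'|capN] := pselect (capsub P L `<=` capsub C L); last first.
  exists p.+1, q; split; first by rewrite addSn ltnS.
    by exists (capsub C L); split.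
  exact: chainSr Cq.
have [addS'|addN] := pselect (addsub P L `<=` addsub C L); last first.
  exists p, q.+1; split; first by rewrite addnS ltnS.
    exact: chainSr Cp.
  by exists (addsub C L); split.
exfalso; apply: PC => x Px.
have /addS'/addsubP[y [z [Cy Lz xE]]] := @addsubl P L _ Px.
have [Cz _] : capsub C L z.
  apply: capS'; split=> //; have -> : z = x - y by rewrite xE addrC addKr.
  by apply: submodB => //; exact: CP.
by rewrite xE; exact: submodD.
Qed.

Lemma rel_length_sub N L n : rel_length N L n -> N `<=` L.
Proof. by case=> /chain_sub. Qed.

(** No composition series is chosen: any chain from N to P is cut at L by [chain_split], and the two
    pieces are bounded by p and q. *)
Lemma rel_lengthD N L P p q :
  rel_length N L p -> rel_length L P q -> rel_length N P (p + q).
Proof.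
move=> NL LP; have [cNL mNL] := NL; have [cLP mLP] := LP.
split; first exact: chain_cat cNL cLP.
move=> n /(chain_split (L := L))/(_ (rel_length_sub NL)).
move=> [p' [q' [npq /(chainSr (L' := L)) Cp /(chainSr (L' := P)) Cq]]].
apply: leq_trans npq (leq_add (mNL _ (Cp _)) (mLP _ (Cq _))); first by move=> x [].
by apply: addsub_min => //; exact: rel_length_sub LP.
Qed.

Lemma rel_length0 N : rel_length N N 0.
Proof.
split=> [|[//|n] [C [/chain_sub NC [_ CN]]]]; first exact: subset_refl.
by case: CN.
Qed.

(** Supplies finiteness for lengths not known in advance, such as that of A/I^(n+2), where I^(n+2)
    contains the ideal IQ^(n+1) of finite colength. *)
Lemma rel_length_within N L N' L' n : rel_length N L n ->
  N `<=` N' -> N' `<=` L' -> L' `<=` L -> exists k, rel_length N' L' k.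
Proof.
move=> [_ mNL] NN' NL' LL'; apply: (@bounded_is_max _ 0 n) => // k Ck.
by apply: mNL; apply: chainSr LL' _; apply: chainSl Ck.
Qed.

(** Starting at the zero submodule makes the containment required at the bottom of [chain]
    automatic. *)
Lemma proper_chainP n : proper_chain M n <-> chain zerosub (fullsub M) n.
Proof.
have zero_sub N : zerosub `<=` N by move=> x; rewrite zerosubE => ->; apply: submod0.
split=> [[C]|].
  move=> Cn; suff: chain zerosub (C n) n by apply: chainSr.
  elim: n Cn => [|n IH] Cn /=; first exact: zero_sub.
  by exists (C n); split; [apply: IH => i /ltnW; apply: Cn|exact: Cn].
suff H L : chain zerosub L n ->
    exists C : nat -> submod M, C n = L /\ forall i, (i < n)%N -> C i `<` C i.+1.
  by move=> /H[C [_ Cn]]; exists C.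
elim: n L => [|n IH] L /=; first by exists (fun=> L).
move=> [L' [/IH[C [CL' Cn]] L'L]].
exists (fun i => if (i <= n)%N then C i else L); rewrite ltnn; split=> // i.
rewrite ltnS leq_eqVlt => /predU1P[->|in_] /=; first by rewrite eqxx ltnn CL'.
by rewrite in_ orbT; exact: Cn.
Qed.

End SubmodLattice.

(** * Invariance of length under isomorphisms of subquotients *)

Section Transfer.
Variable R : comPzRingType.

(* The graph of an isomorphism L/N -> L'/N', read as a relation between L and L'. *)
Record quo_iso (M M' : lmodType R) (N L : submod M) (N' L' : submod M')
    (r : M -> M' -> Prop) : Prop := QuoIso {
  quo_isoD : forall x y x' y', r x x' -> r y y' -> r (x + y) (x' + y');
  quo_isoZ : forall c x x', r x x' -> r (c *: x) (c *: x');
  quo_iso_dom : forall x, L x -> exists x', r x x';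
  quo_iso_cod : forall x', L' x' -> exists x, r x x';
  quo_iso_subl : forall x x', r x x' -> L x;
  quo_iso_subr : forall x x', r x x' -> L' x';
  quo_iso_ker : forall x x', r x x' -> N x <-> N' x' }.

Lemma quo_iso_sym (M M' : lmodType R) (N L : submod M) (N' L' : submod M') r :
  quo_iso N L N' L' r -> quo_iso N' L' N L (fun y x => r x y).
Proof.
case=> rD rZ d c sl sr k; split=> //.
- by move=> x y x' y'; exact: rD.
- by move=> e x x'; exact: rZ.
- by move=> x x'; exact: sr.
- by move=> x x'; exact: sl.
- by move=> x x' rxx'; apply: iff_sym; exact: k.
Qed.

(** Submodules are pushed forward along the relation. Strict steps stay strict because two elements
    related to the same y differ by an element of N, which lies in every member of the chain. *)
Lemma chain_transfer (M M' : lmodType R) (N L : submod M) (N' L' : submod M') r :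
  quo_iso N L N' L' r -> N' `<=` L' ->
  forall n, chain N L n -> chain N' L' n.
Proof.
case=> rD rZ dom cod subl subr ker NL' n.
have r0 : r 0 0.
  have [x r0x] := dom 0 (submod0 L).
  by have := rZ 0 _ _ r0x; rewrite !scale0r.
have rB x y x' y' : r x x' -> r y y' -> r (x - y) (x' - y').
  by move=> rx /(rZ (-1)); rewrite !scaleN1r; exact: rD.
pose F (C : submod M) : submod M' := @Submod _ _
  [set y | exists x, C x /\ r x y]
  (ex_intro _ 0 (conj (submod0 C) r0))
  (fun x y '(ex_intro x' (conj Cx rx)) '(ex_intro y' (conj Cy ry)) =>
     ex_intro _ (x' + y') (conj (submodD Cx Cy) (rD _ _ _ _ rx ry)))
  (fun c x '(ex_intro x' (conj Cx rx)) =>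
     ex_intro _ (c *: x') (conj (submodZ c Cx) (rZ c _ _ rx))).
suff H (C : submod M) k : C `<=` L -> chain N C k -> chain N' (F C) k.
  move=> NL; apply: (@chainSr _ _ _ (F L)); last exact: H.
  by move=> y [x [_ rxy]]; exact: subr rxy.
elim: k C => [|k IH] C CL /=.
  move=> NC y N'y; have [x rxy] := cod y (NL' y N'y).
  by exists x; split=> //; apply/NC/(ker _ _ rxy).
move=> [C' [NC' [C'C CC']]]; exists (F C'); split.
  by apply: IH => //; exact: subset_trans C'C CL.
split; first by move=> y [x [/C'C Cx rxy]]; exists x.
move=> FCC'; apply: CC' => x Cx.
have [y rxy] := dom x (CL x Cx).
have [|x' [C'x' rx'y]] := FCC' y; first by exists x.
have := rB _ _ _ _ rxy rx'y; rewrite subrr => /ker[_ /(_ (submod0 _)) Nxx'].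
by apply: submod_cong C'x'; exact: chain_sub NC' _ Nxx'.
Qed.

Lemma rel_length_transfer (M M' : lmodType R) (N L : submod M)
    (N' L' : submod M') r : quo_iso N L N' L' r -> N `<=` L -> N' `<=` L' ->
  forall n, rel_length N L n <-> rel_length N' L' n.
Proof.
move=> rI NL NL' n; apply: is_max_ext => k; split; first exact: chain_transfer rI _ _.
exact: chain_transfer (quo_iso_sym rI) _ _.
Qed.

Lemma has_lengthE (M : lmodType R) n :
  has_length M n <-> rel_length (zerosub M) (fullsub M) n.
Proof. exact: is_max_ext (@proper_chainP R M) n. Qed.

Lemma zerosub_sub (M : lmodType R) (N : submod M) : zerosub M `<=` N.
Proof. by move=> x; rewrite zerosubE => ->; apply: submod0. Qed.

Lemma has_length_quo (M : lmodType R) (N : submod M) n :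
  has_length (quo N) n <-> rel_length N (fullsub M) n.
Proof.
rewrite has_lengthE.
apply: (@rel_length_transfer _ _ _ _ _ _ (fun y x => quo_proj N x = y)) => //.
  split=> // [x y x' y' <- <-|c x x' <-|x _|x' _|x x' <-].
  - exact: quo_projD.
  - exact: quo_projZ.
  - by exists (quo_repr x); exact: quo_reprK.
  - by exists (quo_proj N x').
  - rewrite zerosubE -(subr0 x') -quo_projP.
    have -> : quo_proj N 0 = 0 by have := quo_projB N 0 0; rewrite !subrr.
    by rewrite subr0.
Qed.

Lemma quo_proj0 (M : lmodType R) (N : submod M) : quo_proj N 0 = 0.
Proof. by have := quo_projB N 0 0; rewrite !subrr. Qed.

Lemma quo_proj_eq0 (M : lmodType R) (N : submod M) x :
  quo_proj N x = 0 <-> N x.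
Proof. by rewrite -(quo_proj0 N) quo_projP subr0. Qed.

Definition subm_of (M : lmodType R) (L : submod M) x (Lx : L x) : subm L :=
  Subm (asboolT Lx : x \in submod_pred L).

Lemma subm_in (M : lmodType R) (L : submod M) (u : subm L) : L (val u).
Proof. by case: u => x /= /asboolP. Qed.

(** The graph of the projection of L onto L/N. It later allows computing in the Sally module with
    polynomial representatives. *)
Definition class_of (M : lmodType R) (N L : submod M) (x : M) (s : subquo N L) :=
  exists u : subm L, val u = x /\ quo_proj (pull N L) u = s.

Lemma class_ofP (M : lmodType R) (N L : submod M) :
  quo_iso N L (zerosub (subquo N L)) (fullsub _) (@class_of M N L).
Proof.
split=> // [x y _ _ [u [<- <-]] [v [<- <-]]|c x _ [u [<- <-]]|x Lx|s _|x s|x s].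
- by exists (u + v); split=> //; exact: quo_projD.
- by exists (c *: u); split=> //; exact: quo_projZ.
- by exists (quo_proj (pull N L) (subm_of Lx)), (subm_of Lx).
- exists (val (quo_repr s)), (quo_repr s); split=> //; exact: quo_reprK.
- by move=> [u [<- _]]; exact: subm_in.
- by move=> [u [<- <-]]; rewrite zerosubE quo_proj_eq0.
Qed.

Lemma has_length_subquo (M : lmodType R) (N L : submod M) n : N `<=` L ->
  has_length (subquo N L) n <-> rel_length N L n.
Proof.
move=> NL; rewrite has_lengthE; apply: iff_sym.
by apply: rel_length_transfer (class_ofP N L) _ _ _ => //; exact: zerosub_sub.
Qed.

End Transfer.

(** * Lengths of subquotients that are free over R/J *)

Section Generators.
Variables (R : comPzRingType) (M : lmodType R).
Implicit Types (N L : submod M) (J : ideal R).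

Lemma cyclesub_subproof (g : M) :
  let S := [set x : M | exists c : R, x = c *: g] in
  [/\ S 0, forall x y, S x -> S y -> S (x + y)
    & forall (a : R) x, S x -> S (a *: x)].
Proof.
split=> [|_ _ [c ->] [c' ->]|a _ [c ->]]; first by exists 0; rewrite scale0r.
- by exists (c + c'); rewrite scalerDl.
- by exists (a * c); rewrite scalerA.
Qed.

Definition cyclesub g : submod M :=
  let: And3 S0 SD SZ := cyclesub_subproof g in Submod S0 SD SZ.

Lemma cyclesubP g x : cyclesub g x <-> exists c : R, x = c *: g.
Proof. by rewrite /cyclesub; case: cyclesub_subproof. Qed.

(** J is the annihilator of g modulo N, so (N + Rg)/N is isomorphic to R/J. *)
Lemma rel_length_cycle N (g : M) J l :
  (forall c : R, J c <-> N (c *: g)) -> rel_length J (fullsub _) l ->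
  rel_length N (addsub N (cyclesub g)) l.
Proof.
move=> JN Jl; have NL := @addsubl _ _ N (cyclesub g).
apply/(@rel_length_transfer _ _ _ _ _ J (fullsub _)
  (fun y c => N (y - (c : R) *: g))) => //.
split=> // [x y c d|c x d|_ /addsubP[y [z [Ny /cyclesubP[c ->] ->]]]|c _|x c Nxc|x c Nxc].
- by rewrite scalerDl opprD addrACA; exact: submodD.
- by rewrite -scalerA -scalerBr; exact: submodZ.
- by exists c; rewrite addrK.
- by exists ((c : R) *: g); rewrite subrr; exact: submod0.
- rewrite -(subrK ((c : R) *: g) x); apply: submodD; first exact: NL.
  by apply: addsubr; apply/cyclesubP; exists c.
- rewrite (JN c); split; first exact: submod_congr.
  exact: submod_cong.
Qed.

(** The hypotheses say that L/N is free over R/J with basis g; the generators are added one at a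
    time. With J = m and l = 1 this is the dimension of a vector space, with J = Q or I it counts
    monomials in a and b. *)
Lemma rel_length_basis N L J l (T : finType) (g : T -> M) :
  rel_length J (fullsub _) l -> N `<=` L ->
  (forall t, L (g t)) ->
  (forall (c : R) t, J c -> N (c *: g t)) ->
  (forall x, L x -> exists c : T -> R, N (x - \sum_t c t *: g t)) ->
  (forall c : T -> R, N (\sum_t c t *: g t) -> forall t, J (c t)) ->
  rel_length N L (#|T| * l).
Proof.
move=> Jl NL Lg Jg span_g free_g.
pose fix E (s : seq T) : submod M :=
  if s is t :: s' then addsub (E s') (cyclesub (g t)) else N.
have EP s : uniq s -> forall x, E s x <->
    exists c : T -> R, N (x - \sum_(t <- s) c t *: g t).
  elim: s => [_ x|t s IH /= /andP[ts us] x] /=.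
    by split=> [Nx|[c]]; [exists (fun=> 0)|]; rewrite big_nil subr0.
  rewrite addsubP; split=> [[y [_ [/(IH us)[c Nc] /cyclesubP[d ->] ->]]]|[c]].
    exists (fun u => if u == t then d else c u); rewrite big_cons eqxx.
    rewrite opprD addrA addrK.
    rewrite (eq_big_seq (fun u => c u *: g u)) // => u us'.
    by case: eqP us' ts => // -> ->.
  rewrite big_cons opprD addrA => Nc; exists (x - c t *: g t), (c t *: g t).
  rewrite subrK; split=> //; last by apply/cyclesubP; exists (c t).
  by apply/(IH us); exists c.
have len s : uniq s -> rel_length N (E s) (size s * l).
  elim: s => [_|t s IH /= /andP[ts us]]; first exact: rel_length0.
  rewrite mulSn addnC; apply: rel_lengthD (IH us) _.
  apply: (rel_length_cycle (J := J)) Jl => c; split=> [Jc|].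
    apply/(EP s us); exists (fun=> 0).
    by rewrite big1 ?subr0 => [|u _]; rewrite ?scale0r //; exact: Jg.
  move=> /(EP s us)[d Nd].
  (* A membership of [c *: g t] in [E s] becomes a relation of the whole family, with [c] at t,
     [- d] on s and 0 elsewhere, so freeness puts [c] in J. *)
  pose e u := if u == t then c else if u \in s then - d u else 0.
  suff /free_g/(_ t) : N (\sum_u e u *: g u) by rewrite /e eqxx.
  rewrite (bigD1 t) //= {1}/e eqxx.
  have -> : \sum_(u | u != t) e u *: g u = - \sum_(u <- s) d u *: g u.
    rewrite /e.
    rewrite -sumrN big_uniq // big_mkcond [RHS]big_mkcond; apply: eq_bigr => u _.
    case: eqP => [->|_] /=; first by rewrite (negbTE ts).
    by case: ifP; rewrite ?scaleNr ?scale0r.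
  exact: Nd.
have -> : L = E (enum T).
  apply: submod_eqP => x; rewrite EP ?enum_uniq //; under eq_exists do rewrite big_enum.
    exact: span_g.
  move=> [c Nc]; apply: submod_cong (NL _ Nc) _.
  by apply: submod_sum => t _; exact: submodZ.
by rewrite cardE; exact: len (enum_uniq T).
Qed.

End Generators.

(** * Ideals *)

Section IdealArithmetic.
Variable R : comPzRingType.
Implicit Types (J K P : ideal R) (x y c : R).

Lemma ideal0 J : J (0 : R). Proof. exact: submod0. Qed.
Lemma idealD J x y : J x -> J y -> J (x + y). Proof. exact: submodD. Qed.
Lemma idealN J x : J x -> J (- x). Proof. exact: submodN. Qed.
Lemma idealB J x y : J x -> J y -> J (x - y). Proof. exact: submodB. Qed.
Lemma ideal_mull J c x : J x -> J (c * x). Proof. exact: (@submodZ _ _ J). Qed.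
Lemma ideal_mulr J c x : J x -> J (x * c). Proof. by rewrite mulrC; apply: ideal_mull. Qed.

Lemma ideal_sum J (T : Type) (r : seq T) (P : pred T) (F : T -> R) :
  (forall t, P t -> J (F t)) -> J (\sum_(t <- r | P t) F t).
Proof. exact: submod_sum. Qed.

Lemma ideal_cong J x y : J (x - y) -> J y -> J x.
Proof. exact: submod_cong. Qed.

Lemma ideal_congr J x y : J (x - y) -> J x -> J y.
Proof. exact: submod_congr. Qed.

Lemma ideal_subC J x y : J (x - y) -> J (y - x).
Proof. by move=> /idealN; rewrite opprB. Qed.

Lemma ideal_subT J y x z : J (x - y) -> J (y - z) -> J (x - z).
Proof. by move=> Jxy /(idealD Jxy); rewrite addrA subrK. Qed.

Lemma idmul_mem J K x y : J x -> K y -> idmul J K (x * y).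
Proof. by move=> Jx Ky; apply: (@Defs.sub_span _ R^o); exists x, y. Qed.

Lemma idmul_min J K P : (forall x y, J x -> K y -> P (x * y)) -> idmul J K `<=` P.
Proof. by move=> JKP; apply: Defs.span_min => _ [x [y [Jx Ky ->]]]; exact: JKP. Qed.

Lemma idmulS J J' K K' : J `<=` J' -> K `<=` K' -> idmul J K `<=` idmul J' K'.
Proof.
by move=> JJ' KK'; apply: idmul_min => x y /JJ' J'x /KK' K'y; exact: idmul_mem.
Qed.

Lemma idmulC J K : idmul J K = idmul K J.
Proof.
by apply: submod_eqP; apply: idmul_min => x y Hx Hy; rewrite mulrC; exact: idmul_mem.
Qed.

(** Here f stands for multiplication by a fixed element: a linear condition on a product ideal is
    checked on products, without writing elements as sums. *)
Lemma idmul_ind J K (P : ideal R) (f : R -> R) :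
  (forall x y, f (x + y) = f x + f y) -> (forall c x, f (c * x) = c * f x) ->
  (forall x y, J x -> K y -> P (f (x * y))) -> forall z, idmul J K z -> P (f z).
Proof.
move=> fD fZ fJK z.
have f0 : P (f 0) by rewrite -(mul0r 0) fZ mul0r; exact: ideal0.
pose S : ideal R := @Submod _ R^o [set x : R^o | P (f x)] f0
  (fun x y Px Py => eq_ind_r (fun z => P z) (idealD Px Py) (fD x y))
  (fun c x Px => eq_ind_r (fun z => P z) (ideal_mull c Px) (fZ c x)).
by apply: (idmul_min (P := S)) => x y; exact: fJK.
Qed.

Lemma idmulA J K P : idmul J (idmul K P) = idmul (idmul J K) P.
Proof.
apply: submod_eqP; apply: idmul_min => x y.
  move=> Jx; apply: (idmul_ind (f := fun y => x * y)) => [*|*|u v Ku Pv].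
  - exact: mulrDr.
  - exact: mulrCA.
  - by rewrite mulrA; apply: idmul_mem => //; exact: idmul_mem.
move=> + Py; apply: (idmul_ind (f := fun x => x * y)) => [*|*|u v Ju Kv].
- exact: mulrDl.
- by rewrite mulrA.
- by rewrite -mulrA; apply: idmul_mem => //; exact: idmul_mem.
Qed.

Lemma idmulCA J K P : idmul J (idmul K P) = idmul K (idmul J P).
Proof. by rewrite idmulA (idmulC J) -idmulA. Qed.

Lemma idmulT J : idmul J (fullsub _) = J.
Proof.
apply: submod_eqP; first by apply: idmul_min => x y Jx _; exact: ideal_mulr.
by move=> x Jx; rewrite -[x]mulr1; exact: idmul_mem.
Qed.

Lemma idmul_subr J K : idmul J K `<=` K.
Proof. by apply: idmul_min => x y _; exact: ideal_mull. Qed.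

Lemma idmul_subl J K : idmul J K `<=` J.
Proof. by rewrite idmulC; exact: idmul_subr. Qed.

Lemma idpowSubset J K n : J `<=` K -> idpow J n `<=` idpow K n.
Proof. by move=> JK; elim: n => //= n IH; exact: idmulS. Qed.

Lemma idpow1 J : idpow J 1 = J. Proof. exact: idmulT. Qed.

Lemma idpow_mem J n x : J x -> idpow J n (x ^+ n).
Proof.
move=> Jx; elim: n => //= n IH; rewrite exprS; exact: idmul_mem.
Qed.

Lemma span2P (a b x : R) : Defs.span ([set` [:: a; b]] : set R^o) x <->
  exists u v, x = u * a + v * b.
Proof.
have memP y : [set` [:: a; b]] y <-> y = a \/ y = b.
  by rewrite /= !inE; split=> [/orP[]/eqP|[]->]; [left|right| |]; rewrite ?eqxx ?orbT.
split=> [|[u [v ->]]]; last first.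
  by apply: idealD; apply: ideal_mull; apply: Defs.sub_span; apply/memP; [left|right].
have S0 : exists u v, (0 : R^o) = u * a + v * b by exists 0, 0; ring.
have SD (y z : R^o) : (exists u v, y = u * a + v * b) ->
    (exists u v, z = u * a + v * b) -> exists u v, y + z = u * a + v * b.
  by move=> [u [v ->]] [u' [v' ->]]; exists (u + u'), (v + v'); ring.
have SZ (c : R) (y : R^o) : (exists u v, y = u * a + v * b) ->
    exists u v, c *: y = u * a + v * b.
  move=> [u [v ->]]; exists (c * u), (c * v); rewrite /GRing.scale /=; ring.
apply: (Defs.span_min (N := Submod S0 SD SZ)) => y /memP[]-> /=.
  by exists 1, 0; ring.
by exists 0, 1; ring.
Qed.

Lemma span1P (a x : R) : Defs.span ([set` [:: a]] : set R^o) x <-> exists u, x = u * a.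
Proof.
split=> [|[u ->]]; last first.
  by apply: ideal_mull; apply: Defs.sub_span; rewrite /= inE.
move=> xa; suff /cyclesubP[u ->] : cyclesub (a : R^o) x by exists u.
apply: Defs.span_min xa => y; rewrite /= inE => /eqP ->.
by apply/cyclesubP; exists 1; rewrite scale1r.
Qed.

Lemma span0P (x : R) : Defs.span ([set` [::]] : set R^o) x <-> x = 0.
Proof.
split=> [|->]; last exact: ideal0.
move=> x0; suff: zerosub R^o x by rewrite zerosubE.
by apply: Defs.span_min x0 => y; rewrite /= in_nil.
Qed.

End IdealArithmetic.

(** * Chain conditions and units of local rings *)

Section Noetherian.
Variables (R : comPzRingType) (noethR : noetherian R).
Implicit Types J K : ideal R.

Lemma noetherian_acc (J : nat -> ideal R) : (forall n, J n `<=` J n.+1) ->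
  exists n, J n.+1 `<=` J n.
Proof.
move=> JS; have JSk n k : J n `<=` J (n + k)%N.
  elim: k => [|k IH]; first by rewrite addn0.
  by rewrite addnS; apply: subset_trans IH _.
have Jle n k : (n <= k)%N -> J n `<=` J k by move/subnKC <-.
have U0 : (\bigcup_n J n) (0 : R^o) by exists 0%N => //; exact: ideal0.
have UD (x y : R^o) : (\bigcup_n J n) x -> (\bigcup_n J n) y -> (\bigcup_n J n) (x + y).
  move=> [n _ Jx] [k _ Jy]; exists (maxn n k) => //; apply: submodD.
    by apply: Jle Jx; exact: leq_maxl.
  by apply: Jle Jy; exact: leq_maxr.
have UZ (c : R) (x : R^o) : (\bigcup_n J n) x -> (\bigcup_n J n) (c *: x).
  by move=> [n _ Jx]; exists n => //; exact: submodZ.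
have [s sE] := noethR (Submod U0 UD UZ).
have [n sJ] : exists n, forall x, x \in s -> J n x.
  have : forall x, x \in s -> (\bigcup_n J n) x.
    by move=> x xs; rewrite [X in X x]sE; exact: Defs.sub_span.
  elim: (s) => [_|x t IH xtU]; first by exists 0%N.
  have [k Jk] := IH (fun y yt => xtU y (mem_behead (s := x :: t) yt)).
  have [n _ Jx] := xtU x (mem_head x t); exists (maxn n k) => y.
  rewrite inE => /predU1P[->|/Jk Jy]; first by apply: Jle Jx; exact: leq_maxl.
  by apply: Jle Jy; exact: leq_maxr.
exists n => x Jx; have : (\bigcup_n J n) x by exists n.+1.
rewrite [X in X x]sE; apply: Defs.span_min; exact: sJ.
Qed.

Lemma noetherian_max J : Defs.proper_ideal J ->
  exists2 K : ideal R, J `<=` K & Defs.maximal_ideal K.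
Proof.
move=> Jproper; apply: contrapT => nomax.
pose T := {K : ideal R | Defs.proper_ideal K /\ J `<=` K}.
have step (K : T) : exists K' : T, sval K `<` sval K'.
  case: K => K [properK JK] /=; apply: contrapT => Kmax; apply: nomax.
  exists K => //; split=> // K' KK' properK'; apply/seteqP; split=> //.
  apply: contrapT => K'K; apply: Kmax.
  by exists (exist _ K' (conj properK' (subset_trans JK KK'))); split.
have [f fP] := choice step.
pose K n := sval (iter n f (exist _ J (conj Jproper (@subset_refl _ _)))).
have KS n : K n `<` K n.+1 by exact: fP.
have [|n Kn] := @noetherian_acc K; first by move=> n; case: (KS n).
by case: (KS n).
Qed.

Lemma local_unit (m : ideal R) (u : R) : local_ring m -> ~ m u ->
  exists v, u * v = 1.
Proof.
move=> [_ _ mmax] mu; apply: contrapT => nunit.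
have properu : Defs.proper_ideal (cyclesub (u : R^o)).
  by move=> /cyclesubP[v vE]; apply: nunit; exists v; rewrite mulrC; exact: esym vE.
have [K uK Kmax] := noetherian_max properu; apply: mu.
rewrite -(mmax K Kmax); apply: uK; apply/cyclesubP; exists 1.
by rewrite scale1r.
Qed.

End Noetherian.

(** * Koszul exactness and powers of a two-generated ideal *)

(* Regularity of b stands for H_2 = 0; given H_1 = 0 they are equivalent when a
   and b lie in the maximal ideal of a Noetherian local ring. *)
Definition koszul_exact (R : comPzRingType) (a b : R) : Prop :=
  (forall u v, a * u + b * v = 0 -> exists w, u = b * w /\ v = - (a * w)) /\
  (forall w, b * w = 0 -> w = 0).

Section Grade.
Variable R : comPzRingType.
Implicit Types (x y a b : R) (m : ideal R).

Lemma regular_pow x y n :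
  (forall z, x * z = 0 -> z = 0) ->
  (forall z w, y * z = x * w -> exists t, z = x * t) ->
  (forall z, x ^+ n * z = 0 -> z = 0) /\
  (forall z w, y ^+ n * z = x ^+ n * w -> exists t, z = x ^+ n * t).
Proof.
move=> xreg yreg; have xnreg k z : x ^+ k * z = 0 -> z = 0.
  by elim: k z => [|k IH] z; [rewrite mul1r|rewrite exprS -mulrA => /xreg/IH].
split; first exact: xnreg.
have yxn k z w : y * z = x ^+ k * w -> exists t, z = x ^+ k * t.
  elim: k z w => [|k IH] z w; first by move=> _; exists z; rewrite mul1r.
  rewrite exprS -mulrA => zE; have [t tE] := yreg _ _ zE.
  have [|s sE] := IH t w; last by exists s; rewrite tE sE mulrA.
  apply/eqP; rewrite -subr_eq0; apply/eqP/xreg.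
  by rewrite mulrBr -zE tE; ring.
elim: (X in y ^+ X) => [|k IH] z w; first by rewrite mul1r => ->; exists w.
by rewrite exprS -mulrA => /yxn[t /IH].
Qed.

(* The Koszul homology of (a, b) is killed by (a, b), hence by x and y. *)
Lemma regular_koszul m a b x y : local_ring m -> m a ->
  (exists p q, x = p * a + q * b) -> (exists p q, y = p * a + q * b) ->
  (forall z, x * z = 0 -> z = 0) ->
  (forall z w, y * z = x * w -> exists t, z = x * t) ->
  koszul_exact a b.
Proof.
move=> mloc ma [p [q xE]] [p' [q' yE]] xreg yreg.
have K2 z : a * z = 0 -> b * z = 0 -> z = 0.
  move=> az bz; apply: xreg; rewrite xE.
  have -> : (p * a + q * b) * z = p * (a * z) + q * (b * z) by ring.
  by rewrite az bz; ring.
(* Multiplying (u, v) by x = p a + q b and using a u = - b v gives the trivial syzygy with factor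
   [wx]; likewise y gives [wy]. The factors satisfy y wx = x wy, so wx = x w by regularity, and x is
   cancelled. *)
have K1 u v : a * u + b * v = 0 -> exists w, u = b * w /\ v = - (a * w).
  move=> uv; pose wx := q * u - p * v; pose wy := q' * u - p' * v.
  have xu : x * u = b * wx.
    apply/eqP; rewrite xE -subr_eq0 -[X in _ == X](mulr0 p) -uv.
    by apply/eqP; rewrite /wx; ring.
  have xv : x * v = - (a * wx).
    apply/eqP; rewrite xE -subr_eq0 -[X in _ == X](mulr0 q) -uv.
    by apply/eqP; rewrite /wx; ring.
  have yu : y * u = b * wy.
    apply/eqP; rewrite yE -subr_eq0 -[X in _ == X](mulr0 p') -uv.
    by apply/eqP; rewrite /wy; ring.
  have yv : y * v = - (a * wy).
    apply/eqP; rewrite yE -subr_eq0 -[X in _ == X](mulr0 q') -uv.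
    by apply/eqP; rewrite /wy; ring.
  have wxy : y * wx = x * wy.
    apply/eqP; rewrite -subr_eq0; apply/eqP; apply: K2.
      have -> : a * (y * wx - x * wy) = x * - (a * wy) - y * - (a * wx) by ring.
      by rewrite -xv -yv; ring.
    have -> : b * (y * wx - x * wy) = y * (b * wx) - x * (b * wy) by ring.
    by rewrite -xu -yu; ring.
  have [w wE] := yreg _ _ wxy; exists w; split; apply/eqP; rewrite -subr_eq0.
    by apply/eqP/xreg; rewrite mulrBr xu wE; ring.
  by apply/eqP/xreg; rewrite mulrBr xv wE; ring.
split=> // z bz.
(* z = a w with w again killed by b; iterating, the ideals (w_n) ascend, and
   w_n in (a w_n) forces w_n = 0 since A is local. *)
pose T := {z : R | b * z = 0}.
have step (t : T) : exists t' : T, sval t = a * sval t'.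
  case: t => t bt /=; have [|w [bw ->]] := K1 0 t; first by rewrite mulr0 add0r.
  have bNw : b * - w = 0 by rewrite mulrN -bw oppr0.
  by exists (exist _ (- w) bNw); rewrite mulrN.
have [f fP] := choice step.
pose w n := sval (iter n f (exist _ z bz)).
have wS n : w n = a * w n.+1 by exact: fP.
have [noethR [mproper _] _] := mloc.
have [n|n wn] := @noetherian_acc _ noethR (fun n => cyclesub (w n : R^o)).
  move=> _ /cyclesubP[c ->]; apply/cyclesubP; exists (c * a).
  by rewrite wS /GRing.scale /= mulrA.
have /wn/cyclesubP[c cE] : cyclesub (w n.+1 : R^o) (w n.+1).
  by apply/cyclesubP; exists 1; rewrite scale1r.
have [|d dE] := local_unit (u := 1 - c * a) noethR mloc.
  move=> m1; apply: mproper; rewrite -(subrK (c * a) 1).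
  by apply: idealD => //; exact: ideal_mull.
have wn0 : w n.+1 = 0.
  rewrite -[LHS]mul1r -dE mulrC mulrA.
  have -> : w n.+1 * (1 - c * a) = w n.+1 - c * (a * w n.+1) by ring.
  by rewrite -wS {1}cE subrr mul0r.
by rewrite -[z]/(w 0%N); elim: n.+1 wn0 => // k IH wk0; apply: IH; rewrite wS wk0 mulr0.
Qed.

(** The Cohen-Macaulay hypothesis only provides some regular sequence x, y in m, not one generating
    Q. As m = rad Q, equal high powers of x and y lie in Q, and they still form a regular
    sequence. *)
Lemma parameter_koszul (m Q : ideal R) : local_ring m -> cohen_macaulay m ->
  krull_dim R 2 -> parameter_ideal m Q ->
  exists a b, koszul_exact a b /\ forall x, Q x <-> exists u v, x = u * a + v * b.
Proof.
move=> mloc [d [dimd [depthd _]]] dim2 [d' [s [dimd' ss QE [_ radQ]]]].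
rewrite (is_max_uniq dimd dim2) in depthd.
rewrite (is_max_uniq dimd' dim2) in ss.
case: s ss QE => [|a [|b []]] //= _ QE.
have QP x : Q x <-> exists u v, x = u * a + v * b by rewrite QE; exact: span2P.
exists a, b; split=> //.
have [r [sr rm [reg _]]] := depthd.
case: r sr rm reg => [|x [|y []]] //= _ xym reg.
have xreg z : x * z = 0 -> z = 0.
  by move=> xz; apply/span0P; apply: (reg 0 z) => //; apply/span0P.
have yreg z w : y * z = x * w -> exists t, z = x * t.
  move=> yz; have /span1P[t ->] : Defs.span ([set` [:: x]] : set R^o) z.
    by apply: (reg 1 z) => //; apply/span1P; exists w; rewrite /= yz mulrC.
  by exists t; rewrite mulrC.
have powQ z : z \in [:: x; y] -> exists n, Q (z ^+ n).
  by move=> /xym; rewrite -radQ.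
have [n xn] := powQ x (mem_head _ _).
have [k yk] := powQ y (mem_last x [:: y]).
have [xreg' yreg'] := regular_pow (n + k) xreg yreg.
have ma : m a.
  rewrite -radQ; exists 1%N; rewrite expr1; apply/QP.
  by exists 1, 0; rewrite mul1r mul0r addr0.
apply: regular_koszul mloc ma _ _ xreg' yreg'; apply/QP; rewrite exprD.
  exact: ideal_mulr.
exact: ideal_mull.
Qed.

End Grade.

Section TwoGenerators.
Variables (A : comNzRingType) (a b : A) (Q : ideal A).
Hypothesis koszul_ab : koszul_exact a b.
Hypothesis QP : forall x, Q x <-> exists u v, x = u * a + v * b.
Implicit Types (F G H : nat -> A) (J K m : ideal A).

Lemma Qa : Q a. Proof. by apply/QP; exists 1, 0; ring. Qed.
Lemma Qb : Q b. Proof. by apply/QP; exists 0, 1; ring. Qed.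

Lemma idmulQP J x : idmul Q J x <-> exists u v, [/\ J u, J v & x = a * u + b * v].
Proof.
split=> [|[u [v [Ju Jv ->]]]]; last first.
  by apply: idealD; apply: idmul_mem => //; [exact: Qa|exact: Qb].
have S0 : exists u v, [/\ J u, J v & (0 : A^o) = a * u + b * v].
  by exists 0, 0; split; [exact: ideal0..|ring].
have SD (y z : A^o) : (exists u v, [/\ J u, J v & y = a * u + b * v]) ->
    (exists u v, [/\ J u, J v & z = a * u + b * v]) ->
    exists u v, [/\ J u, J v & y + z = a * u + b * v].
  move=> [u [v [Ju Jv ->]]] [u' [v' [Ju' Jv' ->]]]; exists (u + u'), (v + v').
  by split; [exact: idealD|exact: idealD|ring].
have SZ (c : A) (y : A^o) : (exists u v, [/\ J u, J v & y = a * u + b * v]) ->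
    exists u v, [/\ J u, J v & c *: y = a * u + b * v].
  move=> [u [v [Ju Jv ->]]]; exists (c * u), (c * v).
  by split; [exact: ideal_mull|exact: ideal_mull|rewrite /GRing.scale /=; ring].
apply: (idmul_min (P := Submod S0 SD SZ)) => _ y /QP[u [v ->]] Jy /=.
by exists (u * y), (v * y); split; [exact: ideal_mull|exact: ideal_mull|ring].
Qed.

(** Two expressions on (a, b) differ by a Koszul relation, whose entries lie in Q and hence in J. So
    Q/QJ is free over A/J on a and b. *)
Lemma idmulQ_coef J u v : Q `<=` J -> idmul Q J (a * u + b * v) -> J u /\ J v.
Proof.
move=> QJ /idmulQP[u' [v' [Ju' Jv' E]]].
have [|w [uE vE]] := koszul_ab.1 (u - u') (v - v').
  by apply: (addrI (a * u' + b * v')); rewrite addr0 -[in RHS]E; ring.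
split; [apply: ideal_cong Ju'; rewrite uE|apply: ideal_cong Jv'; rewrite vE].
  by apply/QJ/ideal_mulr/Qb.
by apply/QJ/idealN/ideal_mulr/Qa.
Qed.

(* The value at (a, b) of the form of degree N with coefficients F. *)
Definition bform N F : A := \sum_(i < N.+1) F i * (a ^+ i * b ^+ (N - i)).

Lemma bformSr N F : bform N.+1 F = b * bform N F + F N.+1 * a ^+ N.+1.
Proof.
rewrite /bform big_ord_recr /= subnn expr0 mulr1; congr (_ + _).
rewrite mulr_sumr; apply: eq_bigr => i _.
by rewrite subSn -1?ltnS // exprS; ring.
Qed.

Lemma bformSl N F : bform N.+1 F = F 0%N * b ^+ N.+1 + a * bform N (F \o succn).
Proof.
rewrite /bform big_ord_recl /= expr0 mul1r subn0; congr (_ + _).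
rewrite mulr_sumr; apply: eq_bigr => i _.
by rewrite /= subSS exprS; ring.
Qed.

Lemma bform0 F : bform 0 F = F 0%N.
Proof. by rewrite /bform big_ord1 /= subn0 expr0 !mulr1. Qed.

Lemma eq_bform N F G : (forall i, (i <= N)%N -> F i = G i) -> bform N F = bform N G.
Proof. by move=> FG; apply: eq_bigr => i _; rewrite FG // -ltnS. Qed.

Lemma bformD N F G : bform N (fun i => F i + G i) = bform N F + bform N G.
Proof. by rewrite -big_split; apply: eq_bigr => i _; rewrite mulrDl. Qed.

Lemma bformN N F : bform N (fun i => - F i) = - bform N F.
Proof. by rewrite -sumrN; apply: eq_bigr => i _; rewrite mulNr. Qed.

Lemma bformB N F G : bform N (fun i => F i - G i) = bform N F - bform N G.
Proof. by rewrite bformD bformN. Qed.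

Lemma bformMl N c F : bform N (fun i => c * F i) = c * bform N F.
Proof. by rewrite /bform mulr_sumr; apply: eq_bigr => i _; rewrite -mulrA. Qed.

Lemma bform_sum N (T : finType) (F : T -> nat -> A) :
  bform N (fun i => \sum_t F t i) = \sum_t bform N (F t).
Proof. by rewrite /bform exchange_big; apply: eq_bigr => i _; rewrite mulr_suml. Qed.

Definition shiftX F i : A := if i is j.+1 then F j else 0.

Lemma bform_shift N F : bform N.+1 (shiftX F) = a * bform N F.
Proof. by rewrite bformSl mul0r add0r; congr (_ * _); exact: eq_bform. Qed.

Lemma bform_trunc N F : F N.+1 = 0 -> bform N.+1 F = b * bform N F.
Proof. by move=> FN; rewrite bformSr FN mul0r addr0. Qed.

Lemma bform_mon N F i : (i <= N)%N -> (forall j, j != i -> F j = 0) ->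
  bform N F = F i * (a ^+ i * b ^+ (N - i)).
Proof.
move=> iN Fi; rewrite /bform (bigD1 (Ordinal (iN : (i < N.+1)%N))) //=.
by rewrite big1 ?addr0 // => j; rewrite -val_eqE /= => /Fi ->; rewrite mul0r.
Qed.

Lemma idpowQ_mon N i : (i <= N)%N -> idpow Q N (a ^+ i * b ^+ (N - i)).
Proof.
move=> iN; rewrite -{1}(subnKC iN); apply: idpowM; apply: idpow_mem.
  exact: Qa.
exact: Qb.
Qed.

Lemma idpowQP N x : idpow Q N x <-> exists F, x = bform N F.
Proof.
split=> [|[F ->]]; last first.
  by apply: ideal_sum => i _; apply/ideal_mull/idpowQ_mon; rewrite -ltnS.
elim: N x => [|N IH] x; first by move=> _; exists (fun=> x); rewrite bform0.
move=> /idmulQP[u [v [/IH[F ->] /IH[G ->] ->]]].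
exists (fun i => shiftX F i + if (i <= N)%N then G i else 0).
rewrite bformD bform_shift; congr (_ + _); rewrite bform_trunc ?ltnn //.
by congr (_ * _); apply: eq_bform => i ->.
Qed.

Lemma idmul_powQP J N x :
  idmul J (idpow Q N) x <-> exists F, (forall i, J (F i)) /\ x = bform N F.
Proof.
split=> [|[F [JF ->]]]; last first.
  by apply: ideal_sum => i _; apply: idmul_mem => //; apply: idpowQ_mon; rewrite -ltnS.
have S0 : exists F, (forall i, J (F i)) /\ (0 : A^o) = bform N F.
  exists (fun=> 0); split=> [i|]; first exact: ideal0.
  by rewrite /bform big1 // => i _; rewrite mul0r.
have SD (y z : A^o) : (exists F, (forall i, J (F i)) /\ y = bform N F) ->
    (exists F, (forall i, J (F i)) /\ z = bform N F) ->
    exists F, (forall i, J (F i)) /\ y + z = bform N F.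
  move=> [F [JF ->]] [G [JG ->]]; exists (fun i => F i + G i).
  by split=> [i|]; [exact: idealD|rewrite bformD].
have SZ (c : A) (y : A^o) : (exists F, (forall i, J (F i)) /\ y = bform N F) ->
    exists F, (forall i, J (F i)) /\ c *: y = bform N F.
  move=> [F [JF ->]]; exists (fun i => c * F i).
  by split=> [i|]; [exact: ideal_mull|rewrite bformMl].
apply: (idmul_min (P := Submod S0 SD SZ)) => y _ Jy /idpowQP[F ->] /=.
by exists (fun i => y * F i); split=> [i|]; [exact: ideal_mulr|rewrite bformMl].
Qed.

Lemma idmul_powQS J N : idmul J (idpow Q N.+1) = idmul (idmul Q J) (idpow Q N).
Proof. by rewrite /= idmulA (idmulC J). Qed.

(* The coefficients of (b X - a Y) H. *)
Definition kos H i : A := if i is j.+1 then b * H j - a * H j.+1 else - (a * H 0%N).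

Lemma kosD H H' i : kos (fun j => H j + H' j) i = kos H i + kos H' i.
Proof. by case: i => [|i] /=; ring. Qed.

(** That is, a^N is regular modulo b: Koszul exactness removes one factor a at a time. *)
Lemma pow_koszul N u v : a ^+ N * u = b * v -> exists w, u = b * w.
Proof.
elim: N u v => [|N IH] u v; first by rewrite mul1r => ->; exists v.
rewrite exprS -mulrA => E.
have [|w [wE _]] := koszul_ab.1 (a ^+ N * u) (- v); last exact: IH wE.
by rewrite E; ring.
Qed.

Lemma bform_eq0 N F : bform N F = 0 -> exists H,
  (forall i, (N <= i)%N -> H i = 0) /\ (forall i, (i <= N)%N -> F i = kos H i).
Proof.
elim: N F => [|N IH] F.
  rewrite bform0 => F0; exists (fun=> 0); split=> // i.
  by rewrite leqn0 => /eqP ->; rewrite /= F0; ring.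
rewrite bformSr => E.
have [|w wE] := @pow_koszul N.+1 (F N.+1) (- bform N F).
  by apply/eqP; rewrite -subr_eq0; apply/eqP; rewrite -[RHS]E; ring.
(* The leading coefficient is b w, so the leading term is removed by subtracting (bX - aY) w X^N,
   which adds a w to the coefficient of index N. What remains is b times the value of a form of
   degree N, and b is regular. *)
pose D i := if i == N then a * w else 0.
have DE : bform N D = w * a ^+ N.+1.
  rewrite (@bform_mon _ D N) // /D; last by move=> j /negPf ->.
  by rewrite eqxx subnn exprS; ring.
have /IH[H [HN HF]] : bform N (fun i => F i + D i) = 0.
  rewrite bformD DE; apply: koszul_ab.2; rewrite -[RHS]E wE; ring.
exists (fun i => H i + if i == N then w else 0); split=> [i Ni|i].
  by rewrite HN 1?ltnW // gtn_eqF // addr0.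
rewrite kosD leq_eqVlt => /predU1P[->|].
  by rewrite /= HN // eqxx gtn_eqF // HN // wE; ring.
rewrite ltnS => iN; rewrite -HF // /D.
case: i iN => [|i] iN /=.
  by case: eqP => _; ring.
by rewrite (ltn_eqF iN); case: eqP => _; ring.
Qed.

Lemma idmul_powQ_form K N F : idmul K (idpow Q N) (bform N F) -> exists H,
  (forall i, (N <= i)%N -> H i = 0) /\ (forall i, (i <= N)%N -> K (F i - kos H i)).
Proof.
move=> /idmul_powQP[G [KG /eqP]]; rewrite -subr_eq0 -bformB => /eqP/bform_eq0[H [HN FG]].
by exists H; split=> // i /FG <-; rewrite opprB addrC subrK.
Qed.

(** The multiples of bX - aY have coefficients in Q, hence in K. So the monomials of degree N in a,
    b are a basis of Q^N/KQ^N over A/K; for K = m this says that B is a polynomial ring. *)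
Lemma bform_coef K N F : Q `<=` K -> idmul K (idpow Q N) (bform N F) ->
  forall i, (i <= N)%N -> K (F i).
Proof.
move=> QK /idmul_powQ_form[H [_ FH]] i /FH FHi; apply: ideal_cong FHi _; apply: QK.
case: i => [|i] /=; first by apply/idealN/ideal_mulr/Qa.
by apply: idealB; apply: ideal_mulr; [exact: Qb|exact: Qa].
Qed.

Lemma bform_in K N F : (forall i, (i <= N)%N -> K (F i)) -> idmul K (idpow Q N) (bform N F).
Proof.
move=> KF; apply: ideal_sum => i _; apply: idmul_mem; first by apply: KF; rewrite -ltnS.
by apply: idpowQ_mon; rewrite -ltnS.
Qed.

(** Multiplication by a or b only moves the coefficients of a form, so at and bt are nonzerodivisors
    on the sum of the Q^n/KQ^n. *)
Lemma idmul_powQ_regular K N x : Q `<=` K -> idpow Q N x ->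
  idmul K (idpow Q N.+1) (a * x) \/ idmul K (idpow Q N.+1) (b * x) ->
  idmul K (idpow Q N) x.
Proof.
move=> QK /idpowQP[F ->]; case.
  rewrite -bform_shift => /(bform_coef QK) KF; apply: bform_in => i iN.
  exact: KF i.+1 iN.
pose G i := if (i <= N)%N then F i else 0.
have -> : b * bform N F = bform N.+1 G.
  by rewrite bform_trunc /G ?ltnn //; congr (_ * _); apply: eq_bform => i ->.
move=> /(bform_coef QK) KG; apply: bform_in => i iN.
by have := KG i (leqW iN); rewrite /G iN.
Qed.

Lemma rel_length_powQ J l n : Q `<=` J -> rel_length J (fullsub A^o) l ->
  rel_length (idmul J (idpow Q n)) (idpow Q n) (n.+1 * l).
Proof.
move=> QJ Jl; rewrite -[n.+1]card_ord.
apply: (@rel_length_basis _ _ _ _ J l _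
  (fun i : 'I_n.+1 => (a ^+ i * b ^+ (n - i) : A^o))) => //.
- exact: idmul_subr.
- by move=> i; apply: idpowQ_mon; rewrite -ltnS.
- by move=> c i Jc; apply: idmul_mem => //; apply: idpowQ_mon; rewrite -ltnS.
- move=> x /idpowQP[F ->]; exists (fun i : 'I_n.+1 => F i).
  by rewrite [X in submod_set _ X]subrr; exact: ideal0.
move=> c Jc i; pose F j := oapp c 0 (insub j).
have : idmul J (idpow Q n) (bform n F).
  by move: Jc; congr (submod_set _ _); apply: eq_bigr => j _; rewrite /F valK.
by move=> /(bform_coef QJ)/(_ i); rewrite -ltnS ltn_ord /F valK; apply.
Qed.

End TwoGenerators.

(** * Independence modulo the maximal ideal *)

Section ResidueField.
Variables (A : comNzRingType) (m : ideal A).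
Hypothesis mloc : local_ring m.
Implicit Types (N L : ideal A) (s : seq A) (c : nat -> A).

Lemma unit_mod x : ~ m x -> exists y, x * y = 1.
Proof. by case: (mloc) => noethA _ _; exact: local_unit. Qed.

Lemma max_proper : ~ m 1.
Proof. by case: mloc => _ [mproper _]. Qed.

Lemma rel_length_max : rel_length m (fullsub A^o) 1.
Proof.
have [_ [mproper mmax] _] := mloc; split.
  by exists m; split=> //; split=> // /(_ 1 I).
case=> [//|[//|n]] Cn; exfalso.
have [C2 [[C1 [mC1 [C12 C21]]] [_ C2f]]] := chain_leq (isT : (2 <= n.+2)%N) Cn.
have C2m : C2 = m :> set A.
  apply: mmax; first exact: subset_trans mC1 C12.
  by move=> C2_1; apply: C2f => x _; rewrite -[x]mulr1; exact: ideal_mull.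
by apply: C21; rewrite C2m.
Qed.

Definition lincomb c s : A := \sum_(i < size s) c i * s`_i.

(** Linear independence over A/m of the classes of s modulo N, for N containing the products of m
    with s. *)
Definition free_mod N s : Prop :=
  forall c, N (lincomb c s) -> forall i, (i < size s)%N -> m (c i).

Lemma lincomb_rcons c s x : lincomb c (rcons s x) = lincomb c s + c (size s) * x.
Proof.
rewrite /lincomb size_rcons big_ord_recr /= nth_rcons ltnn eqxx; congr (_ + _).
by apply: eq_bigr => i _; rewrite nth_rcons ltn_ord.
Qed.

Lemma lincombD c d s : lincomb (fun i => c i + d i) s = lincomb c s + lincomb d s.
Proof. by rewrite -big_split; apply: eq_bigr => i _; rewrite mulrDl. Qed.

Lemma lincombMl x c s : lincomb (fun i => x * c i) s = x * lincomb c s.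
Proof. by rewrite /lincomb mulr_sumr; apply: eq_bigr => i _; rewrite -mulrA. Qed.

Lemma lincomb0 s : lincomb (fun=> 0) s = 0.
Proof. by rewrite /lincomb big1 // => i _; rewrite mul0r. Qed.

Lemma addspan_subproof N s :
  let S := [set x : A^o | exists c, N (x - lincomb c s)] in
  [/\ S 0, forall x y, S x -> S y -> S (x + y) & forall (a : A) x, S x -> S (a *: x)].
Proof.
split=> [|x y [c Nc] [d Nd]|a x [c Nc]].
- by exists (fun=> 0); rewrite lincomb0 subr0; exact: ideal0.
- by exists (fun i => c i + d i); rewrite lincombD opprD addrACA; exact: idealD.
- exists (fun i => a * c i); rewrite lincombMl -[X in submod_set N X]mulrBr.
  exact: ideal_mull.
Qed.

Definition addspan N s : ideal A :=
  let: And3 S0 SD SZ := addspan_subproof N s in Submod S0 SD SZ.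

Lemma addspanP N s x : addspan N s x <-> exists c, N (x - lincomb c s).
Proof. by rewrite /addspan; case: addspan_subproof. Qed.

(** * Linear algebra in the vector space L/N of dimension d over A/m *)

Section Free.
Variables (N L : ideal A) (d : nat).
Hypotheses (NL : rel_length N L d) (mL : idmul m L `<=` N).

Lemma rel_length_free s : (forall x, x \in s -> L x) -> free_mod N s ->
  rel_length N (addspan N s) (size s).
Proof.
move=> sL free_s; rewrite -[size s]muln1 -{1}[size s]card_ord.
have sumE (c : 'I_(size s) -> A) :
    \sum_(i < size s) c i * s`_i = lincomb (fun i => oapp c 0 (insub i)) s.
  by apply: eq_bigr => i _; rewrite valK.
apply: (@rel_length_basis _ _ _ _ m 1 _ (fun i : 'I_(size s) => (s`_i : A^o))).
- exact: rel_length_max.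
- by move=> x Nx; apply/addspanP; exists (fun=> 0); rewrite lincomb0 subr0.
- move=> i; apply/addspanP; exists (fun j : nat => (j == i :> nat)%:R).
  rewrite [lincomb _ _](bigD1 i) //= eqxx mul1r big1 ?addr0 ?subrr; first exact: ideal0.
  by move=> j; rewrite -val_eqE /= => /negPf ->; rewrite mul0r.
- by move=> c i mc; apply: mL; apply: idmul_mem => //; apply/sL/mem_nth.
- by move=> x /addspanP[c Nc]; exists (fun i : 'I_(size s) => c i).
- move=> c; rewrite [X in submod_set N X]sumE => /free_s H i.
  by have := H i (ltn_ord i); rewrite valK.
Qed.

Lemma addspan_sub s : (forall x, x \in s -> L x) -> addspan N s `<=` L.
Proof.
move=> sL x /addspanP[c Nc]; apply: ideal_cong (rel_length_sub NL Nc) _.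
by apply: ideal_sum => i _; apply/ideal_mull/sL/mem_nth.
Qed.

Lemma free_mod_size s : (forall x, x \in s -> L x) -> free_mod N s -> (size s <= d)%N.
Proof.
move=> sL /(rel_length_free sL)[Cs _]; case: NL => _; apply.
by apply: chainSr Cs; exact: addspan_sub.
Qed.

Lemma free_mod_rcons s x : L x -> ~ addspan N s x -> free_mod N s -> free_mod N (rcons s x).
Proof.
move=> Lx sx free_s c; rewrite lincomb_rcons => Nc i; rewrite size_rcons.
have mc : m (c (size s)).
  apply: contrapT => /unit_mod[y yE]; apply: sx; apply/addspanP; exists (fun i => - y * c i).
  have -> : x - lincomb (fun i => - y * c i) s =
            y * (lincomb c s + c (size s) * x) + (1 - c (size s) * y) * x.
    by rewrite lincombMl; ring.
  by rewrite yE subrr mul0r addr0; exact: ideal_mull.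
rewrite ltnS leq_eqVlt => /predU1P[-> //|].
apply: free_s; apply: ideal_cong Nc; rewrite opprD addNKr.
by apply/idealN/mL/idmul_mem.
Qed.

Lemma free_mod_extend s : (forall x, x \in s -> L x) -> free_mod N s -> (size s < d)%N ->
  exists2 x, L x & free_mod N (rcons s x).
Proof.
move=> sL free_s sd; apply: contrapT => noext.
have Ls : L = addspan N s.
  apply: submod_eqP; last exact: addspan_sub.
  move=> x Lx; apply: contrapT => sx; apply: noext; exists x => //.
  exact: free_mod_rcons.
have := rel_length_free sL free_s; rewrite -Ls => /(is_max_uniq NL) dE.
by rewrite dE ltnn in sd.
Qed.

Lemma free_mod_span s : (forall x, x \in s -> L x) -> free_mod N s -> size s = d ->
  forall x, L x -> exists c, N (x - lincomb c s).
Proof.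
move=> sL free_s sd x Lx; apply/addspanP; apply: contrapT => sx.
suff : (size (rcons s x) <= d)%N by rewrite size_rcons sd ltnn.
apply: free_mod_size.
  by move=> y; rewrite mem_rcons inE => /predU1P[->|/sL].
exact: free_mod_rcons.
Qed.

Lemma free_mod_complete s : (forall x, x \in s -> L x) -> free_mod N s ->
  exists t, [/\ size (s ++ t) = d, forall x, x \in t -> L x & free_mod N (s ++ t)].
Proof.
move=> sL free_s; have [k kE] : exists k, d = (size s + k)%N.
  by exists (d - size s)%N; rewrite subnKC // free_mod_size.
elim: k s sL free_s kE => [|k IH] s sL free_s kE.
  by exists [::]; rewrite cats0 kE addn0.
have [|x Lx free_sx] := free_mod_extend sL free_s; first by rewrite kE addnS ltnS leq_addr.
have [|//||t [td tL free_t]] := IH (rcons s x).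
- by move=> y; rewrite mem_rcons inE => /predU1P[->|/sL].
- by rewrite size_rcons kE addnS.
exists (x :: t); rewrite -cat_rcons; split=> // y.
by rewrite inE => /predU1P[->|/tL].
Qed.

End Free.
End ResidueField.

(** * Bases of the first component of the Sally module *)

Section SallyBasis.
Variables (A : comNzRingType) (m I Q : ideal A) (a b : A).
Hypotheses (mloc : local_ring m) (koszul_ab : koszul_exact a b).
Hypothesis QP : forall x, Q x <-> exists u v, x = u * a + v * b.
Hypotheses (QI : Q `<=` I) (Im : I `<=` m).
Hypothesis mI2 : idmul m (idpow I 2) `<=` idmul Q I.

Local Notation I2 := (idpow I 2).
Implicit Types (x y h : A) (H : nat -> A).
Local Notation lc u h := (\sum_j u j * h j).

Lemma colon_subproof :
  let S := [set x : A^o | I2 (a * x) /\ I2 (b * x)] in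
  [/\ S 0, forall x y : A^o, S x -> S y -> S (x + y)
    & forall (c : A) (x : A^o), S x -> S (c *: x)].
Proof.
split=> [|x y [ax bx] [ay by_]|c x [ax bx]].
- by rewrite /= !mulr0; split; exact: ideal0.
- by rewrite /= !mulrDr; split; exact: idealD.
- by split; rewrite [c *: x]/(c * x) mulrCA; exact: ideal_mull.
Qed.

(* The ideal I^2 : Q. *)
Definition colon : ideal A :=
  let: And3 S0 SD SZ := colon_subproof in Submod S0 SD SZ.

Lemma colonP x : colon x <-> I2 (a * x) /\ I2 (b * x).
Proof. by rewrite /colon; case: colon_subproof. Qed.

Lemma idmulQI_sub : idmul Q I `<=` I2.
Proof. by rewrite /= idmulT; exact: idmulS. Qed.

Lemma QI_coef (u v : A) : idmul Q I (a * u + b * v) -> I u /\ I v.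
Proof. refine (idmulQ_coef koszul_ab QP QI). Qed.

Lemma QI_a u : idmul Q I (a * u) -> I u.
Proof. by move=> ?; have [] // := @QI_coef u 0; rewrite mulr0 addr0. Qed.

Lemma QI_b u : idmul Q I (b * u) -> I u.
Proof. by move=> ?; have [] // := @QI_coef 0 u; rewrite mulr0 add0r. Qed.

Lemma I_QI u v : I u -> I v -> idmul Q I (a * u + b * v).
Proof. by move=> Iu Iv; apply/(idmulQP QP); exists u, v. Qed.

Lemma I_QIa u : I u -> idmul Q I (a * u).
Proof. by move=> Iu; apply: idmul_mem => //; exact: Qa QP. Qed.

Lemma I_QIb u : I u -> idmul Q I (b * u).
Proof. by move=> Iu; apply: idmul_mem => //; exact: Qb QP. Qed.

Lemma sub_colon : I `<=` colon.
Proof.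
by move=> x Ix; apply/colonP; split; apply: idmulQI_sub; [exact: I_QIa|exact: I_QIb].
Qed.

(** From a c x in mI^2, which lies in QI, the factor a is cancelled. Hence (I^2 : Q)/I is a vector
    space over A/m. *)
Lemma max_colon x c : m c -> colon x -> I (c * x).
Proof.
move=> mc /colonP[ax _]; apply: QI_a; rewrite mulrCA.
by apply: mI2; exact: idmul_mem.
Qed.

(* Bases of the residue field vector space I^2/QI adapted to colon/I; the
   last condition says that the forms H with (bX - aY)H in I^2[X,Y] have
   coefficients in I + (h). *)
Record sally_basis c e (h : 'I_c -> A) (f : 'I_e -> A) : Prop := SallyBasis {
  sb_h : forall j, colon (h j);
  sb_f : forall l, I2 (f l);
  sb_span : forall x, I2 x -> exists u v w,
    idmul Q I (x - (a * lc u h + b * lc v h + lc w f));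
  sb_free : forall u v w, idmul Q I (a * lc u h + b * lc v h + lc w f) ->
    [/\ forall j, m (u j), forall j, m (v j) & forall l, m (w l)];
  sb_kos : forall H N, (forall i, (N <= i)%N -> H i = 0) ->
    (forall i, I2 (kos a b H i)) -> forall i, exists u, I (H i - lc u h) }.

(** The analogue of [max_colon] for a form H whose individual coefficients are not yet known to lie
    in I^2 : Q. *)
Lemma colon_kos_coef H x i : m x -> (forall i, I2 (kos a b H i)) -> I (x * H i).
Proof.
move=> mx kosH; have mkos j : idmul Q I (x * kos a b H j).
  by apply: mI2; exact: idmul_mem.
case: i => [|i].
  by apply: QI_a; have /idealN := mkos 0%N; rewrite /= mulrN opprK mulrCA.
have := mkos i.+1.
have -> : x * kos a b H i.+1 = a * - (x * H i.+1) + b * (x * H i) by rewrite /=; ring.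
by move=> /QI_coef[/idealN]; rewrite opprK.
Qed.

Lemma not_I_unit x y : colon y -> ~ I y -> I (x * y) -> m x.
Proof.
move=> Wy Iy Ixy; apply: contrapT => /(unit_mod mloc)[z xz]; apply: Iy.
by have := ideal_mull z Ixy; rewrite mulrA (mulrC z) xz mul1r.
Qed.

(** The four products of a, b with h1, h2 are independent modulo QI and already exhaust the
    dimension 4, so no f is left. *)
Lemma sally_basis2 (h1 h2 : A) : rel_length (idmul Q I) I2 4 -> colon h1 -> colon h2 ->
  (forall u v, I (u * h1 + v * h2) -> m u /\ m v) ->
  exists (h : 'I_2 -> A) (f : 'I_0 -> A), sally_basis h f.
Proof.
move=> l4 W1 W2 free12; pose h := fun j : 'I_2 => [:: h1; h2]`_j.
exists h, (fun=> 0); pose s := [:: a * h1; a * h2; b * h1; b * h2].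
have Wh j : colon (h j) by rewrite /h; case: j => -[|[|]].
have lch u : lc u h = u ord0 * h1 + u (inord 1) * h2.
  rewrite !big_ord_recl big_ord0 addr0; congr (_ * _ + u _ * _).
  by apply: val_inj; rewrite /= inordK.
have lc0 (w : 'I_0 -> A) : lc w (fun=> 0) = 0 by rewrite big_ord0.
have freeh (u v : 'I_2 -> A) : idmul Q I (a * lc u h + b * lc v h) ->
    (forall j, m (u j)) /\ (forall j, m (v j)).
  move=> /QI_coef[]; rewrite !lch => /free12[mu0 mu1] /free12[mv0 mv1].
  have ord2 (P : 'I_2 -> Prop) : P ord0 -> P (inord 1) -> forall j, P j.
    move=> P0 P1 j; case: (unliftP ord0 j) => [k ->|-> //].
    by rewrite ord1; congr (P _): P1; apply: val_inj; rewrite /= inordK.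
  by split; apply: ord2.
have sI2 x : x \in s -> I2 x.
  have [? ?] := (colonP h1).1 W1; have [? ?] := (colonP h2).1 W2.
  by rewrite !inE => /or4P[]/eqP ->.
have lcs c : lincomb c s = a * (c 0%N * h1 + c 1%N * h2) + b * (c 2 * h1 + c 3 * h2).
  by rewrite /lincomb !big_ord_recl big_ord0 /=; ring.
have free_s : free_mod m (idmul Q I) s.
  move=> c; rewrite lcs => /QI_coef[/free12[? ?] /free12[? ?]] i.
  by case: i => [|[|[|[|]]]].
have spanh x : I2 x -> exists u v : 'I_2 -> A, idmul Q I (x - (a * lc u h + b * lc v h)).
  move=> /(free_mod_span mloc l4 mI2 sI2 free_s (erefl _))[c]; rewrite lcs => Hc.
  by exists (fun j => c j), (fun j => c (2 + j)%N); rewrite !lch /= inordK.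
split=> //; first by case.
- by move=> x /spanh[u [v uv]]; exists u, v, (fun=> 0); rewrite lc0 addr0.
- by move=> u v w; rewrite lc0 addr0 => /freeh[mu mv]; split=> // -[].
(* Comparing the b-parts of an expansion of b x shows that b x alone decides: x lies in I + (h),
   hence in I^2 : Q. *)
have spanW x : I2 (b * x) -> exists v, I (x - lc v h).
  move=> /spanh[u [v uv]]; exists v.
  have /QI_coef[_ //] : idmul Q I (a * - lc u h + b * (x - lc v h)).
  by move: uv; congr (submod_set _ _); ring.
move=> H N HN kosH i; apply: (spanW).
(* Descending induction from the vanishing top coefficients: at index N - k, (bX - aY)H has the
   coefficient b H_(N-k-1) - a H_(N-k), so [spanW] passes membership one index down. *)
have HW k : colon (H (N - k)%N).
  elim: k => [|k IH]; first by rewrite subn0 HN //; exact: ideal0.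
  have [kN|Nk] := ltnP k N; last by move: IH; rewrite (eqnP Nk) (eqnP (leqW Nk)).
  have Sk : ((N - k.+1).+1 = N - k)%N by rewrite -subSn.
  have := kosH (N - k)%N; rewrite -Sk /= Sk => Hk.
  have /colonP[aH _] := IH.
  have /spanW[v Iv] : I2 (b * H (N - k.+1)%N) by exact: ideal_cong Hk aH.
  apply: ideal_cong (sub_colon Iv) _; apply: ideal_sum => j _; exact: ideal_mull.
suff /colonP[_ //] : colon (H i).
have [/ltnW iN|Ni] := ltnP i N; first by rewrite -(subKn iN).
by rewrite HN //; exact: ideal0.
Qed.

Lemma sally_basis1 (h1 : A) : rel_length (idmul Q I) I2 4 -> colon h1 -> ~ I h1 ->
  (forall h2, colon h2 -> exists u, I (h2 - u * h1)) ->
  exists (h : 'I_1 -> A) (f : 'I_2 -> A), sally_basis h f.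
Proof.
move=> l4 W1 nI1 gen1; have [aW1 bW1] := (colonP h1).1 W1.
have free_s : free_mod m (idmul Q I) [:: a * h1; b * h1].
  move=> c; have -> : lincomb c [:: a * h1; b * h1] = a * (c 0%N * h1) + b * (c 1%N * h1).
    by rewrite /lincomb !big_ord_recl big_ord0 /=; ring.
  move=> /QI_coef[I0 I1_]; case=> [|[|//]] _; exact: not_I_unit nI1 _.
have sI2 x : x \in [:: a * h1; b * h1] -> I2 x by rewrite !inE => /orP[]/eqP ->.
have [t [st tI2 free_st]] := free_mod_complete mloc l4 mI2 sI2 free_s.
case: t st tI2 free_st => [|f1 [|f2 []]] //= _ tI2 free_st.
have stI2 x : x \in [:: a * h1; b * h1; f1; f2] -> I2 x.
  by rewrite 2!inE => /or3P[/eqP ->|/eqP ->|/tI2].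
pose h := fun _ : 'I_1 => h1; pose f := fun j : 'I_2 => [:: f1; f2]`_j.
exists h, f.
have lch (u : 'I_1 -> A) : lc u h = u ord0 * h1 by rewrite big_ord1.
have lcf u : lc u f = u ord0 * f1 + u (inord 1) * f2.
  rewrite !big_ord_recl big_ord0 addr0; congr (_ * _ + u _ * _).
  by apply: val_inj; rewrite /= inordK.
have lcs c : lincomb c [:: a * h1; b * h1; f1; f2] =
    a * (c 0%N * h1) + b * (c 1%N * h1) + (c 2 * f1 + c 3 * f2).
  by rewrite /lincomb !big_ord_recl big_ord0 /=; ring.
split=> [//|l|x|u v w|H N HN kosH i].
- by apply: tI2; rewrite /f mem_nth //; exact: ltn_ord.
- move=> /(free_mod_span mloc l4 mI2 stI2 free_st (erefl _))[c]; rewrite lcs => Hc.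
  exists (fun=> c 0%N), (fun=> c 1%N), (fun j : 'I_2 => c (2 + j)%N).
  by rewrite !lch lcf /= inordK.
- rewrite !lch lcf.
  pose c i := [:: u ord0; v ord0; w ord0; w (inord 1)]`_i.
  move: (free_st c); rewrite lcs /c /= => H /H{}H.
  split=> j; first by rewrite ord1; exact: (H 0%N).
    by rewrite ord1; exact: (H 1%N).
  case: (unliftP ord0 j) => [k ->|->]; last exact: (H 2%N).
  rewrite ord1; have -> : lift ord0 ord0 = inord 1 :> 'I_2.
    by apply: val_inj; rewrite /= inordK.
  exact: (H 3).
suff /gen1[u Iu] : colon (H i) by exists (fun=> u); rewrite lch.
(* Otherwise let H_p and H_q be the first and the last coefficient outside
   I^2 : Q; then a h_1, b h_1, a H_p, b H_q is a basis of I^2/QI, and expanding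
   b H_p - a H_(p+1) in it shows that H_q is in I^2 : Q. *)
apply: contrapT => nWi.
pose P j := `[< ~ colon (H j) >].
have exP : exists j, P j by exists i; apply/asboolP.
have PN j : P j -> (j <= N)%N.
  move=> /asboolP nWj; rewrite leqNgt; apply/negP => /ltnW Nj; apply: nWj.
  by rewrite HN //; exact: ideal0.
case: (ex_minnP exP) => p /asboolP nWp pmin; case: (ex_maxnP exP PN) => q /asboolP nWq qmax.
(* By minimality H_(p-1) is in I^2 : Q, so b H_(p-1) drops out of the coefficient of index p; dually
   for q at index q + 1. *)
have aHp : I2 (a * H p).
  have := kosH p; case: p {nWp} pmin => [|p] pmin /=.
    by move=> /idealN; rewrite opprK.
  move/ideal_congr; apply; apply: contrapT => nbH.
  have : P p by apply/asboolP => /colonP[].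
  by move/pmin; rewrite ltnn.
have bHq : I2 (b * H q).
  apply: ideal_cong (kosH q.+1) _; apply: contrapT => naH.
  have : P q.+1 by apply/asboolP => /colonP[].
  by move/qmax; rewrite ltnn.
have : (p <= q)%N by apply: pmin; apply/asboolP.
rewrite leq_eqVlt => /predU1P[pq|pq].
  by apply: nWp; apply/colonP; split=> //; rewrite pq.
have combW u v x : ~ colon x -> I (u * h1 + v * x) -> m v.
  move=> nWx Iux; apply: contrapT => /(unit_mod mloc)[v' vv']; apply: nWx.
  have -> : x = v' * (u * h1 + v * x) - v' * u * h1 + (1 - v * v') * x by ring.
  rewrite vv' subrr mul0r addr0; apply: idealB; first exact/sub_colon/ideal_mull.
  exact: ideal_mull.
have comb_m u v j : ~ colon (H j) -> I (u * h1 + v * H j) -> m u /\ m v.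
  move=> nWj Iuv; have mv := combW _ _ _ nWj Iuv; split=> //.
  apply: (not_I_unit W1 nI1); apply: ideal_cong (idealN (colon_kos_coef j mv kosH)).
  by rewrite opprK.
pose s := [:: a * h1; b * h1; a * H p; b * H q].
have sI2' x : x \in s -> I2 x by rewrite !inE => /or4P[]/eqP ->.
have lcs' c : lincomb c s =
    a * (c 0%N * h1 + c 2 * H p) + b * (c 1%N * h1 + c 3 * H q).
  by rewrite /lincomb !big_ord_recl big_ord0 /=; ring.
have free_s' : free_mod m (idmul Q I) s.
  move=> c; rewrite lcs' => /QI_coef[/(comb_m _ _ _ nWp)[? ?] /(comb_m _ _ _ nWq)[? ?]] k.
  by case: k => [|[|[|[|]]]].
have [c] := free_mod_span mloc l4 mI2 sI2' free_s' (erefl _) (kosH p.+1).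
rewrite lcs' /= => Hc.
have {Hc}/QI_coef[_ Hc] : idmul Q I (a * - (H p.+1 + c 0%N * h1 + c 2 * H p) +
    b * (H p - c 1%N * h1 - c 3 * H q)).
  by move: Hc; congr (submod_set _ _); ring.
(* Otherwise c_3 H_q would lie in I, and H_p would be in I + (h_1), inside I^2 : Q. *)
have mc3 : ~ m (c 3).
  move=> mc3; apply: nWp.
  have -> : H p = H p - c 1%N * h1 - c 3 * H q + c 1%N * h1 + c 3 * H q by ring.
  apply: idealD; first by apply: idealD; [exact: sub_colon|exact: ideal_mull].
  by apply/sub_colon/colon_kos_coef.
(* Now H_q is, modulo I, a combination of H_p and h_1, and a sends both of these into I^2; so a H_q
   lies in I^2, as b H_q does. *)
have [d c3d] := unit_mod mloc mc3; apply: nWq; apply/colonP; split=> //.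
have -> : a * H q = a * (d * (c 3 * H q - H p + c 1%N * h1)) + d * (a * H p)
    - d * c 1%N * (a * h1) + (1 - c 3 * d) * (a * H q) by ring.
rewrite c3d subrr mul0r addr0; apply: idealB; last exact: ideal_mull.
apply: idealD; last exact: ideal_mull.
apply/idmulQI_sub/I_QIa/ideal_mull; move/idealN: Hc.
by congr (submod_set _ _); ring.
Qed.

(** The alternative is whether some h2 is independent of h1 modulo I. A third independent element
    needs no separate exclusion: in the second case the basis already forces h1, h2 to span. *)
Lemma sally_basis_exists (h1 : A) : rel_length (idmul Q I) I2 4 -> colon h1 -> ~ I h1 ->
  (exists (h : 'I_1 -> A) (f : 'I_2 -> A), sally_basis h f) \/
  (exists (h : 'I_2 -> A) (f : 'I_0 -> A), sally_basis h f).
Proof.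
move=> l4 W1 nI1.
have [[h2 [W2 free12]]|nofree] := pselect (exists h2, colon h2 /\
  forall u v, I (u * h1 + v * h2) -> m u /\ m v); [right|left].
  exact: sally_basis2 W1 W2 free12.
apply: (sally_basis1 l4 W1 nI1) => h2 W2; apply: contrapT => nogen.
apply: nofree; exists h2; split=> // u v Iuv.
have mv : m v.
  apply: contrapT => /(unit_mod mloc)[v' vv']; apply: nogen; exists (- v' * u).
  have -> : h2 - - v' * u * h1 = v' * (u * h1 + v * h2) + (1 - v * v') * h2 by ring.
  by rewrite vv' subrr mul0r addr0; exact: ideal_mull.
split=> //; apply: (not_I_unit W1 nI1).
by apply: ideal_cong (idealN (max_colon mv W2)); rewrite opprK.
Qed.

End SallyBasis.

(** * The components of the Sally module *)

Section SallyComponents.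
Variables (A : comNzRingType) (m I Q : ideal A) (a b : A).
Hypotheses (mloc : local_ring m) (koszul_ab : koszul_exact a b).
Hypothesis QP : forall x, Q x <-> exists u v, x = u * a + v * b.
Hypotheses (QI : Q `<=` I) (Im : I `<=` m).
Hypothesis mI2 : idmul m (idpow I 2) `<=` idmul Q I.

Local Notation I2 := (idpow I 2).
Local Notation lc u h := (\sum_j u j * h j).
Local Notation bform := (bform a b).
Local Notation kos := (kos a b).
Local Notation colon := (colon I a b).
Implicit Types (x y : A) (F G H : nat -> A).

Lemma lcD (T : finType) (u v h : T -> A) : lc (fun j => u j + v j) h = lc u h + lc v h.
Proof. by rewrite -big_split; apply: eq_bigr => j _; rewrite mulrDl. Qed.

Lemma lcMr (T : finType) c (u h : T -> A) : lc u (fun j => c * h j) = c * lc u h.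
Proof. by rewrite mulr_sumr; apply: eq_bigr => j _; rewrite mulrCA. Qed.

Lemma lcN (T : finType) (u h : T -> A) : lc (fun j => - u j) h = - lc u h.
Proof. by rewrite -sumrN; apply: eq_bigr => j _; rewrite mulNr. Qed.

Lemma bform_lc N (T : finType) (F : T -> nat -> A) (h : T -> A) :
  bform N (fun i => lc (fun j => F j i) h) = \sum_j bform N (F j) * h j.
Proof.
rewrite bform_sum; apply: eq_bigr => j _; rewrite mulrC -bformMl.
by apply: eq_bform => i _; rewrite mulrC.
Qed.

Section Basis.
Variables (c e : nat) (h : 'I_c -> A) (f : 'I_e -> A).
Hypothesis hf : sally_basis m I Q a b h f.

Lemma Qm : Q `<=` m. Proof. exact: subset_trans Im. Qed.

(** All relations on the generators a h_j, b h_j, f_l are multiples of the Koszul ones. The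
    coefficients are lifted to forms, the relation becomes (bX - aY)H modulo QI, H is expanded on h
    by [sb_kos], and [sb_free] compares coefficients. *)
Lemma sally_relation N (p1 p2 : 'I_c -> A) (p3 : 'I_e -> A) :
  (forall j, idpow Q N (p1 j)) -> (forall j, idpow Q N (p2 j)) ->
  (forall l, idpow Q N (p3 l)) ->
  idmul I (idpow Q N.+1) (lc p1 (fun j => a * h j) + lc p2 (fun j => b * h j) + lc p3 f) ->
  exists u : 'I_c -> A,
  [/\ forall j, if N is N'.+1 then idpow Q N' (u j) : Prop else u j = 0,
      forall j, idmul m (idpow Q N) (p1 j - b * u j),
      forall j, idmul m (idpow Q N) (p2 j + a * u j)
    & forall l, idmul m (idpow Q N) (p3 l)].
Proof.
move=> Qp1 Qp2 Qp3; rewrite (idmul_powQS _ _ N).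
have [F1 p1E] := choice (fun j => (idpowQP QP N (p1 j)).1 (Qp1 j)).
have [F2 p2E] := choice (fun j => (idpowQP QP N (p2 j)).1 (Qp2 j)).
have [F3 p3E] := choice (fun l => (idpowQP QP N (p3 l)).1 (Qp3 l)).
pose F i := a * lc (F1 ^~ i) h + b * lc (F2 ^~ i) h + lc (F3 ^~ i) f.
have -> : lc p1 (fun j => a * h j) + lc p2 (fun j => b * h j) + lc p3 f = bform N F.
  rewrite /F !bformD !bformMl !bform_lc !lcMr.
  by congr (_ * _ + _ * _ + _); apply: eq_bigr => j _; rewrite ?p1E ?p2E ?p3E.
move=> /(idmul_powQ_form koszul_ab QP)[H [HN FH]].
(* F has coefficients in I^2 and agrees with (bX - aY)H modulo QI, so [sb_kos] applies to H. *)
have kosH i : I2 (kos H i).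
  have [iN|Ni] := leqP i N; last first.
    by case: i Ni => // i Ni; rewrite /= !HN // 1?ltnW // !mulr0 subr0; exact: ideal0.
  apply: ideal_congr (idmulQI_sub QI (FH i iN)) _.
  apply: idealD; last by apply: ideal_sum => l _; exact/ideal_mull/(sb_f hf).
  rewrite !mulr_sumr; apply: idealD; apply: ideal_sum => j _; rewrite mulrCA;
  by have /colonP[? ?] := sb_h hf j; exact: ideal_mull.
(* Taking u = 0 from index N on makes the multiplier a form of degree N - 1, and zero when N = 0. *)
have uH i : exists u : 'I_c -> A,
    I (H i - lc u h) /\ ((N <= i)%N -> forall j, u j = 0).
  have [Ni|iN] := leqP N i; last by have [u Iu] := sb_kos hf HN kosH i; exists u.
  exists (fun=> 0); split=> //; rewrite HN // big1 ?subr0; first exact: ideal0.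
  by move=> j _; rewrite mul0r.
have {uH}[u uE] := choice uH.
have uN i j : (N <= i)%N -> u i j = 0 by move=> Ni; have [_ ->] := uE i.
have Iu i : I (H i - lc (u i) h) by have [] := uE i.
pose u' i j := if i is i'.+1 then u i' j else 0.
have cf i : (i <= N)%N -> [/\ forall j, m (F1 j i + u i j),
    forall j, m (F2 j i - u' i j) & forall l, m (F3 l i)].
  move=> iN; apply: (sb_free hf (u := fun j => F1 j i + u i j)
    (v := fun j => F2 j i - u' i j) (w := F3 ^~ i)).
  rewrite !lcD !lcN; apply: ideal_cong (FH i iN); rewrite /F.
  case: i {iN} => [|i] /=.
    have -> : lc (u' 0%N) h = 0 by rewrite big1 // => j _; rewrite mul0r.
    have := I_QIa QP (idealN (Iu 0%N)); congr (submod_set _ _).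
    by rewrite opprB; ring.
  have -> : lc (u' i.+1) h = lc (u i) h by [].
  have := I_QI QP (idealN (Iu i.+1)) (Iu i); congr (submod_set _ _).
  by rewrite opprB; ring.
(* The minus sign comes from -aY: index i carries - a H_i, so modulo m the form F1 is - u and F2 is
   u moved by one index. *)
exists (fun j => if N is N'.+1 then bform N' (fun i => - u i j) else 0); split=> j.
- by case: (N) => // N'; apply/(idpowQP QP); exists (fun i => - u i j).
- have -> : p1 j - b * (if N is N'.+1 then bform N' (fun i => - u i j) else 0) =
      bform N (fun i => F1 j i + u i j).
    rewrite bformD p1E; congr (_ + _).
    case: N uN {HN FH cf Qp1 Qp2 Qp3 F1 F2 F3 p1E p2E p3E F Iu uE kosH} => [|N'] uN.
      by rewrite bform0 uN // mulr0 oppr0.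
    by rewrite bformN mulrN opprK bform_trunc // uN.
  by apply: (bform_in QP) => i /cf[].
- have -> : p2 j + a * (if N is N'.+1 then bform N' (fun i => - u i j) else 0) =
      bform N (fun i => F2 j i - u' i j).
    rewrite bformB p2E; congr (_ + _).
    case: N uN {HN FH cf Qp1 Qp2 Qp3 F1 F2 F3 p1E p2E p3E F Iu uE kosH} => [|N'] uN.
      by rewrite bform0 mulr0 oppr0.
    rewrite bformN mulrN; congr (- _); rewrite -bform_shift.
    by apply: eq_bform => -[].
  by apply: (bform_in QP) => i /cf[].
- by rewrite p3E; apply: (bform_in QP) => i /cf[].
Qed.

(** A constant form H = x in [sb_kos]: the coefficients of (bX - aY)x are - a x and b x. *)
Lemma colon_span x : colon x -> exists u, I (x - lc u h).
Proof.
move=> /colonP[ax bx].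
apply: (sb_kos hf (N := 1) (H := fun i => if i is 0%N then x else 0)) 0%N => [[]//|].
case=> [|[|i]] /=; first exact: idealN.
  by rewrite mulr0 subr0.
by rewrite !mulr0 subr0; exact: ideal0.
Qed.

Lemma colon_free u : I (lc u h) -> forall j, m (u j).
Proof.
move=> Iu j.
have [|mu _ _] := sb_free hf (u := u) (v := fun=> 0) (w := fun=> 0); last exact: mu.
rewrite [X in b * X]big1 => [|k _]; last by rewrite mul0r.
rewrite [X in _ + _ + X]big1 => [|k _]; last by rewrite mul0r.
by rewrite mulr0 !addr0; exact: I_QIa.
Qed.

(** Makes c independent of the basis, so that it can be matched with the rank of a given
    resolution. *)
Lemma rel_length_colon : rel_length I colon c.
Proof.
rewrite -[c]muln1 -{1}[c]card_ord.
apply: (@rel_length_basis _ _ _ _ m 1 _ (fun j => (h j : A^o))).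
- exact: rel_length_max.
- exact: sub_colon.
- exact: (sb_h hf).
- by move=> x j mx; apply: (max_colon koszul_ab QP QI mI2) mx _; exact: (sb_h hf).
- exact: colon_span.
- exact: colon_free.
Qed.

Hypothesis I3 : idpow I 3 = idmul Q I2.

Lemma idpow_form N : idpow I N.+2 = idmul I2 (idpow Q N).
Proof.
elim: N => [|N IH]; first by rewrite idmulT.
have -> : idpow I N.+3 = idmul I (idpow I N.+2) by [].
rewrite IH (idmulA I I2).
have -> : idmul I I2 = idmul I2 Q by rewrite (idmulC I2); exact: I3.
by rewrite -idmulA.
Qed.

Lemma sally_generate N x : idpow I N.+2 x -> exists p1 p2 p3,
  [/\ forall j, idpow Q N (p1 j), forall j, idpow Q N (p2 j), forall l, idpow Q N (p3 l)
    & idmul I (idpow Q N.+1)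
       (x - (lc p1 (fun j => a * h j) + lc p2 (fun j => b * h j) + lc p3 f))].
Proof.
rewrite idpow_form => /(idmul_powQP QP)[F [I2F ->]].
have H i : exists w : ('I_c -> A) * ('I_c -> A) * ('I_e -> A),
    idmul Q I (F i - (a * lc w.1.1 h + b * lc w.1.2 h + lc w.2 f)).
  by have [u [v [w Hw]]] := sb_span hf (I2F i); exists (u, v, w).
have {H}[w wE] := choice H.
exists (fun j => bform N (fun i => (w i).1.1 j)), (fun j => bform N (fun i => (w i).1.2 j)),
  (fun l => bform N (fun i => (w i).2 l)).
split=> [j|j|l|]; try by apply/(idpowQP QP); eexists.
rewrite (idmul_powQS _ _ N) !lcMr -!bform_lc -!bformMl -!bformD -bformB.
exact: (bform_in QP) (fun i _ => wE i).
Qed.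

(** A basis consists of the monomials of degree N + 1 times h_j and those of degree N times f_l. The
    pieces Q^N a h_j and Q^N b h_j overlap, which is why h_j rather than a h_j, b h_j is used. *)
Lemma rel_length_sally N :
  rel_length (idmul I (idpow Q N.+1)) (idpow I N.+2) (c * N.+2 + e * N.+1).
Proof.
pose T := ('I_c * 'I_N.+2 + 'I_e * 'I_N.+1)%type.
pose g (t : T) : A^o := match t with
  | inl jk => a ^+ jk.2 * b ^+ (N.+1 - jk.2) * h jk.1
  | inr lk => a ^+ lk.2 * b ^+ (N - lk.2) * f lk.1 end.
have cardT : #|{: T}| = (c * N.+2 + e * N.+1)%N by rewrite card_sum !card_prod !card_ord.
have sumE (k : T -> A) : \sum_t k t * g t =
    \sum_j bform N.+1 (fun i => oapp (fun i => k (inl (j, i))) 0 (insub i)) * h j +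
    \sum_l bform N (fun i => oapp (fun i => k (inr (l, i))) 0 (insub i)) * f l.
  rewrite big_sumType /=; congr (_ + _).
    rewrite (eq_bigr (fun p => k (inl (p.1, p.2)) * g (inl (p.1, p.2)))); last by case.
    rewrite -(pair_bigA _ (fun j i => k (inl (j, i)) * g (inl (j, i)))) /=.
    apply: eq_bigr => j _; rewrite mulr_suml; apply: eq_bigr => i _.
    by rewrite valK /= mulrA.
  rewrite (eq_bigr (fun p => k (inr (p.1, p.2)) * g (inr (p.1, p.2)))); last by case.
  rewrite -(pair_bigA _ (fun j i => k (inr (j, i)) * g (inr (j, i)))) /=.
  apply: eq_bigr => j _; rewrite mulr_suml; apply: eq_bigr => i _.
  by rewrite valK /= mulrA.
have gI t : idpow I N.+2 (g t).
  rewrite idpow_form; case: t => -[j k] /=; rewrite mulrC; last first.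
    by apply: idmul_mem; [exact: (sb_f hf)|apply: (idpowQ_mon QP); rewrite -ltnS].
  have /colonP[ah bh] := sb_h hf j.
  (* Since h_j itself need not be in I^2, one factor b, or a for the pure power of a, is absorbed
     into it. *)
  have [kN|Nk] := leqP k N.
    have -> : h j * (a ^+ k * b ^+ (N.+1 - k)) = b * h j * (a ^+ k * b ^+ (N - k)).
      by rewrite subSn // exprS; ring.
    by apply: idmul_mem => //; exact: (idpowQ_mon QP).
  have -> : (k : nat) = N.+1 by apply/eqP; rewrite eqn_leq -ltnS ltn_ord.
  rewrite subnn mulr1 exprS mulrA; apply: idmul_mem; first by rewrite mulrC.
  by apply: idpow_mem; exact: Qa QP.
rewrite -cardT -[#|_|]muln1.
apply: (@rel_length_basis _ _ _ _ m 1 _ g) => //.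
- exact: rel_length_max.
- by rewrite idpow_form idmul_powQS; apply: idmulS => //; exact: idmulQI_sub.
- have mS : idmul m (idpow I N.+2) `<=` idmul I (idpow Q N.+1).
    rewrite idpow_form idmul_powQS.
    have -> : idmul m (idmul I2 (idpow Q N)) = idmul (idmul m I2) (idpow Q N) := idmulA _ _ _.
    exact: idmulS mI2 (@subset_refl _ _).
  by move=> x t mx; apply: mS; exact: idmul_mem.
- move=> x /sally_generate[p1 [p2 [p3 [Qp1 Qp2 Qp3 H]]]].
  have [F1 p1E] := choice (fun j => (idpowQP QP N (p1 j)).1 (Qp1 j)).
  have [F2 p2E] := choice (fun j => (idpowQP QP N (p2 j)).1 (Qp2 j)).
  have [F3 p3E] := choice (fun l => (idpowQP QP N (p3 l)).1 (Qp3 l)).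
  pose F j i := shiftX (F1 j) i + if (i <= N)%N then F2 j i else 0.
  exists (fun t : T => match t with inl jk => F jk.1 jk.2 | inr lk => F3 lk.1 lk.2 end).
  move: H; congr (submod_set _ (_ - _)); rewrite sumE -big_split /=.
  congr (_ + _); apply: eq_bigr => j _; last first.
    congr (_ * _); rewrite p3E; apply: eq_bform => i iN.
    by rewrite (insubT (fun i => (i < N.+1)%N) (iN : (i < N.+1)%N)).
  rewrite p1E p2E; transitivity (bform N.+1 (F j) * h j).
    rewrite /F bformD bform_shift bform_trunc ?ltnn //.
    have -> : bform N (fun i => if (i <= N)%N then F2 j i else 0) = bform N (F2 j).
      by apply: eq_bform => i ->.
    by ring.
  congr (_ * _); apply: eq_bform => i iN.
  by rewrite (insubT (fun i => (i < N.+2)%N) (iN : (i < N.+2)%N)).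
move=> k; rewrite [X in submod_set _ X]sumE.
set K1 := fun j i => oapp (fun i => k (inl (j, i))) 0 (insub i).
set K2 := fun l i => oapp (fun i => k (inr (l, i))) 0 (insub i).
(* Each form of degree N + 1 is split into a times a form plus b times K1_0 b^N, which presents it
   on the generators a h_j, b h_j. *)
have -> : \sum_j bform N.+1 (K1 j) * h j + \sum_l bform N (K2 l) * f l =
    lc (fun j => bform N (K1 j \o succn)) (fun j => a * h j) +
    lc (fun j => K1 j 0%N * b ^+ N) (fun j => b * h j) + lc (fun l => bform N (K2 l)) f.
  rewrite -big_split /=; congr (_ + _); apply: eq_bigr => j _.
  by rewrite bformSl exprS; ring.
move=> /sally_relation[j|j|l|u [Qu u1 u2 u3]].
- by apply/(idpowQP QP); eexists.
- by apply/ideal_mull/idpow_mem/(Qb QP).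
- by apply/(idpowQP QP); eexists.
(* The Koszul ambiguity u of that splitting is harmless: K1_0 b^N + a u is the value of one form of
   degree N, whose coefficients must all lie in m. *)
have mu j : idmul m (idpow Q N) (b * u j) /\ m (K1 j 0%N).
  move: (Qu j) (u2 j); case: (N) => [|N'] uN.
    rewrite uN expr0 !mulr0 mulr1 addr0 idmulT => mK; split=> //; exact: ideal0.
  have /(idpowQP QP)[U ->] := uN.
  have -> : K1 j 0%N * b ^+ N'.+1 + a * bform N' U =
      bform N'.+1 (fun i => if i is i'.+1 then U i' else K1 j 0%N) by rewrite bformSl.
  move=> /(bform_coef koszul_ab QP Qm) mU; split; last exact: mU 0%N _.
  rewrite idmul_powQS -idmulA; apply: idmul_mem; first exact: Qb QP.
  by apply: (bform_in QP) => i iN; exact: mU i.+1 _.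
have mK1 j i : (i <= N.+1)%N -> m (K1 j i).
  case: i => [_|i iN]; first by case: (mu j).
  have H : idmul m (idpow Q N) (bform N (K1 j \o succn)).
    by apply: ideal_cong (u1 j) _; case: (mu j).
  exact: (bform_coef koszul_ab QP Qm H iN).
case=> -[j i]; first by have := mK1 j i; rewrite /K1 valK /= -ltnS ltn_ord; apply.
have := bform_coef koszul_ab QP Qm (u3 j) (i := i).
by rewrite /K2 valK /= -ltnS ltn_ord; apply.
Qed.

End Basis.

(** If I^2 : Q = I, the map (u, v) -> au + bv from two copies of I^2/QI to I^3/Q^2 I is injective,
    so the length is exactly 8. *)
Lemma colon_nontrivial l : idpow I 3 = idmul Q I2 ->
  rel_length (idmul Q I) I2 4 ->
  rel_length (idmul (idpow Q 2) I) (idpow I 3) l -> (l < 8)%N ->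
  exists2 x, colon x & ~ I x.
Proof.
move=> I3 l4 l3 l8; apply: contrapT => noW.
have WI x : colon x -> I x by move=> Wx; apply: contrapT => nIx; apply: noW; exists x.
have nil_free : free_mod m (idmul Q I) [::] by [].
have [//|s [s4 sI2 free_s]] := free_mod_complete mloc l4 mI2 _ nil_free.
rewrite cat0s in s4 free_s.
have span_s := free_mod_span mloc l4 mI2 sI2 free_s s4.
pose g (t : 'I_(size s) + 'I_(size s)) : A^o :=
  match t with inl i => a * s`_i | inr i => b * s`_i end.
have sumE (k : 'I_(size s) + 'I_(size s) -> A) : \sum_t k t * g t =
    a * lincomb (fun i => oapp (k \o inl) 0 (insub i)) s +
    b * lincomb (fun i => oapp (k \o inr) 0 (insub i)) s.
  rewrite big_sumType /= /lincomb !mulr_sumr; congr (_ + _); apply: eq_bigr => i _;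
  by rewrite valK /= mulrCA.
have mq i : (i < size s)%N -> forall x, m x -> idmul Q I (x * s`_i).
  by move=> si x mx; apply: mI2; apply: idmul_mem => //; exact/sI2/mem_nth.
have Q2E x : idmul (idpow Q 2) I x <-> exists u v,
    [/\ idmul Q I u, idmul Q I v & x = a * u + b * v].
  by rewrite /= idmulT -idmulA; exact: (idmulQP QP).
suff l3' : rel_length (idmul (idpow Q 2) I) (idpow I 3) 8.
  by rewrite (is_max_uniq l3 l3') in l8.
have <- : (#|{: 'I_(size s) + 'I_(size s)}| * 1 = 8)%N.
  by rewrite muln1 card_sum !card_ord s4.
rewrite I3; apply: (@rel_length_basis _ _ _ _ m 1 _ g).
- exact: rel_length_max.
- by rewrite /= idmulT -idmulA; apply: idmulS => //; exact: idmulQI_sub.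
- case=> i /=; apply: idmul_mem; try exact/sI2/mem_nth.
    exact: Qa QP.
  exact: Qb QP.
- move=> x t mx; apply/Q2E; case: t => i; [exists (x * s`_i), 0|exists 0, (x * s`_i)].
    split; [exact: mq|exact: ideal0|].
    by rewrite mulr0 addr0 [LHS]mulrCA.
  split; [exact: ideal0|exact: mq|].
  by rewrite mulr0 add0r [LHS]mulrCA.
- move=> x /(idmulQP QP)[u [v [/span_s[c uc] /span_s[d vd] ->]]].
  exists (fun t : 'I_(size s) + 'I_(size s) => match t with inl i => c i | inr i => d i end).
  rewrite [X in submod_set _ (_ - X)]sumE; apply/Q2E.
  exists (u - lincomb c s), (v - lincomb d s); split=> //.
  have E (k : nat -> A) : lincomb (fun i => oapp (fun i : 'I_(size s) => k i) 0 (insub i)) s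
      = lincomb k s by apply: eq_bigr => i _; rewrite valK.
  by rewrite -(E c) -(E d) /=; ring.
move=> k; rewrite [X in submod_set _ X]sumE => /Q2E[u [v [QIu QIv E]]].
pose c (i : nat) := oapp (k \o inl) 0 (insub i : option 'I_(size s)).
pose d (i : nat) := oapp (k \o inr) 0 (insub i : option 'I_(size s)).
change (a * lincomb c s + b * lincomb d s = a * u + b * v) in E.
have [|w [uw vw]] := koszul_ab.1 (lincomb c s - u) (lincomb d s - v).
  by apply: (addrI (a * u + b * v)); rewrite addr0 -[RHS]E; ring.
have lsI2 (x : nat -> A) : I2 (lincomb x s).
  by apply: ideal_sum => i _; apply/ideal_mull/sI2/mem_nth.
(* Modulo QI the two combinations are b w and - a w; both are in I^2, so w is in I^2 : Q, which
   equals I under the assumption. *)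
have Iw : I w.
  apply/WI/colonP; split.
    have -> : a * w = v - lincomb d s by rewrite -[a * w]opprK -vw; ring.
    by apply: idealB; [exact: (idmulQI_sub QI)|exact: lsI2].
  by rewrite -uw; apply: idealB; [exact: lsI2|exact: (idmulQI_sub QI)].
have fc : idmul Q I (lincomb c s).
  by apply: ideal_cong QIu; rewrite uw; exact: I_QIb.
have fd : idmul Q I (lincomb d s).
  by apply: ideal_cong QIv; rewrite vw; apply/idealN; exact: I_QIa.
case=> i; first by have := free_s _ fc i (ltn_ord i); rewrite /c valK.
by have := free_s _ fd i (ltn_ord i); rewrite /d valK.
Qed.

End SallyComponents.

(** * Rees algebras and the Sally module *)

Section Rees.
Variables (A : comNzRingType) (J : ideal A).
Implicit Types (K : ideal A) (p q : rees J) (x y : A).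

Lemma rees_in p i : idpow J i (val p)`_i.
Proof. by case: p => p /= /asboolP. Qed.

(** The default 0 of [insubd] makes this total; the intended polynomial is obtained when each u n
    lies in J^n. *)
Definition rees_seq (D : nat) (u : nat -> A) : rees J :=
  insubd 0 (\poly_(n < D) u n).

Lemma val_rees_seq D u : (forall n, idpow J n (u n)) ->
  val (rees_seq D u) = \poly_(n < D) u n.
Proof.
move=> Ju; rewrite /rees_seq insubdK //; apply/asboolP => n; rewrite coef_poly.
by case: ifP => // _; exact: ideal0.
Qed.

Definition rees_mon i x : rees J := insubd 0 (x *: 'X^i).

Lemma val_rees_mon i x : idpow J i x -> val (rees_mon i x) = x *: 'X^i.
Proof.
move=> Jx; rewrite /rees_mon insubdK //; apply/asboolP => n; rewrite coefZ coefXn.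
by case: eqP => [->|_]; rewrite ?mulr1 ?mulr0 //; exact: ideal0.
Qed.

Lemma rees_sum_mon p : p = \sum_(i < size (val p)) rees_mon i (val p)`_i.
Proof.
apply: val_inj; rewrite raddf_sum -[LHS]coefK poly_def; apply: eq_bigr => i _.
by rewrite /= val_rees_mon //; exact: rees_in.
Qed.

Lemma idmul_idpowM K i j x y :
  idpow J i x -> idmul K (idpow J j) y -> idmul K (idpow J (i + j)) (x * y).
Proof.
move=> Jx; apply: (idmul_ind (f := fun y => x * y)) => [*|*|u v Ku Jv].
- exact: mulrDr.
- exact: mulrCA.
- by rewrite mulrCA; apply: idmul_mem => //; exact: idpowM.
Qed.

(** The ideal K A[Jt] has K J^i in degree i. Equality in B and in G thus becomes a condition on
    coefficients. *)
Lemma span_reesC K p : Defs.span (reesC J @` K : set (rees J)^o) p <->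
  forall i, idmul K (idpow J i) (val p)`_i.
Proof.
split.
  have S0 i : idmul K (idpow J i) (val (0 : rees J))`_i.
    by rewrite raddf0 coef0; exact: ideal0.
  have SD (q q' : (rees J)^o) : (forall i, idmul K (idpow J i) (val (q : rees J))`_i) ->
      (forall i, idmul K (idpow J i) (val (q' : rees J))`_i) ->
      forall i, idmul K (idpow J i) (val (q + q' : rees J))`_i.
    by move=> Kq Kq' i; rewrite raddfD coefD; exact: idealD.
  have SZ (t : rees J) (q : (rees J)^o) :
      (forall i, idmul K (idpow J i) (val (q : rees J))`_i) ->
      forall i, idmul K (idpow J i) (val (t *: q : (rees J)^o))`_i.
    move=> Kq i; rewrite [val _](rmorphM _ t q) coefM; apply: ideal_sum => k _.
    by have := idmul_idpowM (rees_in t k) (Kq (i - k)%N); rewrite subnKC // -ltnS.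
  apply: (Defs.span_min (N := Submod S0 SD SZ)) => _ [x Kx <-] i /=.
  rewrite coefC; case: eqP => [->|_]; last exact: ideal0.
  by rewrite idmulT.
move=> Kp; rewrite (rees_sum_mon p); apply: ideal_sum => i _.
set S := Defs.span _.
(* Membership in J^i is carried along because [rees_mon] falls back to 0 outside J^i. *)
have T0 : idpow J i (0 : A) /\ S (rees_mon i 0).
  split; first exact: ideal0; have -> : rees_mon i 0 = 0.
    by apply: val_inj; rewrite val_rees_mon ?scale0r ?raddf0 //; exact: ideal0.
  exact: ideal0.
have TD (x y : A^o) : idpow J i x /\ S (rees_mon i x) ->
    idpow J i y /\ S (rees_mon i y) -> idpow J i (x + y) /\ S (rees_mon i (x + y)).
  move=> [Jx Sx] [Jy Sy]; split; first exact: idealD.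
  have -> : rees_mon i (x + y) = rees_mon i x + rees_mon i y.
    by apply: val_inj; rewrite raddfD /= !val_rees_mon ?scalerDl //; exact: idealD.
  exact: idealD.
have TZ (c : A) (x : A^o) : idpow J i x /\ S (rees_mon i x) ->
    idpow J i (c * x) /\ S (rees_mon i (c * x)).
  move=> [Jx Sx]; split; first exact: ideal_mull.
  have -> : rees_mon i (c * x) = reesC J c * rees_mon i x.
    apply: val_inj; rewrite rmorphM /= !val_rees_mon //; last exact: ideal_mull.
    by rewrite mul_polyC scalerA.
  exact: ideal_mull.
suff [] : (Submod T0 TD TZ : ideal A) (val p)`_i by [].
apply: idmul_min (Kp i) => x y Kx Jy; split; first exact: ideal_mull.
have -> : rees_mon i (x * y) = reesC J x * rees_mon i y.
  apply: val_inj; rewrite rmorphM /= !val_rees_mon //; last exact: ideal_mull.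
  by rewrite mul_polyC scalerA.
by apply: ideal_mulr; apply: Defs.sub_span; exists x.
Qed.

Lemma ring_proj_eq0 K p :
  ring_proj (Defs.span (reesC J @` K : set (rees J)^o)) p = 0 <->
  forall i, idmul K (idpow J i) (val p)`_i.
Proof. by rewrite -span_reesC; exact: quo_proj_eq0. Qed.

End Rees.

Section Extend.
Variables (A : comNzRingType) (I J Q : ideal A).
Hypothesis QJ : Q `<=` J.

(** The two submodules defining the Sally module are the cases J = Q and J = I: in degree i they are
    IQ^i and I^(i+1). *)
Lemma extendP (z : {poly A}) : extend I Q (range (@rees_val A J)) z <->
  forall i, idmul I (idpow J i) z`_i.
Proof.
split.
  have S0 i : idmul I (idpow J i) (0 : {poly A})`_i by rewrite coef0; exact: ideal0.
  have SD (p q : rees_poly Q) : (forall i, idmul I (idpow J i) (p : {poly A})`_i) ->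
      (forall i, idmul I (idpow J i) (q : {poly A})`_i) ->
      forall i, idmul I (idpow J i) (p + q : {poly A})`_i.
    by move=> Ip Iq i; rewrite coefD; exact: idealD.
  have SZ (t : rees Q) (p : rees_poly Q) :
      (forall i, idmul I (idpow J i) (p : {poly A})`_i) ->
      forall i, idmul I (idpow J i) (val t * (p : {poly A}))`_i.
    move=> Ip i; rewrite coefM; apply: ideal_sum => k _.
    have Jt := idpowSubset QJ (rees_in t k).
    by have := idmul_idpowM Jt (Ip (i - k)%N); rewrite subnKC // -ltnS.
  apply: (Defs.span_min (N := Submod S0 SD SZ)) => _ [x [p [Ix [q _ <-] ->]]] i /=.
  by rewrite coefCM; apply: idmul_mem => //; exact: (rees_in q).
move=> Iz; rewrite -[z]coefK poly_def; apply: submod_sum => i _.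
set S := extend _ _ _.
have T0 : S ((0 : A) *: 'X^i) by rewrite scale0r; exact: submod0.
have TD (x y : A^o) : S ((x : A) *: 'X^i) -> S ((y : A) *: 'X^i) ->
    S ((x + y : A) *: 'X^i).
  by move=> Sx Sy; rewrite scalerDl; exact: submodD.
have TZ (c : A) (x : A^o) : S ((x : A) *: 'X^i) -> S ((c * x : A) *: 'X^i).
  move=> Sx; have -> : (c * x) *: 'X^i = c%:P * (x *: 'X^i) by rewrite mul_polyC scalerA.
  exact: (submodZ (reesC Q c) Sx).
apply: (idmul_min (P := Submod T0 TD TZ)) (Iz i) => x y Ix Jy.
apply: Defs.sub_span; exists x, (y *: 'X^i); split=> //.
  by exists (rees_mon J i y) => //; exact: val_rees_mon.
by rewrite mul_polyC scalerA.
Qed.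

End Extend.

Section Homogeneous.
Variables (A : comNzRingType).
Implicit Types (p q : {poly A}).

Lemma homog0 n : homog n (0 : {poly A}).
Proof. by move=> i _; rewrite coef0. Qed.

Lemma homogD n p q : homog n p -> homog n q -> homog n (p + q).
Proof. by move=> hp hq i ni; rewrite coefD hp ?hq ?addr0. Qed.

Lemma homogN n p : homog n p -> homog n (- p).
Proof. by move=> hp i ni; rewrite coefN hp ?oppr0. Qed.

Lemma homogM n k p q : homog n p -> homog k q -> homog (n + k) (p * q).
Proof.
move=> hp hq i ni; rewrite coefM big1 // => j _.
have [jn|jn] := eqVneq (j%:Z) n; last by rewrite hp ?mul0r.
rewrite [q`__]hq ?mulr0 //; apply: contraNneq ni => <-.
by rewrite -jn -PoszD subnKC // -ltnS.
Qed.

Lemma homog_mon (i : nat) (x : A) : homog i (x *: 'X^i).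
Proof.
by move=> j; rewrite coefZ coefXn eqz_nat => /negPf ->; rewrite mulr0.
Qed.

Lemma homogE (i : nat) p : homog i p -> p = p`_i *: 'X^i.
Proof.
move=> hp; apply/polyP => j; rewrite coefZ coefXn.
have [->|ji] := eqVneq j i; first by rewrite mulr1.
by rewrite mulr0 hp // eqz_nat.
Qed.

End Homogeneous.

Section SallyModule.
Variables (A : comNzRingType) (m I Q : ideal A).
Hypotheses (QI : Q `<=` I) (h : m_kills_sally I Q m).

Local Notation B := (fiberT Q m).
Local Notation S := (sallyB h).
Local Notation proj := (ring_proj (Defs.span (reesC Q @` m : set (rees Q)^o))).
Local Notation N := (extend I Q (range (@rees_val A Q))).
Local Notation L := (extend I Q (range (@rees_val A I))).

Implicit Types (p q : {poly A}) (s t : S).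

Definition sally_class (p : {poly A}) (s : S) : Prop := @class_of _ _ N L p s.

Lemma sally_class_ex p : (forall i, idpow I i.+1 p`_i) -> exists s, sally_class p s.
Proof. by move=> Ip; apply: (quo_iso_dom (class_ofP N L)); apply/extendP. Qed.

Lemma sally_class_onto s : exists p, sally_class p s.
Proof. exact: (quo_iso_cod (class_ofP N L)). Qed.

Lemma sally_class_in p s : sally_class p s -> forall i, idpow I i.+1 p`_i.
Proof. by move=> /(quo_iso_subl (class_ofP N L))/extendP H; exact: H. Qed.

Lemma sally_class_eq0 p s : sally_class p s ->
  s = 0 <-> forall i, idmul I (idpow Q i) p`_i.
Proof.
move=> ps; rewrite -(extendP I (@subset_refl _ Q)).
by apply: iff_sym; rewrite (quo_iso_ker (class_ofP N L) ps) zerosubE.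
Qed.

Lemma sally_classD p q s t : sally_class p s -> sally_class q t ->
  sally_class (p + q) (s + t).
Proof. exact: (quo_isoD (class_ofP N L)). Qed.

Lemma sally_classZ (r : rees Q) p s : sally_class p s ->
  sally_class (val r * p) (proj r *: s).
Proof.
rewrite [proj r *: s](over_scaleE h r s).
exact: (quo_isoZ (class_ofP N L)).
Qed.

Lemma sally_class0 : sally_class 0 0.
Proof.
have [|s ps] := @sally_class_ex 0; first by move=> i; rewrite coef0; exact: ideal0.
suff <- : s = 0 by []; apply/(sally_class_eq0 ps) => i; rewrite coef0; exact: ideal0.
Qed.

Lemma sally_classN p s : sally_class p s -> sally_class (- p) (- s).
Proof.
by move=> /(quo_isoZ (class_ofP N L) (-1)); rewrite !scaleN1r.
Qed.

Lemma sally_class_inj p s t : sally_class p s -> sally_class p t -> s = t.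
Proof.
move=> ps /sally_classN pt; apply/eqP; rewrite -subr_eq0; apply/eqP.
apply/(sally_class_eq0 (sally_classD ps pt)) => i.
by rewrite subrr coef0; exact: ideal0.
Qed.

Lemma sally_class_sum (T : finType) (p : T -> {poly A}) (s : T -> S) :
  (forall k, sally_class (p k) (s k)) -> sally_class (\sum_k p k) (\sum_k s k).
Proof.
move=> ps; elim/big_ind2: _ => // [|*]; first exact: sally_class0.
exact: sally_classD.
Qed.

Lemma sally_grP n s : sallyB_gr h n s <-> exists2 p, homog n p & sally_class p s.
Proof.
split=> [[x hx <-]|[p hp [u [up us]]]]; first by exists (val x) => //; exists x.
by exists u => //=; rewrite up.
Qed.

Section Presentation.
Variables (r : nat) (f : 'I_r -> A) (eps : {linear 'rV[B]_r -> S}).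
Hypothesis epsf : forall i, sally_class (f i *: 'X) (eps (delta_mx 0 i)).

Local Notation row P := (\row_i proj (P i)).

Lemma row_lift (v : 'rV[B]_r) : exists P : 'I_r -> rees Q, v = row P.
Proof.
exists (fun i => quo_repr (v 0 i)); apply/rowP => i.
by rewrite mxE ring_reprK.
Qed.

Lemma eps_class (P : 'I_r -> rees Q) :
  sally_class (\sum_i val (P i) * (f i *: 'X)) (eps (row P)).
Proof.
rewrite [row P]row_sum_delta linear_sum /=; apply: sally_class_sum => i.
by rewrite linearZ /= mxE; exact: sally_classZ.
Qed.

Lemma coef_eps_class (P : 'I_r -> rees Q) i :
  (\sum_j val (P j) * (f j *: 'X))`_i =
  if i is i'.+1 then \sum_j (val (P j))`_i' * f j else 0.
Proof.
rewrite coef_sum; case: i => [|i].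
  by rewrite big1 // => j _; rewrite -scalerAr coefZ coefMX mulr0.
by apply: eq_bigr => j _; rewrite -scalerAr coefZ coefMX mulrC.
Qed.

(** Relations hold degree by degree; the exponent i + 1 comes from the factor t carried by the
    generators f_j t. *)
Lemma eps_eq0 (P : 'I_r -> rees Q) : eps (row P) = 0 <->
  forall i, idmul I (idpow Q i.+1) (\sum_j (val (P j))`_i * f j).
Proof.
rewrite (sally_class_eq0 (eps_class P)); split=> H i.
  by have := H i.+1; rewrite coef_eps_class.
by rewrite coef_eps_class; case: i => [|i]; [exact: ideal0|exact: H].
Qed.

Lemma eps_onto : (forall s, exists v, eps v = s) <->
  forall n (x : A), idpow I n.+2 x -> exists p : 'I_r -> A,
    (forall j, idpow Q n (p j)) /\ idmul I (idpow Q n.+1) (x - \sum_j p j * f j).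
Proof.
split=> [onto n x Ix|gen s].
  have [|s ps] := @sally_class_ex (x *: 'X^(n.+1)).
    move=> i; rewrite coefZ coefXn; case: eqP => [->|_]; first by rewrite mulr1.
    by rewrite mulr0; exact: ideal0.
  have [v] := onto s; have [P ->] := row_lift v => vs.
  exists (fun j => (val (P j))`_n); split=> [j|]; first exact: rees_in.
  have := eps_class P; rewrite vs => /sally_classN/(sally_classD ps)/sally_class_eq0.
  rewrite subrr => -[/(_ erefl)/(_ n.+1) + _].
  by rewrite coefB coef_eps_class coefZ coefXn eqxx mulr1.
have [q qs] := sally_class_onto s.
have [p pE] := choice (fun n => gen n _ (sally_class_in qs n.+1)).
pose P j := rees_seq Q (size q) (fun n => p n j).
have valP j : val (P j) = \poly_(n < size q) p n j.
  by apply: val_rees_seq => n; have [Qp _] := pE n; exact: Qp.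
exists (row P); apply/eqP; rewrite -subr_eq0; apply/eqP.
apply/(sally_class_eq0 (sally_classD (eps_class P) (sally_classN qs))) => i.
rewrite coefD coefN coef_eps_class; case: i => [|i].
  (* The Sally module is I/I = 0 in degree 0, so the constant coefficient of q, an element of I,
     needs no preimage. *)
  rewrite add0r; apply: idealN; rewrite idmulT.
  by have := sally_class_in qs 0; rewrite idpow1.
under eq_bigr do rewrite valP coef_poly.
have [iq|qi] := ltnP i (size q); first by apply: ideal_subC; case: (pE i).
rewrite big1 => [|j _]; last by rewrite mul0r.
by rewrite nth_default ?subrr ?leqW //; exact: ideal0.
Qed.

End Presentation.
End SallyModule.

(** * The resolution attached to a basis *)

Section LinearCombination.
Variables (R : comPzRingType) (M : lmodType R) (n : nat) (s : 'I_n -> M).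

Definition lin_comb (v : 'rV[R]_n) : M := \sum_i v 0 i *: s i.

Fact lin_comb_is_linear : linear lin_comb.
Proof.
move=> x u v; rewrite /lin_comb scaler_sumr -big_split; apply: eq_bigr => i _ /=.
by rewrite !mxE scalerDl scalerA.
Qed.

HB.instance Definition _ :=
  GRing.isLinear.Build R 'rV[R]_n M *:%R lin_comb lin_comb_is_linear.

Lemma lin_comb_delta i : lin_comb (delta_mx 0 i) = s i.
Proof.
rewrite /lin_comb (bigD1 i) //= mxE !eqxx scale1r big1 ?addr0 // => j /negPf ji.
by rewrite mxE ji andbF scale0r.
Qed.

End LinearCombination.

Lemma lin_comb_koszul (R : comPzRingType) (M : lmodType R) c e (x y : R)
    (s : 'I_(c + c + e) -> M) (u : 'rV[R]_c) :
  (forall j, x *: s (lshift e (lshift c j)) + y *: s (lshift e (rshift c j)) = 0) ->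
  lin_comb s (row_mx (row_mx (x *: u) (y *: u)) 0) = 0.
Proof.
move=> xy0; rewrite /lin_comb !big_split_ord /=.
rewrite [X in _ + X]big1 => [|l _]; last by rewrite row_mxEr mxE scale0r.
rewrite addr0 -big_split; apply: big1 => j _ /=.
rewrite !row_mxEl row_mxEr !mxE [x * _]mulrC [y * _]mulrC.
by rewrite -!scalerA -scalerDr xy0 scaler0.
Qed.

(** * The fiber ring B = A[Qt]/mA[Qt] and its grading *)

Section FiberRing.
Variables (A : comNzRingType) (m Q : ideal A).

Local Notation B := (fiberT Q m).
Local Notation proj := (ring_proj (Defs.span (reesC Q @` m : set (rees Q)^o))).
Implicit Types (x y : B).

Lemma fiber_onto x : exists p, x = proj p.
Proof. by exists (quo_repr x); rewrite ring_reprK. Qed.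

Lemma fiber_eq p q : proj p = proj q <->
  forall i, idmul m (idpow Q i) ((val p)`_i - (val q)`_i).
Proof.
rewrite quo_projP span_reesC; split=> H i; have := H i.
  by rewrite raddfB coefB.
by rewrite raddfB coefB.
Qed.

Lemma fiber_eq0 p : proj p = 0 <-> forall i, idmul m (idpow Q i) (val p)`_i.
Proof. exact: ring_proj_eq0. Qed.

Lemma proj0 : proj 0 = 0. Proof. exact: quo_proj0. Qed.

Lemma projN p : proj (- p) = - proj p.
Proof.
by apply/eqP; rewrite -subr_eq0 opprK -ring_projD addNr; apply/eqP/proj0.
Qed.

Lemma fiberT_grM n k x y : fiberT_gr Q m n x -> fiberT_gr Q m k y ->
  fiberT_gr Q m (n + k) (x * y).
Proof.
move=> [p hp <-] [q hq <-]; exists (p * q); last exact: ring_projM.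
by rewrite /mkset rmorphM; exact: homogM.
Qed.

Lemma fiberT_grN n x : fiberT_gr Q m n x -> fiberT_gr Q m n (- x).
Proof.
move=> [p hp <-]; exists (- p); last exact: projN.
by rewrite /mkset raddfN; exact: homogN.
Qed.

Lemma fiberT_gr0 n : fiberT_gr Q m n 0.
Proof. by exists 0; [rewrite /mkset raddf0; exact: homog0|exact: proj0]. Qed.

Lemma fiberT_gr1 : fiberT_gr Q m 0 1.
Proof.
exists 1 => //; rewrite /mkset rmorph1 => i; rewrite coef1 eqz_nat.
by case: i.
Qed.

Lemma fiberT_gr_mon i (x : A) : idpow Q i x -> fiberT_gr Q m i (proj (rees_mon Q i x)).
Proof.
by move=> Qx; eexists; [|by []]; rewrite /mkset val_rees_mon //; exact: homog_mon.
Qed.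

Lemma fiberT_grP (i : nat) x : fiberT_gr Q m i x ->
  exists2 y : A, idpow Q i y & x = proj (rees_mon Q i y).
Proof.
move=> [p hp <-]; exists (val p)`_i; first exact: rees_in.
congr (proj _); apply: val_inj; rewrite val_rees_mon; last exact: rees_in.
exact: homogE.
Qed.

(** Elements with a lift whose constant coefficient is in m form an ideal [Z] containing all
    components of positive degree; the choice of lift is immaterial, since lifts differ by
    mA[Qt]. *)
Lemma irrelevant_coef r (v : 'rV[B]_r) i p :
  smul (irrelevant (fiberT_gr Q m)) (fullsub 'rV[B]_r) v -> v 0 i = proj p ->
  m (val p)`_0.
Proof.
pose Z : set B := [set x | exists2 p, x = proj p & m (val p)`_0].
have Z0 : Z 0 by exists 0; [rewrite proj0|rewrite raddf0 coef0; exact: ideal0].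
have ZD x y : Z x -> Z y -> Z (x + y).
  move=> [q -> mq] [q' -> mq']; exists (q + q'); first by rewrite ring_projD.
  by rewrite raddfD coefD; exact: idealD.
have ZM x y : Z y -> Z (x * y).
  have [q ->] := fiber_onto x; move=> [q' -> mq'].
  exists (q * q'); first by rewrite ring_projM.
  by rewrite rmorphM coef0M; exact: ideal_mull.
have V0 : forall i, Z ((0 : 'rV[B]_r) 0 i) by move=> j; rewrite mxE.
have VD (u w : 'rV[B]_r) : (forall i, Z (u 0 i)) -> (forall i, Z (w 0 i)) ->
  forall i, Z ((u + w) 0 i) by move=> Zu Zw j; rewrite mxE; exact: ZD.
have VZ (x : B) (u : 'rV[B]_r) : (forall i, Z (u 0 i)) -> forall i, Z ((x *: u) 0 i).
  by move=> Zu j; rewrite mxE; exact: ZM.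
move=> vS vE; have : (Submod V0 VD VZ : submod 'rV[B]_r) v.
  apply: Defs.span_min vS => _ [x [w [irrx _ ->]]] j; rewrite mxE mulrC; apply: (ZM).
  pose ZI : ideal B := @Submod _ B^o Z Z0 ZD ZM.
  apply: (Defs.span_min (N := ZI)) irrx => _ [n [n0 [q hq <-]]]; exists q => //.
  by rewrite hq; [exact: ideal0|rewrite (Order.POrderTheory.lt_eqF n0)].
move=> /(_ i)[q]; rewrite vE => /fiber_eq/(_ 0%N); rewrite idmulT => + mq.
by move/ideal_cong; apply.
Qed.

End FiberRing.

Section Resolution.
Variables (A : comNzRingType) (m I Q : ideal A) (a b : A).
Hypotheses (mloc : local_ring m) (koszul_ab : koszul_exact a b).
Hypothesis QP : forall x, Q x <-> exists u v, x = u * a + v * b.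
Hypotheses (QI : Q `<=` I) (Im : I `<=` m).
Hypothesis mI2 : idmul m (idpow I 2) `<=` idmul Q I.
Hypothesis hk : m_kills_sally I Q m.

Local Notation I2 := (idpow I 2).
Local Notation B := (fiberT Q m).
Local Notation S := (sallyB hk).
Local Notation proj := (ring_proj (Defs.span (reesC Q @` m : set (rees Q)^o))).
Local Notation at_ := (proj (rees_mon Q 1 a)).
Local Notation bt := (proj (rees_mon Q 1 b)).

Lemma sally_gr_sum n (T : finType) (s : T -> S) :
  (forall t, sallyB_gr hk n (s t)) -> sallyB_gr hk n (\sum_t s t).
Proof.
move=> sn; elim/big_ind: _ => // [|s1 s2].
  by apply/sally_grP; exists 0; [exact: homog0|exact: sally_class0].
move=> /sally_grP[p1 hp1 ps1] /sally_grP[p2 hp2 ps2]; apply/sally_grP.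
by exists (p1 + p2); [exact: homogD|exact: sally_classD].
Qed.

Lemma sally_gr_scale n k x s : fiberT_gr Q m n x -> sallyB_gr hk k s ->
  sallyB_gr hk (n + k) (x *: s).
Proof.
move=> [p hp <-] /sally_grP[q hq qs]; apply/sally_grP.
by exists (val p * q); [exact: homogM|exact: sally_classZ].
Qed.

Lemma Qa1 : idpow Q 1 a. Proof. by rewrite idpow1; exact: Qa QP. Qed.
Lemma Qb1 : idpow Q 1 b. Proof. by rewrite idpow1; exact: Qb QP. Qed.

Lemma val_mon1 x : idpow Q 1 x -> val (rees_mon Q 1 x) = x *: 'X.
Proof. by move=> Qx; rewrite val_rees_mon // expr1. Qed.

Lemma coef_mon1 x p i : idpow Q 1 x ->
  (val (rees_mon Q 1 x * p))`_i = if i is i'.+1 then x * (val p)`_i' else 0.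
Proof.
move=> Qx; rewrite rmorphM /= val_mon1 // -scalerAl coefZ coefXM.
by case: i => [|i]; rewrite ?mulr0.
Qed.

Lemma bt_reg x : bt * x = 0 -> x = 0.
Proof.
have [p ->] := fiber_onto x; rewrite -ring_projM => /fiber_eq0 H; apply/fiber_eq0 => i.
apply: (idmul_powQ_regular koszul_ab QP (subset_trans QI Im) (rees_in p i)); right.
by have := H i.+1; rewrite coef_mon1 //; exact: Qb1.
Qed.

Section Basis.
Variables (c e : nat) (h : 'I_c -> A) (f : 'I_e -> A).
Hypothesis hf : sally_basis m I Q a b h f.
Hypothesis I3 : idpow I 3 = idmul Q I2.

Let g (i : 'I_(c + c + e)) : A :=
  row_mx (row_mx (\row_j (a * h j)) (\row_j (b * h j))) (\row_l f l) 0 i.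

Let g1 j : g (lshift e (lshift c j)) = a * h j.
Proof. by rewrite /g !row_mxEl mxE. Qed.

Let g2 j : g (lshift e (rshift c j)) = b * h j.
Proof. by rewrite /g row_mxEl row_mxEr mxE. Qed.

Let g3 l : g (rshift (c + c) l) = f l.
Proof. by rewrite /g row_mxEr mxE. Qed.

Let sum_g (p : 'I_(c + c + e) -> A) : \sum_i p i * g i =
  \sum_j p (lshift e (lshift c j)) * (a * h j) +
  \sum_j p (lshift e (rshift c j)) * (b * h j) +
  \sum_l p (rshift (c + c) l) * f l.
Proof.
rewrite !big_split_ord /=; congr (_ + _ + _); apply: eq_bigr => j _.
- by rewrite g1.
- by rewrite g2.
- by rewrite g3.
Qed.

(** Row j is the syzygy bt (a h_j) - at (b h_j) = 0; the zero block reflects that the f_l enter no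
    relation. *)
Definition koszul_mx : 'M[B]_(c, c + c + e) :=
  row_mx (row_mx bt%:M (- at_)%:M) 0.

Lemma mul_koszul_mx (u : 'rV[B]_c) :
  u *m koszul_mx = row_mx (row_mx (bt *: u) (- at_ *: u)) 0.
Proof. by rewrite !mul_mx_row !mul_mx_scalar mulmx0. Qed.

(** Generators are elements of I^2 times t, in degree 1; the matrix entries have degree 1, which
    puts relations in degree 2 and gives minimality. Exactness in the middle is [sally_relation] in
    each degree. *)
Lemma sally_resolution :
  min_free_resolution (fiberT_gr Q m) (sallyB_gr hk) c (-2) (c + c + e) (-1).
Proof.
have gI2 i : I2 (g i).
  case: (split_ordP i) => [k ->|l ->]; last by rewrite g3; exact: sb_f hf l.
  by case: (split_ordP k) => j ->; rewrite ?g1 ?g2; have /colonP[] := sb_h hf j.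
have sex i : exists s : S, sally_class (g i *: 'X) s.
  apply: (sally_class_ex QI) => n; rewrite coefZ coefX.
  by case: n => [|[|n]]; rewrite ?mulr0 ?mulr1 //; exact: ideal0.
have [s sE] := choice sex.
pose eps : {linear 'rV[B]_(c + c + e) -> S} := lin_comb s.
have epsg i : sally_class (g i *: 'X) (eps (delta_mx 0 i)).
  by rewrite /eps /= lin_comb_delta.
pose phi : {linear 'rV[B]_c -> 'rV[B]_(c + c + e)} := @mulmxr B 1 _ _ koszul_mx.
have phiE u : phi u = row_mx (row_mx (bt *: u) (- at_ *: u)) 0 by exact: mul_koszul_mx.
have gr_at : fiberT_gr Q m 1 at_ by apply: fiberT_gr_mon; exact: Qa1.
have gr_bt : fiberT_gr Q m 1 bt by apply: fiberT_gr_mon; exact: Qb1.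
have irr x : fiberT_gr Q m 1 x -> irrelevant (fiberT_gr Q m) x.
  by move=> x1; apply: Defs.sub_span; exists 1.
exists phi, eps; split.
- split=> n v vn.
    have shiftE : (-1 + n = 1 + (-2 + n))%R by ring.
    move=> i; rewrite phiE /shift shiftE; case: (split_ordP i) => [k ->|l ->].
      rewrite row_mxEl; case: (split_ordP k) => j ->; rewrite ?row_mxEl ?row_mxEr mxE.
        exact: fiberT_grM (vn j).
      by apply: fiberT_grM (vn j); exact: fiberT_grN.
    by rewrite row_mxEr mxE; exact: fiberT_gr0.
  apply: sally_gr_sum => i; have -> : n = (-1 + n) + 1 by ring.
  apply: sally_gr_scale (vn i) _; apply/sally_grP; exists (g i *: 'X) => //.
  by rewrite -[X in _ *: X]expr1; exact: homog_mon.
(* The block of bt alone gives injectivity, bt being a nonzerodivisor of B. *)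
- move=> u u'; rewrite !phiE => /eq_row_mx[/eq_row_mx[buu' _] _]; apply/rowP => j.
  apply/eqP; rewrite -subr_eq0; apply/eqP/bt_reg; rewrite mulrBr.
  by apply/eqP; rewrite subr_eq0; apply/eqP; move/rowP/(_ j): buu'; rewrite !mxE.
- move=> v; split=> [|[u <-]]; last first.
    rewrite phiE; apply: lin_comb_koszul => j.
    have Ha := sally_classZ (rees_mon Q 1 b) (sE (lshift e (lshift c j))).
    have Hb := sally_classZ (- rees_mon Q 1 a) (sE (lshift e (rshift c j))).
    rewrite projN in Hb; apply: sally_class_inj (sally_classD Ha Hb) _.
    rewrite g1 g2 raddfN /= (val_mon1 Qa1) (val_mon1 Qb1).
    have -> : b *: 'X * ((a * h j) *: 'X) + - (a *: 'X) * ((b * h j) *: 'X) = 0 :> {poly A}.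
      by rewrite -!mul_polyC !polyCM; ring.
    exact: sally_class0.
  have [P ->] := row_lift v; move=> /(eps_eq0 QI epsg) H.
  have rel n : exists u : 'I_c -> A,
    [/\ forall j, if n is n'.+1 then idpow Q n' (u j) : Prop else u j = 0,
        forall j, idmul m (idpow Q n) ((val (P (lshift e (lshift c j))))`_n - b * u j),
        forall j, idmul m (idpow Q n) ((val (P (lshift e (rshift c j))))`_n + a * u j)
      & forall l, idmul m (idpow Q n) (val (P (rshift (c + c) l)))`_n].
    apply: (sally_relation koszul_ab QP QI hf) => [j|j|l|]; try exact: rees_in.
    by have := H n; rewrite sum_g.
  have {rel}[u uE] := choice rel.
  (* D bounds all degrees in P, so the degreewise multipliers assemble into polynomials. The one
     found in degree n + 1 has degree n, whence the shift in [U]. *)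
  pose D := \max_i size (val (P i)).
  pose U j := rees_seq Q D (fun n => u n.+1 j).
  have valU j n : (val (U j))`_n = if (n < D)%N then u n.+1 j else 0.
    rewrite /U val_rees_seq ?coef_poly // => k.
    by have [Qu _ _ _] := uE k.+1; exact: Qu j.
  have P0 i n : (D <= n)%N -> (val (P i))`_n = 0.
    by move=> Dn; apply: nth_default; apply: leq_trans Dn; exact: leq_bigmax.
  have u0 j : u 0%N j = 0 by have [Qu _ _ _] := uE 0%N; exact: Qu.
  exists (\row_j proj (U j)); rewrite phiE; apply/rowP => i.
  rewrite [in RHS]mxE; case: (split_ordP i) => [k ->|l ->]; last first.
    rewrite row_mxEr mxE; apply/esym/fiber_eq0 => n.
    by have [_ _ _ H3] := uE n; exact: H3.
  rewrite row_mxEl; case: (split_ordP k) => j ->.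
    rewrite row_mxEl !mxE -ring_projM; apply/fiber_eq => n; apply: ideal_subC.
    rewrite coef_mon1; last exact: Qb1.
    have [_ H1 _ _] := uE n; move: {H1}(H1 j).
    case: n => [|n]; first by rewrite u0 mulr0.
    rewrite valU; case: ltnP => // Dn.
    by rewrite !P0 // 1?leqW // mulr0 subr0 => _; exact: ideal0.
  rewrite row_mxEr !mxE -projN -ring_projM mulNr; apply/fiber_eq => n; apply: ideal_subC.
  rewrite raddfN coefN opprK coef_mon1; last exact: Qa1.
  have [_ _ H2 _] := uE n; move: {H2}(H2 j).
  case: n => [|n]; first by rewrite u0 mulr0.
  rewrite valU; case: ltnP => // Dn.
  by rewrite !P0 // 1?leqW // mulr0 addr0 => _; exact: ideal0.
- apply/(eps_onto QI epsg) => n x /(sally_generate QP hf I3).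
  move=> [p1 [p2 [p3 [Qp1 Qp2 Qp3 H]]]].
  exists (fun i => match split i with
    | inl k => match split k with inl j => p1 j | inr j => p2 j end
    | inr l => p3 l end).
  split=> [i|]; first by case: (split i) => // k; case: (split k).
  rewrite sum_g; move: H; congr (submod_set _ (_ - (_ + _ + _))); apply: eq_bigr => j _.
  - by rewrite (unsplitK (inl (lshift c j))) (unsplitK (inl j)).
  - by rewrite (unsplitK (inl (rshift c j))) (unsplitK (inr j)).
  - by rewrite (unsplitK (inr j)).
- move=> u; rewrite phiE.
  have -> : row_mx (row_mx (bt *: u) (- at_ *: u)) 0 =
      bt *: row_mx (row_mx u 0) 0 + (- at_) *: row_mx (row_mx 0 u) 0 :> 'rV_(c + c + e).
    by rewrite !scale_row_mx !add_row_mx !scaler0 !addr0 add0r.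
  apply: submodD; apply: Defs.sub_span; [exists bt|exists (- at_)]; eexists; split=> //.
    exact: irr.
  by apply/idealN/irr.
Qed.

End Basis.
End Resolution.

(** * The basis attached to a resolution *)

Section FromResolution.
Variables (A : comNzRingType) (m I Q : ideal A) (a b : A).
Hypotheses (mloc : local_ring m) (koszul_ab : koszul_exact a b).
Hypothesis QP : forall x, Q x <-> exists u v, x = u * a + v * b.
Hypotheses (QI : Q `<=` I) (Im : I `<=` m).
Local Notation I2 := (idpow I 2).
Local Notation lc u h := (\sum_j u j * h j).
Implicit Types (x y : A).

(** Since I^(i+2) = I^2 Q^i, multiplication by m in degree i + 1 lands in (QI)Q^i = IQ^(i+1). *)
Lemma m_kills_sallyP : idpow I 3 = idmul Q I2 ->
  idmul m I2 `<=` idmul Q I -> m_kills_sally I Q m.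
Proof.
move=> I3 mI2 _ s [x mx <-].
have [p ps] := quo_iso_cod (class_ofP _ _) (Logic.I : fullsub (sally I Q) s).
have xps := quo_isoZ (class_ofP _ _) (reesC Q x) ps.
suff : zerosub _ (reesC Q x *: s) by rewrite zerosubE.
apply/(quo_iso_ker (class_ofP _ _) xps)/(extendP I (@subset_refl _ Q)) => i.
rewrite coefCM.
have /(extendP I QI)/(_ i) Ip := quo_iso_subl (class_ofP _ _) ps.
case: i Ip => [|i] Ip; first by rewrite idmulT in Ip *; exact: ideal_mull.
rewrite idmul_powQS; apply: (idmulS mI2 (@subset_refl _ (idpow Q i))).
rewrite -[idmul (idmul m _) _](idmulA m I2); apply: idmul_mem => //.
by rewrite -(idpow_form I3).
Qed.

Hypothesis hk : m_kills_sally I Q m.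
Local Notation B := (fiberT Q m).
Local Notation S := (sallyB hk).
Local Notation proj := (ring_proj (Defs.span (reesC Q @` m : set (rees Q)^o))).

Lemma m_kills_I2 : idmul m I2 `<=` idmul Q I.
Proof.
apply: idmul_min => x y mx Iy.
have [|s ys] := @sally_class_ex A m I Q QI hk (y *: 'X).
  move=> i; rewrite coefZ coefX.
  by case: i => [|[|i]]; rewrite ?mulr0 ?mulr1 //; exact: ideal0.
have xys : @sally_class A m I Q hk (x%:P * (y *: 'X)) 0.
  have := quo_isoZ (class_ofP _ _) (reesC Q x) ys.
  by rewrite hk; last by exists x.
have [/(_ erefl)/(_ 1%N) + _] := sally_class_eq0 xys.
by rewrite coefCM coefZ coefX mulr1 idpow1 idmulC.
Qed.

Variables (r0 r1 : nat).
Hypothesis res : min_free_resolution (fiberT_gr Q m) (sallyB_gr hk) r1 (-2) r0 (-1).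

Lemma proj_sum (T : finType) (P : T -> rees Q) : proj (\sum_t P t) = \sum_t proj (P t).
Proof. by apply: (big_morph proj); [exact: ring_projD|exact: proj0]. Qed.

(** Modulo QI the pair (x, y) is a Koszul multiple w(b, -a). Applied to a linear relation, with x
    and y in I^2, this yields w in I^2 : Q. *)
Lemma koszul_div (x y : A) : idmul I (idpow Q 2) (a * x + b * y) ->
  exists w, idmul Q I (x - b * w) /\ idmul Q I (y + a * w).
Proof.
rewrite idmul_powQS idpow1 idmulC => /(idmulQP QP)[u [v [QIu QIv E]]].
have [|w [uE vE]] := koszul_ab.1 (x - u) (y - v).
  by apply: (addrI (a * u + b * v)); rewrite addr0 -[RHS]E; ring.
exists w; rewrite -uE; split; first by rewrite opprB addrC subrK.
by rewrite -[a * w]opprK -vE opprB addrC subrK.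
Qed.

(** Minimality makes the degree 1 generators f_i independent modulo QI. The entries of phi are
    linear, so each basis relation gives an h_j in I^2 : Q by [koszul_div]; exactness makes the h_j
    span modulo I, and injectivity of phi makes them independent. *)
Lemma resolution_data :
  [/\ idpow I 3 = idmul Q I2, rel_length (idmul Q I) I2 r0
    & rel_length I (colon I a b) r1].
Proof.
have mI2 := m_kills_I2.
have [phi [eps [[phi_gr eps_gr] phi_inj phi_eps eps_onto_ irr]]] := res.
have delta_gr r (i k : 'I_r) : fiberT_gr Q m 0 (delta_mx 0 i 0 k).
  by rewrite mxE eqxx; case: (k == i); [exact: fiberT_gr1|exact: fiberT_gr0].
have fex i : exists x, I2 x /\ sally_class (x *: 'X) (eps (delta_mx 0 i)).
  have /sally_grP[p hp ps] : sallyB_gr hk 1 (eps (delta_mx 0 i)).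
    by apply: eps_gr => k; rewrite /shift addNr; exact: delta_gr.
  exists p`_1; split; first exact: (sally_class_in QI ps 1).
  by rewrite -['X]expr1 -homogE.
have {fex}[f fE] := choice fex.
have fI2 i : I2 (f i) by have [] := fE i.
have epsf i : sally_class (f i *: 'X) (eps (delta_mx 0 i)) by have [] := fE i.
have QIE : idmul I (idpow Q 1) = idmul Q I by rewrite idpow1 idmulC.
have span_f n x := (eps_onto QI epsf).1 eps_onto_ n x.
(* A relation with constant coefficients lies in the image of phi, hence has entries in the
   irrelevant ideal, so the constants vanish in A/m. *)
have free_f (c : 'I_r0 -> A) : idmul Q I (lc c f) -> forall i, m (c i).
  move=> cf i; have : eps (\row_i proj (reesC Q (c i))) = 0.
    apply/(eps_eq0 QI epsf) => -[|n].
      by rewrite QIE; move: cf; congr (submod_set _ _); apply: eq_bigr => k _; rewrite coefC.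
    rewrite big1 => [|k _]; last by rewrite coefC mul0r.
    exact: ideal0.
  move=> /phi_eps[u uE]; have := irr u; rewrite uE => /irrelevant_coef.
  by move=> /(_ i (reesC Q (c i))); rewrite mxE coefC; apply.
have I2_span x : I2 x -> exists c : 'I_r0 -> A, idmul Q I (x - lc c f).
  by move=> /(span_f 0%N)[p [_]]; rewrite QIE; exists p.
have mf (x : A) i : m x -> idmul Q I (x * f i).
  by move=> mx; apply: mI2; exact: idmul_mem.
split.
- apply: submod_eqP => x; last first.
    exact: (idmulS QI (@subset_refl _ (idpow I 2))).
  (* Surjectivity in degree 2 expresses I^3 through Q f_i and IQ^2, all inside Q I^2. *)
  move=> /(span_f 1%N)[p [Qp H]]; apply: ideal_cong.
    rewrite idmul_powQS idpow1 idmulC in H.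
    exact: (idmulS (@subset_refl _ Q) (idmulQI_sub QI)) H.
  apply: ideal_sum => i _; apply: idmul_mem => //.
  by have := Qp i; rewrite idpow1.
- rewrite -[r0]muln1 -{1}[r0]card_ord.
  apply: (@rel_length_basis _ _ _ _ m 1 _ (fun i => (f i : A^o))) => //.
  + exact: rel_length_max.
  + exact: idmulQI_sub.
have qex j : exists al be : 'I_r0 -> A, forall i,
    Q (a * al i + b * be i) /\
    phi (delta_mx 0 j) 0 i = proj (rees_mon Q 1 (a * al i + b * be i)).
  have phij : copies (shift (fiberT_gr Q m) (-1)) 2 (phi (delta_mx 0 j)).
    by apply: phi_gr => k; rewrite /shift addNr; exact: delta_gr.
  have H i : exists w : A * A, Q (a * w.1 + b * w.2) /\
      phi (delta_mx 0 j) 0 i = proj (rees_mon Q 1 (a * w.1 + b * w.2)).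
    have /(fiberT_grP (i := 1%N))[y Qy ->] := phij i.
    rewrite idpow1 in Qy; have [u [v yE]] := (QP y).1 Qy.
    by exists (u, v); rewrite /= mulrC (mulrC b) -yE.
  by have [w wE] := choice H; exists (fun i => (w i).1), (fun i => (w i).2).
have {qex}[al alE] := choice qex.
have {alE}[be qE] := choice alE.
have Qq j i : idpow Q 1 (a * al j i + b * be j i) by rewrite idpow1; have [] := qE j i.
pose q j i := rees_mon Q 1 (a * al j i + b * be j i).
have phi_row (U : 'I_r1 -> rees Q) i :
    phi (\row_j proj (U j)) 0 i = proj (\sum_j U j * q j i).
  rewrite [\row_j _]row_sum_delta linear_sum /= summxE proj_sum; apply: eq_bigr => j _.
  rewrite linearZ /= !mxE ring_projM; congr (_ * _).
  by have [_ ->] := qE j i.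
have coefq (U : rees Q) j i n : (val (U * q j i))`_n =
    if n is n'.+1 then (val U)`_n' * (a * al j i + b * be j i) else 0.
  by rewrite [U * _]mulrC coef_mon1 //; case: n => // n; rewrite [LHS]mulrC.
have hex j : exists w, idmul Q I (lc (al j) f - b * w) /\ idmul Q I (lc (be j) f + a * w).
  apply: koszul_div; have : eps (\row_i proj (q j i)) = 0.
    apply/phi_eps; exists (delta_mx 0 j); apply/rowP => i; rewrite mxE.
    by have [_ ->] := qE j i.
  move=> /(eps_eq0 QI epsf)/(_ 1%N); congr (submod_set _ _).
  rewrite !mulr_sumr -big_split; apply: eq_bigr => i _ /=.
  by rewrite val_mon1 // coefZ coefX mulr1; ring.
have {hex}[h hE] := choice hex.
rewrite -[r1]muln1 -{1}[r1]card_ord.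
apply: (@rel_length_basis _ _ _ _ m 1 _ (fun j => (h j : A^o))).
- exact: rel_length_max.
- exact: (sub_colon QP QI).
- move=> j; have [H1 H2] := hE j; apply/colonP; split.
    have -> : a * h j = lc (be j) f + a * h j - lc (be j) f by ring.
    apply: idealB; first exact: (idmulQI_sub QI).
    by apply: ideal_sum => i _; exact: ideal_mull.
  apply: ideal_congr (idmulQI_sub QI H1) _.
  by apply: ideal_sum => i _; exact: ideal_mull.
- move=> x j mx; apply: (max_colon koszul_ab QP QI mI2) => //.
  have [H1 H2] := hE j; apply/colonP; split.
    have -> : a * h j = lc (be j) f + a * h j - lc (be j) f by ring.
    apply: idealB; first exact: (idmulQI_sub QI).
    by apply: ideal_sum => i _; exact: ideal_mull.
  apply: ideal_congr (idmulQI_sub QI H1) _.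
  by apply: ideal_sum => i _; exact: ideal_mull.
- move=> w /colonP[/I2_span[al' al'E] /I2_span[be' be'E]].
  (* Expansions of a w and b w on the f_i give a relation, because a (b w) = b (a w). The constant
     parts c of its preimage under phi are the coefficients of w on the h_j. *)
  pose p i := rees_mon Q 1 (a * be' i + b * - al' i).
  have Qp i : idpow Q 1 (a * be' i + b * - al' i).
    by rewrite idpow1; apply: idealD; apply: ideal_mulr; [exact: Qa QP|exact: Qb QP].
  have : eps (\row_i proj (p i)) = 0.
    apply/(eps_eq0 QI epsf) => n.
    case: n => [|[|n]].
    + rewrite big1 => [|i _]; first exact: ideal0.
      by rewrite val_mon1 // coefZ coefX mulr0 mul0r.
    + rewrite idmul_powQS idpow1 idmulC; apply/(idmulQP QP).
      exists (lc be' f - b * w), (a * w - lc al' f); split=> //.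
        exact: ideal_subC.
      have -> : a * (lc be' f - b * w) + b * (a * w - lc al' f) =
          a * lc be' f - b * lc al' f by ring.
      rewrite !mulr_sumr -sumrB; apply: eq_bigr => i _ /=.
      by rewrite val_mon1 // coefZ coefX mulr1; ring.
    + rewrite big1 => [|i _]; first exact: ideal0.
      by rewrite val_mon1 // coefZ coefX mulr0 mul0r.
  move=> /phi_eps[u]; have [U ->] := row_lift u; move=> /rowP phiU.
  pose c j := (val (U j))`_0; exists c.
  have mc i : m (be' i - \sum_j c j * al j i).
    have := phiU i; rewrite phi_row mxE => /fiber_eq/(_ 1%N).
    rewrite raddf_sum coef_sum val_mon1 // coefZ coefX mulr1 idpow1 idmulC.
    under eq_bigr do rewrite coefq.
    have -> : \sum_j (val (U j))`_0 * (a * al j i + b * be j i) -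
        (a * be' i + b * - al' i) = a * (\sum_j c j * al j i - be' i) +
        b * (\sum_j c j * be j i + al' i).
      rewrite mulrBr mulrDr !mulr_sumr addrACA -big_split /=.
      rewrite opprD mulrN opprK; congr (_ + _); apply: eq_bigr => j _.
      by rewrite /c; ring.
    by move=> /(idmulQ_coef koszul_ab QP (subset_trans QI Im))[/ideal_subC].
  apply: (QI_b koszul_ab QP QI).
  have H1 : idmul Q I (lc be' f - \sum_i (\sum_j c j * al j i) * f i).
    rewrite -sumrB; apply: ideal_sum => i _.
    by rewrite -mulrBl; exact: mf.
  have H2 : idmul Q I (\sum_i (\sum_j c j * al j i) * f i - b * lc c h).
    under eq_bigr do rewrite mulr_suml.
    rewrite exchange_big mulr_sumr -sumrB; apply: ideal_sum => j _ /=.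
    under eq_bigr do rewrite -mulrA.
    rewrite -mulr_sumr mulrCA -mulrBr; apply: ideal_mull.
    by have [] := hE j.
  by rewrite mulrBr; exact: ideal_subT be'E (ideal_subT H1 H2).
move=> c Ic j.
have swap (k : 'I_r1 -> 'I_r0 -> A) :
    \sum_i (\sum_j c j * k j i) * f i = \sum_j c j * lc (k j) f.
  under eq_bigr do rewrite mulr_suml.
  rewrite exchange_big; apply: eq_bigr => l _; rewrite mulr_sumr.
  by apply: eq_bigr => i _; rewrite mulrA.
(* Modulo QI the combination of the f_i with these coefficients is b times the sum of the c_j h_j,
   which lies in bI; independence of the f_i applies. So phi kills the constants c. *)
have mal i : m (\sum_j c j * al j i).
  apply: (free_f (fun i => \sum_j c j * al j i)); rewrite swap.
  apply: ideal_cong (I_QIb QP Ic).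
  rewrite mulr_sumr -sumrB; apply: ideal_sum => l _.
  by rewrite mulrCA -mulrBr; apply: ideal_mull; have [] := hE l.
have mbe i : m (\sum_j c j * be j i).
  apply: (free_f (fun i => \sum_j c j * be j i)); rewrite swap.
  apply: ideal_cong (idealN (I_QIa QP Ic)).
  rewrite mulr_sumr -sumrN -sumrB; apply: ideal_sum => l _.
  by rewrite opprK mulrCA -mulrDr; apply: ideal_mull; have [] := hE l.
have : \row_j proj (reesC Q (c j)) = 0.
  apply: phi_inj; rewrite linear0; apply/rowP => i; rewrite phi_row mxE.
  apply/fiber_eq0 => n; rewrite raddf_sum coef_sum.
  under eq_bigr do rewrite coefq.
  case: n => [|[|n]].
  - by rewrite big1 //; exact: ideal0.
  - rewrite idpow1 idmulC; apply/(idmulQP QP).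
    exists (\sum_j c j * al j i), (\sum_j c j * be j i); split=> //.
    rewrite !mulr_sumr -big_split; apply: eq_bigr => l _ /=; rewrite coefC /=; ring.
  - by rewrite big1 => [|l _]; rewrite ?coefC ?mul0r //; exact: ideal0.
move=> /rowP/(_ j); rewrite !mxE => /fiber_eq0/(_ 0%N).
by rewrite coefC idmulT.
Qed.

End FromResolution.

(** * Depth and Hilbert function *)

Section Consequences.
Variables (A : comNzRingType) (m I Q : ideal A) (a b : A).
Hypotheses (mloc : local_ring m) (koszul_ab : koszul_exact a b).
Hypothesis QP : forall x, Q x <-> exists u v, x = u * a + v * b.
Hypotheses (QI : Q `<=` I) (Im : I `<=` m).
Local Notation I2 := (idpow I 2).
Implicit Types (x y : A).

Section Depth.
Hypotheses (I3 : idpow I 3 = idmul Q I2) (radI : radical I = m).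
Local Notation proj := (ring_proj (Defs.span (reesC I @` I : set (rees I)^o))).

(** As m = rad I, a power of p has constant coefficient in I, which is zero in G; removing it leaves
    a multiple of t. Cubing reaches degree 3, from which on I^i = Q I^(i-1). *)
Lemma graded_nilpotent (p : rees I) : m (val p)`_0 ->
  exists n q, proj p ^+ n = proj q /\ forall i, (i < 3)%N -> (val q)`_i = 0.
Proof.
rewrite -radI => -[n pn]; pose r := p ^+ n.
have r0 : I (val r)`_0.
  suff -> : (val r)`_0 = (val p)`_0 ^+ n by [].
  rewrite /r; elim: (n) => [|k IH]; first by rewrite !expr0 rmorph1 coef1.
  by rewrite !exprS rmorphM coef0M IH.
have projX s k : proj s ^+ k = proj (s ^+ k).
  elim: k => [|k IH]; first by rewrite !expr0.
  by rewrite !exprS IH ring_projM.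
pose q := r - reesC I (val r)`_0.
have rq : proj r = proj q.
  apply/quo_projP; rewrite opprB addrC subrK; apply: Defs.sub_span.
  by exists (val r)`_0.
exists (n * 3)%N, (q ^+ 3); split; first by rewrite exprM projX -/r rq projX.
have [s sE] : exists s : {poly A}, val q = 'X * s.
  exists (\poly_(i < size (val q)) (val q)`_i.+1); apply/polyP => -[|i].
    by rewrite coefXM raddfB coefB /= coefC subrr.
  rewrite coefXM coef_poly /=; case: ltnP => // qi.
  by rewrite nth_default // leqW.
move=> i i3; have -> : val (q ^+ 3) = val q ^+ 3 by exact: rmorphXn.
by rewrite sE exprMn coefXnM i3.
Qed.

(** Powers of a regular z are regular, yet some power has a lift q without terms below degree 3.
    Each q_i is then in Q I^(i-1) and Qx is in I^2, so x q_i is in I^(i+1): this power kills the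
    nonzero class of x. *)
Lemma depth_assoc_graded x : colon I a b x -> ~ I x ->
  depth (assoc_graded_max I m) 0.
Proof.
move=> /colonP[ax bx] nIx; split.
  exists [::]; split=> //; split=> // /span0P /(ring_proj_eq0 I)/(_ 0%N).
  rewrite idmulT rmorph1 coef1 => /Im; exact: max_proper.
move=> k [s [sk sM [reg _]]]; case: s sk sM reg => [<- //|z s] _ sM reg; exfalso.
have zreg (y : assoc_graded I) : z * y = 0 -> y = 0.
  by move=> zy; apply/span0P; apply: (reg 0%N) => //; apply/span0P.
have [p mp pz] := sM z (mem_head _ _).
have [n [q [pnq q3]]] := graded_nilpotent mp.
have yn0 (y : assoc_graded I) : z ^+ n * y = 0 -> y = 0.
  elim: (n) => [|i IH]; first by rewrite mul1r.
  by rewrite exprS -mulrA => /zreg/IH.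
suff /yn0/(ring_proj_eq0 I)/(_ 0%N) : z ^+ n * proj (reesC I x) = 0.
  by rewrite coefC idmulT.
rewrite -pz pnq -ring_projM; apply/(ring_proj_eq0 I) => i.
rewrite mulrC rmorphM coefCM.
have [i3|] := ltnP i 3; first by rewrite q3 // mulr0; exact: ideal0.
move=> /subnK; rewrite addn3 => <-; set j := (i - 3)%N.
have : idmul Q (idpow I j.+2) (val q)`_j.+3.
  have <- : idpow I j.+3 = idmul Q (idpow I j.+2); last exact: rees_in.
  by rewrite (idpow_form I3 j.+1) (idpow_form I3 j); exact: idmulCA.
apply: (idmul_ind (f := fun y => x * y)) => [*|*|u v /QP[c [d ->]] Iv].
- exact: mulrDr.
- exact: mulrCA.
have -> : x * ((c * a + d * b) * v) = (c * (a * x) + d * (b * x)) * v by ring.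
have -> : idmul I (idpow I j.+3) = idmul I2 (idpow I j.+2).
  have -> : I2 = idmul I I by rewrite -{3}(idpow1 I).
  exact: idmulA.
by apply: idmul_mem => //; apply: idealD; exact: ideal_mull.
Qed.

End Depth.

Section Hilbert.
Variables (c e : nat) (h : 'I_c -> A) (f : 'I_e -> A).
Hypotheses (hf : sally_basis m I Q a b h f) (I3 : idpow I 3 = idmul Q I2).
Hypothesis mI2 : idmul m I2 `<=` idmul Q I.

Lemma rel_length_idpowQ q n : rel_length Q (fullsub A^o) q ->
  rel_length (idpow Q n) (fullsub A^o) (q * 'C(n.+1, 2)).
Proof.
move=> Qq; elim: n => [|n IH]; first by rewrite bin_small // muln0; exact: rel_length0.
rewrite binS bin1 mulnDr addnC (mulnC q n.+1).
exact: rel_lengthD (rel_length_powQ koszul_ab QP n (@subset_refl _ Q) Qq) IH.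
Qed.

(** The length of A/IQ^(n+1) is computed twice: through I^(n+2), where a component of the Sally
    module appears, and through Q^(n+1), where Q^(n+1)/IQ^(n+1) is free of rank n + 2 over A/I. *)
Lemma hilbert_function q l n : rel_length Q (fullsub A^o) q ->
  rel_length I (fullsub A^o) l -> exists2 L, rel_length (idpow I n.+2) (fullsub A^o) L
    & (c * n.+2 + e * n.+1 + L = n.+2 * l + q * 'C(n.+2, 2))%N.
Proof.
move=> Qq Il.
have IQl := rel_lengthD (rel_length_powQ koszul_ab QP n.+1 QI Il) (rel_length_idpowQ n.+1 Qq).
have Sl := rel_length_sally mloc koszul_ab QP QI Im mI2 hf I3 n.
have [L Ll] : exists L, rel_length (idpow I n.+2) (fullsub A^o) L.
  by apply: rel_length_within IQl _ _ _ => //; exact: rel_length_sub Sl.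
exists L => //; exact: is_max_uniq (rel_lengthD Sl Ll) IQl.
Qed.

(** The Hilbert coefficients presuppose that A/I^n has finite length for large n, and the reduction
    puts such a power of I inside Q. *)
Lemma hilbert_coefficients_finite (red : is_reduction Q I) e0 e1 e2 :
  hilbert_coefficients I e0 e1 e2 ->
  exists q l, rel_length Q (fullsub A^o) q /\ rel_length I (fullsub A^o) l.
Proof.
move=> [N HN]; have [_ [k kE]] := red.
have [L /has_length_quo HL _] := HN (N + k)%N (leq_addr _ _).
have IQ : idpow I (N + k).+1 `<=` Q.
  have {}kE : idpow I k.+1 = idmul Q (idpow I k) by exact: submod_ext.
  elim: (N) => [|j IH]; first by rewrite add0n kE; exact: idmul_subl.
  by rewrite addSn; apply: subset_trans IH; exact: idmul_subr.
have [q Qq] := rel_length_within HL IQ (@subsetT _ _ : Q `<=` fullsub A^o) (@subset_refl _ _).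
have [l Il] := rel_length_within Qq QI (@subsetT _ _ : I `<=` fullsub A^o) (@subset_refl _ _).
by exists q, l.
Qed.

(** Three consecutive values suffice: the second difference is x, and a first difference then gives
    y. *)
Lemma binomial_poly_eq0 (x y z : int) N :
  (forall n : nat, (N <= n)%N -> x * 'C(n + 2, 2)%:Z - y * 'C(n + 1, 1)%:Z + z = 0) ->
  [/\ x = 0, y = 0 & z = 0].
Proof.
move=> H.
have binE k : 'C(k.+3, 2)%:Z = 'C(k.+2, 2)%:Z + k%:Z + 2 by rewrite binS bin1; lia.
have := H N (leqnn _); have := H N.+1 (leqnSn _); have := H N.+2 (leqW (leqnSn _)).
rewrite !bin1 !addn2 !addn1 !binE; set t := Posz 'C(_, _) => H2 H1 H0.
have x0 : x = 0 by nia.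
by rewrite x0 in H0 H1 *; split=> //; nia.
Qed.

(** Substituting C(n+1, 2) = C(n+2, 2) - (n+1) in [hilbert_function] gives a polynomial with leading
    coefficient l(A/Q). It is valid from n = 1 on because the Sally lengths are given from degree 1
    on. *)
Lemma hilbert_coefficients_sally (red : is_reduction Q I) e0 e1 e2 :
  hilbert_coefficients I e0 e1 e2 -> exists l,
  [/\ has_length (quo I) l, e1 = e0 - l%:Z + (c + e)%:Z, e2 = e%:Z
    & forall n, (1 <= n)%N -> exists2 L, has_length (quo (idpow I n.+1)) L
      & L%:Z = e0 * 'C(n + 2, 2)%:Z - e1 * 'C(n + 1, 1)%:Z + e%:Z].
Proof.
move=> hilb; have [q [l [Qq Il]]] := hilbert_coefficients_finite red hilb.
have len n : (1 <= n)%N -> exists2 L, has_length (quo (idpow I n.+1)) L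
    & L%:Z = q%:Z * 'C(n + 2, 2)%:Z - (q%:Z - l%:Z + (c + e)%:Z) * 'C(n + 1, 1)%:Z + e%:Z.
  case: n => // n _; have [L HL LE] := hilbert_function n Qq Il.
  exists L; first exact/has_length_quo.
  rewrite bin1 addn2 addn1 binS bin1; move: LE; set t := 'C(_, _); nia.
have [N HN] := hilb.
have [x0 y0 z0] : [/\ e0 - q%:Z = 0, e1 - (q%:Z - l%:Z + (c + e)%:Z) = 0 & e2 - e%:Z = 0].
  apply: (@binomial_poly_eq0 _ _ _ N.+1) => n Nn.
  have [L /has_length_quo HL LE] := HN n (ltnW Nn).
  have [L' /has_length_quo HL' LE'] := len n (leq_trans (ltn0Sn _) Nn).
  rewrite (is_max_uniq HL HL') LE' in LE.
  by rewrite !mulrBl; move: LE; set s := _%:Z; set t := Posz 'C(n + 1, 1); nia.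
have e0E : e0 = q%:Z by lia.
have e1E : e1 = q%:Z - l%:Z + (c + e)%:Z by lia.
exists l; rewrite e0E e1E; split=> //; first exact/has_length_quo; lia.
Qed.

End Hilbert.

(** The rank c > 0 is the dimension of (I^2 : Q)/I, so this quotient is nonzero and an adapted basis
    exists; the number of its h_j is the same dimension. *)
Lemma resolution_basis (hk : m_kills_sally I Q m) c : (0 < c)%N ->
  min_free_resolution (fiberT_gr Q m) (sallyB_gr hk) c (-2) 4 (-1) ->
  [/\ idpow I 3 = idmul Q I2, idmul m I2 `<=` idmul Q I, rel_length (idmul Q I) I2 4
    & exists e (h : 'I_c -> A) (f : 'I_e -> A),
        sally_basis m I Q a b h f /\ (c + c + e = 4)%N].
Proof.
move=> c0 res; have mI2 := m_kills_I2 QI hk.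
have [I3 l4 lc] := resolution_data mloc koszul_ab QP QI Im res.
split=> //.
have [x Wx nIx] : exists2 x, colon I a b x & ~ I x.
  apply: contrapT => noW; have WI : colon I a b = I.
    apply: submod_eqP => [x Wx|]; last exact: (sub_colon QP QI).
    by apply: contrapT => nIx; apply: noW; exists x.
  by rewrite WI in lc; rewrite (is_max_uniq lc (rel_length0 I)) in c0.
have [[h [f hf]]|[h [f hf]]] := sally_basis_exists mloc koszul_ab QP QI mI2 l4 Wx nIx.
  have E := is_max_uniq lc (rel_length_colon mloc koszul_ab QP QI mI2 hf).
  by subst c; exists 2%N, h, f.
have E := is_max_uniq lc (rel_length_colon mloc koszul_ab QP QI mI2 hf).
by subst c; exists 0%N, h, f.
Qed.

End Consequences.

(** * Assembly of the equivalence and of the two cases *)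

Theorem proposition3p9 (A : comNzRingType) (m I Q : ideal A)
    (hlocal : local_ring m) (hCM : cohen_macaulay m) (hdim : krull_dim A 2)
    (hinf : infinite_set [set: quo_ring m])
    (hI : primary_to m I)
    (hQ : parameter_ideal m Q) (hred : is_reduction Q I) :
  let cond1 :=
    [/\ idpow I 3 = idmul Q (idpow I 2) :> set A,
        idmul m (idpow I 2) `<=` idmul Q I,
        has_length (subquo (idmul Q I) (idpow I 2)) 4
      & exists2 l, has_length (subquo (idmul (idpow Q 2) I) (idpow I 3)) l
                 & (l < 8)%N] in
  let case_i (h : m_kills_sally I Q m) :=
    min_free_resolution (fiberT_gr Q m) (sallyB_gr h) 1 (-2) 4 (-1) in
  let case_ii (h : m_kills_sally I Q m) :=
    min_free_resolution (fiberT_gr Q m) (sallyB_gr h) 2 (-2) 4 (-1) in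
  [/\ cond1 <-> (exists h, case_i h \/ case_ii h),
      cond1 -> depth (assoc_graded_max I m) 0,
      forall h, case_i h ->
        has_length (subquo (idmul (idpow Q 2) I) (idpow I 3)) 7 /\
        forall e0 e1 e2 : int, hilbert_coefficients I e0 e1 e2 ->
        [/\ exists2 l, has_length (quo I) l & e1 = e0 - l%:Z + 3,
            exists2 l, has_length (quo I) l & e1 = e0 - l%:Z + e2 + 1
          & forall n : nat, (1 <= n)%N ->
            exists2 l, has_length (quo (idpow I n.+1)) l
              & l%:Z = e0 * 'C(n + 2, 2)%:Z - e1 * 'C(n + 1, 1)%:Z + 2]
    & forall h, case_ii h ->
        has_length (subquo (idmul (idpow Q 2) I) (idpow I 3)) 6 /\
        forall e0 e1 e2 : int, hilbert_coefficients I e0 e1 e2 ->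
        [/\ exists2 l, has_length (quo I) l & e1 = e0 - l%:Z + 2,
            exists2 l, has_length (quo I) l & e1 = e0 - l%:Z + e2 + 2
          & forall n : nat, (1 <= n)%N ->
            exists2 l, has_length (quo (idpow I n.+1)) l
              & l%:Z = e0 * 'C(n + 2, 2)%:Z - e1 * 'C(n + 1, 1)%:Z]].
Proof.
move=> cond1 case_i case_ii.
have [a [b [koszul_ab QP]]] := parameter_koszul hlocal hCM hdim hQ.
have [QI _] := hred; have [_ radI] := hI.
have Im : I `<=` m by move=> x Ix; rewrite -radI; exists 1%N; rewrite expr1.
have QI2 : idmul Q I `<=` idpow I 2 := idmulQI_sub QI.
have Q2I : idmul (idpow Q 2) I `<=` idpow I 3.
  by rewrite /= !idmulT idmulC; apply: idmulS => //; exact: idmulS.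
have basis : cond1 -> [/\ idpow I 3 = idmul Q (idpow I 2),
    idmul m (idpow I 2) `<=` idmul Q I, rel_length (idmul Q I) (idpow I 2) 4
    & exists2 x, colon I a b x & ~ I x].
  move=> [I3s mI2 /(has_length_subquo _ QI2) l4 [l /(has_length_subquo _ Q2I) l3 l8]].
  have I3 : idpow I 3 = idmul Q (idpow I 2) by exact: submod_ext.
  by split=> //; exact: (colon_nontrivial hlocal koszul_ab QP QI mI2 I3 l4 l3 l8).
have length3 (hk : m_kills_sally I Q m) c : (0 < c)%N ->
    min_free_resolution (fiberT_gr Q m) (sallyB_gr hk) c (-2) 4 (-1) ->
    exists2 e, has_length (subquo (idmul (idpow Q 2) I) (idpow I 3)) (c * 3 + e * 2)
      & (c + c + e = 4)%N.
  move=> c0 res.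
  have [I3 mI2 _ [e [h [f [hf ce]]]]] := resolution_basis hlocal koszul_ab QP QI Im c0 res.
  exists e => //; apply/(has_length_subquo _ Q2I); rewrite idmulC.
  exact: (rel_length_sally hlocal koszul_ab QP QI Im mI2 hf I3 1).
have back (hk : m_kills_sally I Q m) c : (0 < c)%N ->
    min_free_resolution (fiberT_gr Q m) (sallyB_gr hk) c (-2) 4 (-1) -> cond1.
  move=> c0 res; have [e l3 ce] := length3 hk c c0 res.
  have [I3 mI2 l4 _] := resolution_basis hlocal koszul_ab QP QI Im c0 res.
  split=> //; first by rewrite I3.
    exact/(has_length_subquo _ QI2).
  (* With c + c + e = 4 this is 8 - c, below 8 because c > 0. *)
  exists (c * 3 + e * 2)%N => //; lia.
have hilb (hk : m_kills_sally I Q m) c e0 e1 e2 : (0 < c)%N ->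
    min_free_resolution (fiberT_gr Q m) (sallyB_gr hk) c (-2) 4 (-1) ->
    hilbert_coefficients I e0 e1 e2 -> exists e, (c + c + e = 4)%N /\ exists l,
    [/\ has_length (quo I) l, e1 = e0 - l%:Z + (c + e)%:Z, e2 = e%:Z
    & forall n, (1 <= n)%N -> exists2 L, has_length (quo (idpow I n.+1)) L
      & L%:Z = e0 * 'C(n + 2, 2)%:Z - e1 * 'C(n + 1, 1)%:Z + e%:Z].
  move=> c0 res.
  have [I3 mI2 _ [e [h [f [hf ce]]]]] := resolution_basis hlocal koszul_ab QP QI Im c0 res.
  move=> H; exists e; split=> //.
  exact: (hilbert_coefficients_sally hlocal koszul_ab QP QI Im hf I3 mI2 hred H).
split.
- split=> [/basis[I3 mI2 l4 [x Wx nIx]]|[hk [|]]]; [|exact: back|exact: back].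
  exists (m_kills_sallyP QI I3 mI2).
  have [[h [f hf]]|[h [f hf]]] := sally_basis_exists hlocal koszul_ab QP QI mI2 l4 Wx nIx.
    (* The rank [c + c + e] computes to 4, as 1 + 1 + 2 here and 2 + 2 + 0 in the other case. *)
    by left; exact: (sally_resolution koszul_ab QP QI Im _ hf I3).
  by right; exact: (sally_resolution koszul_ab QP QI Im _ hf I3).
- move=> /basis[I3 _ _ [x Wx nIx]].
  exact: (depth_assoc_graded hlocal QP Im I3 radI Wx nIx).
- move=> hk res; split.
    by have [e + ce] := length3 hk 1%N isT res; have -> : e = 2%N by lia.
  move=> e0 e1 e2 H; have [e [ce [l [Il e1E e2E len]]]] := hilb hk 1%N e0 e1 e2 isT res H.
  have {ce}eE : e = 2%N by lia.
  rewrite {}eE in e1E e2E len; split=> //; exists l => //; lia.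
- move=> hk res; split.
    by have [e + ce] := length3 hk 2%N isT res; have -> : e = 0%N by lia.
  move=> e0 e1 e2 H; have [e [ce [l [Il e1E e2E len]]]] := hilb hk 2%N e0 e1 e2 isT res H.
  have {ce}eE : e = 0%N by lia.
  rewrite {}eE in e1E e2E len; split=> [||n n1]; try by exists l => //; lia.
  by have [L HL LE] := len n n1; exists L; rewrite // LE addr0.
Qed.
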